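(* Let $0\le\alpha<1$ and let $\Omega=\mathbb R$ or $\Omega=\mathbb T$. Let $\omega\subset\Omega$ be an open subset such that $\Omega\setminus\omega$ has nonempty interior. Then for every $T>0$ the fractional heat equation $$(\partial_t+(-\Delta)^{\alpha/2})f(t,x)=\mathds 1_\omega u(t,x),\qquad t\in[0,T],\ x\in\Omega,$$ is not null-controllable on $\omega$ in time $T$.
   Context: $\mathbb T=\mathbb R/2\pi\mathbb Z$, and $\mathds 1_\omega$ is the indicator function of $\omega$. All functions are complex-valued. The fractional Laplacian is defined spectrally: if $\Omega=\mathbb R$, $(-\Delta)^{\alpha/2}f=\mathcal F^{-1}(|\xi|^\alpha\mathcal F f)$ with $\mathcal F$ the Fourier transform; if $\Omega=\mathbb T$, $c_n((-\Delta)^{\alpha/2}f)=|n|^\alpha c_n(f)$ where $c_n(f)$ is the $n$-th Fourier coefficient, $n\in\mathbb Z$. Solutions are understood in the (mild) sense of the strongly continuous semigroup on $L^2(\Omega)$ generated by $-(-\Delta)^{\alpha/2}$. Definition: the equation is null-controllable on $\omega$ in time $T>0$ if for every $f_0\in L^2(\Omega)$ there exists $u\in L^2([0,T]\times\omega)$ such that the solution $f$ with initial condition $f(0,\cdot)=f_0$ satisfies $f(T,\cdot)=0$ on $\Omega$. *)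

(* Defs.v *)
From HB Require Import structures.
From mathcomp Require Import all_boot all_order all_algebra.
From mathcomp Require Import complex.
From mathcomp Require Import all_classical all_reals all_analysis.

Set Implicit Arguments.
Unset Strict Implicit.
Unset Printing Implicit Defensive.

Import Order.TTheory GRing.Theory Num.Theory.
Import numFieldNormedType.Exports.

Local Open Scope classical_set_scope.
Local Open Scope ring_scope.
Local Open Scope complex_scope.

Section ComplexL2.
Context {R : realType} {d : measure_display} {X : measurableType d}.
Variable mu : {measure set X -> \bar R}.

Definition Cmeasurable (D : set X) (f : X -> R[i]) : Prop :=
  measurable_fun D (fun x => complex.Re (f x)) /\
  measurable_fun D (fun x => complex.Im (f x)).

Definition Cintegrable (D : set X) (f : X -> R[i]) : Prop :=
  mu.-integrable D (fun x => (complex.Re (f x))%:E) /\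
  mu.-integrable D (fun x => (complex.Im (f x))%:E).

Definition Cintegral (D : set X) (f : X -> R[i]) : R[i] :=
  Rintegral mu D (fun x => complex.Re (f x)) +i*
  Rintegral mu D (fun x => complex.Im (f x)).

Definition L2norm (D : set X) (f : X -> R[i]) : \bar R :=
  ('N[mu]_(2%:E) [ (fun x => (Normc.normc (f x))%:E) \_ D ])%E.

(* Elements of L^2(D) are represented by functions defined on the whole of X
   whose values outside D are irrelevant; equality in L^2(D) is [eqL2]. *)
Definition L2 (D : set X) (f : X -> R[i]) : Prop :=
  Cmeasurable D f /\ (L2norm D f < +oo)%E.

Definition eqL2 (D : set X) (f g : X -> R[i]) : Prop :=
  {ae mu, forall x, D x -> f x = g x}.

Definition inner (D : set X) (f g : X -> R[i]) : R[i] :=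
  Cintegral D (fun x => f x * (g x)^*).

End ComplexL2.

Section Semigroups.
Context {R : realType}.
Notation leb := (@lebesgue_measure R).
Implicit Types (D : set R) (f g : R -> R[i]) (S : R -> (R -> R[i]) -> R -> R[i]).

(* Only the times t >= 0 and the functions in L^2(D) matter. *)
Record c0_semigroup D S : Prop := C0Semigroup {
  c0_L2 : forall t f, 0 <= t -> L2 leb D f -> L2 leb D (S t f);
  c0_eqL2 : forall t f g, 0 <= t -> L2 leb D f -> L2 leb D g ->
    eqL2 leb D f g -> eqL2 leb D (S t f) (S t g);
  c0_linear : forall t (a : R[i]) f g, 0 <= t -> L2 leb D f -> L2 leb D g ->
    eqL2 leb D (S t (fun x => a * f x + g x)) (fun x => a * S t f x + S t g x);
  c0_bounded : forall t, 0 <= t -> exists M : R, forall f, L2 leb D f ->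
    (L2norm leb D (S t f) <= M%:E * L2norm leb D f)%E;
  c0_id : forall f, L2 leb D f -> eqL2 leb D (S 0 f) f;
  c0_add : forall s t f, 0 <= s -> 0 <= t -> L2 leb D f ->
    eqL2 leb D (S (s + t) f) (S s (S t f));
  c0_continuous : forall f, L2 leb D f ->
    L2norm leb D (fun x => S t f x - f x) @[t --> 0^'+] --> 0%E }.

Definition generator D S f g : Prop :=
  [/\ L2 leb D f, L2 leb D g &
      L2norm leb D (fun x => (t^-1)%:C * (S t f x - f x) - g x)
        @[t --> 0^'+] --> 0%E].

(* An unbounded operator A on L^2(D) is given by its graph:
   [A f g] means that f is in the domain of A and A f = g. *)
Definition semigroup_generated_by D (A : (R -> R[i]) -> (R -> R[i]) -> Prop) S
    : Prop :=
  c0_semigroup D S /\ (forall f g, generator D S f g <-> A f g).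

(* v is the integral over I of the L^2(D)-valued function F. The integral is
   taken in the weak sense, which agrees with the Bochner integral whenever
   the latter exists. *)
Definition is_L2_integral D (I : set R) (F : R -> R -> R[i]) (v : R -> R[i])
    : Prop :=
  [/\ L2 leb D v,
      {ae leb, forall s, I s -> L2 leb D (F s)} &
      forall g, L2 leb D g ->
        Cintegrable leb I (fun s => inner leb D (F s) g) /\
        inner leb D v g = Cintegral leb I (fun s => inner leb D (F s) g)].

Definition control_term (omega : set R) (u : R * R -> R[i]) (s x : R) : R[i] :=
  (\1_omega x)%:C * u (s, x).

(* Duhamel's formula
     f(t) = S(t) f0 + \int_0^t S(t - s) (1_omega u(s)) ds,   0 <= t <= T. *)
Definition mild_solution D S (omega : set R) (T : R) (f0 : R -> R[i])
    (u : R * R -> R[i]) (f : R -> R -> R[i]) : Prop :=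
  forall t, 0 <= t <= T ->
    L2 leb D (f t) /\
    is_L2_integral D `[0, t] (fun s => S (t - s) (control_term omega u s))
      (fun x => f t x - S t f0 x).

(* The Borel representative u of the control can be chosen with u(s, .) in
   L^2 for every s, so that the integrand above causes no measurability issue
   on a null set of times. *)
Definition null_controllable D S (omega : set R) (T : R) : Prop :=
  forall f0, L2 leb D f0 ->
  exists u : R * R -> R[i],
    L2 (leb \x leb)%E (`[0, T] `*` (omega `&` D)) u /\
    exists f : R -> R -> R[i],
      mild_solution D S omega T f0 u f /\ eqL2 leb D (f T) (fun=> 0).

End Semigroups.

Section FractionalLaplacian.
Context {R : realType}.
Notation leb := (@lebesgue_measure R).
Implicit Types (f g F G : R -> R[i]).

Definition cis (x : R) : R[i] := cos x +i* sin x.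

Definition fourier_truncated (n : nat) f (xi : R) : R[i] :=
  Cintegral leb `[- n%:R, n%:R] (fun x => f x * cis (- (x * xi))).

(* F is the Fourier-Plancherel transform of f in L^2(R): the L^2-limit of the
   Fourier integrals of the truncations of f to [-n, n]. *)
Definition is_fourier f F : Prop :=
  [/\ L2 leb setT f, L2 leb setT F &
      L2norm leb setT (fun xi => fourier_truncated n f xi - F xi)
        @[n --> \oo] --> 0%E].

Definition fourier_coef (n : int) f : R[i] :=
  ((2 * pi)^-1)%:C *
  Cintegral leb `[0, 2 * pi[ (fun x => f x * cis (- (n%:~R * x))).

(* Since powR 0 0 = 1, both operators below are the identity for alpha = 0. *)
Definition frac_laplacian_line (alpha : R) f g : Prop :=
  exists F G, [/\ is_fourier f F, is_fourier g G &
    eqL2 leb setT G (fun xi => (`|xi| `^ alpha)%:C * F xi)].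

Definition frac_laplacian_torus (alpha : R) f g : Prop :=
  [/\ L2 leb `[0, 2 * pi[ f, L2 leb `[0, 2 * pi[ g &
      forall n : int,
        fourier_coef n g = (`|n%:~R| `^ alpha)%:C * fourier_coef n f].

End FractionalLaplacian.

(* Omega = R or Omega = T = R / 2 pi Z. Functions on T are functions on the
   fundamental domain [0, 2 pi[, while subsets of T are 2 pi-periodic subsets
   of R; by definition of the quotient topology, a subset of T is open (resp.
   has nonempty interior) iff the corresponding periodic subset of R is open
   (resp. has nonempty interior). *)
Inductive ambient := line | torus.

Definition ambient_domain (R : realType) (Omega : ambient) : set R :=
  match Omega with line => setT | torus => `[0, 2 * pi[ end.

Definition subset_of_ambient (R : realType) (Omega : ambient) (A : set R) : Prop :=
  match Omega with
  | line => True
  | torus => forall x, A (x + 2 * pi) <-> A x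
  end.

Definition frac_laplacian (R : realType) (Omega : ambient) (alpha : R) :
    (R -> R[i]) -> (R -> R[i]) -> Prop :=
  match Omega with
  | line => frac_laplacian_line alpha
  | torus => frac_laplacian_torus alpha
  end.

Definition minus_frac_laplacian (R : realType) (Omega : ambient) (alpha : R)
    (f g : R -> R[i]) : Prop :=
  frac_laplacian Omega alpha f (fun x => - g x).

(* Main.v *)
(* By duality, if the initial state f0, the indicator of [a, a + b], can be driven
   to 0, then |<f0, q_T>| <= C sup_t ||q_t||_{L^2(omega)} for every solution q of the
   adjoint heat equation, with C independent of q. Take q whose frequency profile is
   x^n/n! at frequency x (binomial 'C(m + n, n) at frequency m on the torus), cut off
   at a frequency of order n and centred at an interior point a of the complement of
   omega. Since x |-> exp(- t x^alpha) is completely monotone for 0 <= alpha <= 1, n+1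
   integrations (or summations) by parts lose no derivative constants, and q_t is
   O((C/r)^n) at distance r from a, uniformly in t. But all frequencies contribute to
   <f0, q_T> with the same sign, so it is at least the contribution of the frequencies
   near K n, about K^n exp(- T (2 K n)^alpha); since alpha < 1 this beats (C/r)^n once
   K is large. *)
Require Import Defs.
From HB Require Import structures.
From mathcomp Require Import all_boot all_order all_algebra.
From mathcomp Require Import complex.
From mathcomp Require Import all_classical all_reals all_analysis.
From mathcomp Require Import measurable_realfun ring lra zify.
Import Order.TTheory GRing.Theory Num.Theory.
Import numFieldNormedType.Exports.
Local Open Scope classical_set_scope.
Local Open Scope ring_scope.

Set Implicit Arguments.
Unset Strict Implicit.
Unset Printing Implicit Defensive.
Local Open Scope complex_scope.

(** The semigroup is known only through its generator, and only up to null sets, so the identity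
    that moves [S t] from the state onto the test function cannot be read off a spectral formula. It
    is obtained by differentiating t |-> <S t f, q_(T-t)> for f in the domain of the generator,
    which calls for the uniform boundedness of [S] on bounded time intervals and the density of that
    domain; both are proved for seminorms, since functions equal almost everywhere are not
    identified. A single state f0 is driven to 0, and the energy of its control provides the
    constant C. The profile x^n/n! is dictated by its transform, the power -(n+1) of the distance to
    a. A sharp cut-off would create boundary terms, so the cut-off has to vanish at its end, be
    completely monotone itself, and lose only a factor c^n at the frequencies that are kept; it
    therefore sits at a fixed multiple (4 on the line, 2 on the torus) of those frequencies. K is
    tuned so that the lower bound exceeds the upper one by e^(3n), up to factors of order n and
    exp(T (c n)^alpha). *)

Lemma normc_ge0 (R : rcfType) (z : R[i]) : 0 <= Normc.normc z.
Proof. by case: z => a b; exact: sqrtr_ge0. Qed.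

Lemma normc_real (R : rcfType) (r : R) : Normc.normc r%:C = `|r|.
Proof. by rewrite /= expr0n addr0 sqrtr_sqr. Qed.

(** The supremum of the times at which [psi t <= psi 0 + e * t] holds belongs to that set by the
    left condition, and the right condition forbids it to be smaller than [T]. The hypotheses are
    one-sided because an orbit of a semigroup provides a right derivative and left continuity. *)
Lemma le_of_right_dini (R : realType) (psi : R -> R) (T : R) : 0 <= T ->
  (forall t e : R, 0 <= t < T -> 0 < e -> exists2 d : R, 0 < d &
     forall h, 0 < h <= d -> t + h <= T -> psi (t + h) <= psi t + e * h) ->
  (forall t e : R, 0 < t <= T -> 0 < e -> exists2 d : R, 0 < d &
     forall h, 0 <= h <= d -> h <= t -> psi t <= psi (t - h) + e) ->
  psi T <= psi 0.
Proof.
move=> T0 hr hl; apply/ler_addgt0Pr => e0 e00.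
pose e := e0 / (T + 1).
have e_gt0 : 0 < e by rewrite divr_gt0//; lra.
have eT : e * T <= e0.
  by rewrite /e mulrAC ler_pdivrMr; nra.
pose A := [set t | 0 <= t <= T /\ psi t <= psi 0 + e * t].
have A0 : A 0 by rewrite /A /= lexx T0 mulr0 addr0.
have supA : has_sup A by split; [exists 0|exists T => t [/andP[]]].
pose c := sup A.
have c0 : 0 <= c by have /ubP := sup_upper_bound supA; apply.
have cT : c <= T by apply: ge_sup; [exists 0|move=> t [/andP[]]].
have Ac : A c.
  split; first by rewrite c0.
  have [cc|c_gt0] := leP c 0.
    have -> : c = 0 by apply/le_anti; rewrite cc.
    by rewrite mulr0 addr0.
  apply/ler_addgt0Pr => eta eta0.
  have hcc : 0 < c <= T by rewrite c_gt0.
  have [d d0 hd] := hl c eta hcc eta0.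
  have [s [hs1 hs2] hs3] := sup_adherent d0 supA; rewrite -/c in hs3.
  have sc : s <= c by have /ubP := sup_upper_bound supA; apply.
  have := hd (c - s); rewrite subKr => /(_ ltac:(lra) ltac:(lra)) h.
  have : e * s <= e * c by rewrite ler_pM2l.
  by move: hs2 h; lra.
have [Tc|cT'] := leP T c.
  have cTe : c = T by apply/le_anti; rewrite Tc cT.
  by move: Ac; rewrite cTe => -[_ h]; lra.
have [d d0 hd] := hr c e ltac:(lra) e_gt0.
pose h := Num.min d (T - c).
have h0 : 0 < h by rewrite lt_min d0; lra.
have hd1 : h <= d by rewrite ge_min lexx.
have hd2 : h <= T - c by rewrite ge_min lexx orbT.
have : A (c + h).
  split; first lra.
  by have := hd h ltac:(lra) ltac:(lra); have [_] := Ac; rewrite mulrDr; lra.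
have /ubP/[apply] := sup_upper_bound supA; rewrite -/c; lra.
Qed.

(** * Seminorms on complex vector spaces *)

Section Seminorm.
Context {R : realType} {V : lmodType R[i]} (N : V -> R).
Hypothesis ND : forall x y, N (x + y) <= N x + N y.
Hypothesis NZ : forall (a : R[i]) x, N (a *: x) = Normc.normc a * N x.

Lemma seminorm0 : N 0 = 0.
Proof. by rewrite -(scale0r 0) NZ Normc.normc0 mul0r. Qed.

Lemma seminormN x : N (- x) = N x.
Proof. by rewrite -scaleN1r NZ normcN Normc.normc1 mul1r. Qed.

Lemma seminorm_ge0 x : 0 <= N x.
Proof.
have := ND x (- x); rewrite subrr seminorm0 seminormN; lra.
Qed.

Lemma seminormB x y : N (x - y) = N (y - x).
Proof. by rewrite -seminormN opprB. Qed.

Lemma seminorm_tri y x z : N (x - z) <= N (x - y) + N (y - z).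
Proof. by have := ND (x - y) (y - z); rewrite addrA subrK. Qed.

Lemma seminorm_leD x y : N x <= N y + N (x - y).
Proof. by have := ND y (x - y); rewrite addrC subrK. Qed.

Lemma seminormZ_real (r : R) x : N (r%:C *: x) = `|r| * N x.
Proof. by rewrite NZ normc_real. Qed.

Lemma seminorm_sum (I : Type) (s : seq I) (F : I -> V) :
  N (\sum_(i <- s) F i) <= \sum_(i <- s) N (F i).
Proof.
elim: s => [|i s IH]; first by rewrite !big_nil seminorm0.
by rewrite !big_cons (le_trans (ND _ _))// lerD2l.
Qed.

End Seminorm.

(** * Strongly continuous semigroups on a complete seminormed space, up to vectors of seminorm 0 *)

Section Semigroup.
Context {R : realType} {V : lmodType R[i]} (N : V -> R).
Hypothesis ND : forall x y, N (x + y) <= N x + N y.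
Hypothesis NZ : forall (a : R[i]) x, N (a *: x) = Normc.normc a * N x.
Hypothesis N_complete : forall u : nat -> V,
  (forall e : R, 0 < e -> exists n0, forall m n, (n0 <= m)%N -> (n0 <= n)%N ->
     N (u m - u n) <= e) ->
  exists x, forall e : R, 0 < e -> exists n0, forall n, (n0 <= n)%N -> N (u n - x) <= e.
Context (S : R -> V -> V).
Hypothesis Slin : forall (t : R) a x y, 0 <= t ->
  N (S t (a *: x + y) - (a *: S t x + S t y)) = 0.
Hypothesis Sbd : forall t : R, 0 <= t -> exists M, forall x, N (S t x) <= M * N x.
Hypothesis Sid : forall x, N (S 0 x - x) = 0.
Hypothesis Sadd : forall (s t : R) x, 0 <= s -> 0 <= t ->
  N (S (s + t) x - S s (S t x)) = 0.
Hypothesis Scont : forall x (e : R), 0 < e ->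
  exists2 d : R, 0 < d & forall t : R, 0 <= t <= d -> N (S t x - x) <= e.

Let N0 := seminorm0 NZ.
Let N_ge0 := seminorm_ge0 ND NZ.
Let NB := seminormB NZ.
Let Ntri := seminorm_tri ND.
Let NleD := seminorm_leD ND.
Let NZr := seminormZ_real NZ.

Let eqN x y : N (x - y) = 0 -> N x = N y.
Proof.
move=> h; apply/le_anti; have := NleD x y; have := NleD y x.
by rewrite NB h => h1 h2; lra.
Qed.

Let S0 (t : R) : 0 <= t -> N (S t 0) = 0.
Proof.
move=> t0; have [M /(_ 0)] := Sbd t0; rewrite N0 mulr0.
by have := N_ge0 (S t 0); lra.
Qed.

Let SD (t : R) x y : 0 <= t -> N (S t (x + y) - (S t x + S t y)) = 0.
Proof. by move=> t0; have := Slin 1 x y t0; rewrite !scale1r. Qed.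

Let SZ (t : R) a x : 0 <= t -> N (S t (a *: x) - a *: S t x) = 0.
Proof.
move=> t0; have := Slin a x 0 t0; rewrite addr0 => h.
apply/le_anti; rewrite N_ge0 andbT -h.
have := NleD (S t (a *: x) - a *: S t x) (S t (a *: x) - (a *: S t x + S t 0)).
by rewrite h add0r opprB [_ + (_ + S t 0 - _)]addrC addrA subrK addrAC subrr add0r (S0 t0).
Qed.

Let Ssub (t : R) x y : 0 <= t -> N (S t (x - y) - (S t x - S t y)) = 0.
Proof.
move=> t0; have := Slin (-1) y x t0.
by rewrite !scaleN1r (addrC (- y)) (addrC (- S t y)).
Qed.

Let opn t := sup [set N (S t x) | x in [set x | N x <= 1]].

Let opn_has_sup (t : R) : 0 <= t -> has_sup [set N (S t x) | x in [set x | N x <= 1]].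
Proof.
move=> t0; split; first by exists (N (S t 0)); exists 0 => //=; rewrite N0.
have [M hM] := Sbd t0; exists (Num.max M 0) => _ [x /= x1 <-].
rewrite (le_trans (hM x))//.
have := N_ge0 x; have : M <= Num.max M 0 by rewrite le_max lexx.
have : 0 <= Num.max M 0 by rewrite le_max lexx orbT.
by move: (Num.max _ _) => m; nra.
Qed.

Let opn_le (t : R) x : 0 <= t -> N (S t x) <= opn t * N x.
Proof.
move=> t0; have [Nx0|Nx0] := eqVneq (N x) 0.
  by have [M /(_ x)] := Sbd t0; rewrite Nx0 !mulr0.
have Nxgt : 0 < N x by rewrite lt_neqAle eq_sym Nx0 N_ge0.
rewrite -ler_pdivrMr//; have /ubP hub := sup_upper_bound (opn_has_sup t0).
have : N (S t ((N x)^-1%:C *: x)) = N (S t x) / N x.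
  by rewrite (eqN (SZ _ _ t0)) NZr ger0_norm ?invr_ge0// mulrC.
move=> <-; apply: hub; exists ((N x)^-1%:C *: x) => //=.
by rewrite NZr ger0_norm ?invr_ge0// mulVf.
Qed.

(** The ratio 3/4 only has to exceed the 1/2 that the tail of the gliding hump series takes away. *)
Let opn_ge (t : R) : 0 <= t -> 0 < opn t -> exists2 x, N x <= 1 & 3 / 4 * opn t <= N (S t x).
Proof.
move=> t0 o0; have e0 : 0 < opn t / 4 by rewrite divr_gt0.
have [_ [x /= x1 <-] h] := sup_adherent e0 (opn_has_sup t0).
by exists x => //; move: h; rewrite -/(opn t); lra.
Qed.

(* The uniform boundedness principle, by a gliding hump along times tending to 0. *)
Lemma semigroup_bounded_near0 : exists d M : R, 0 < d /\
  forall (t : R) x, 0 <= t <= d -> N (S t x) <= M * N x.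
Proof.
apply: contrapT => hn.
(* The rate is such that [3 ^- j] times the quarter surviving in the end leaves [j.+1]. *)
have unb j : exists t, 0 <= t <= j.+1%:R^-1 /\ 4 * 3 ^+ j * j.+1%:R <= opn t.
  apply: contrapT => hj; apply: hn; exists j.+1%:R^-1, (4 * 3 ^+ j * j.+1%:R).
  split=> [|t x ht]; first by rewrite invr_gt0.
  have /andP[t0 _] := ht.
  rewrite (le_trans (opn_le x t0))// ler_wpM2r//.
  by rewrite leNgt; apply/negP => h; apply: hj; exists t; split => //; exact: ltW.
have [tt htt] := choice unb.
have tt0 j : 0 <= tt j by have [/andP[]] := htt j.
have og j : 0 < opn (tt j).
  by have [_ ] := htt j; apply: lt_le_trans; rewrite !mulr_gt0// exprn_gt0.
have hump j : exists x, N x <= 1 /\ 3 / 4 * opn (tt j) <= N (S (tt j) x).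
  by have [x] := opn_ge (tt0 j) (og j); exists x.
have [yy hyy] := choice hump.
have hyy1 j : N (yy j) <= 1 by have [] := hyy j.
have hyy2 j : 3 / 4 * opn (tt j) <= N (S (tt j) (yy j)) by have [] := hyy j.
pose r j : R := (3 ^+ j)^-1.
have r0 j : 0 < r j by rewrite invr_gt0 exprn_gt0.
(* One of [x + z] and [x - z] has an image at least as large as that of [z], since the two images
   differ by twice the image of [z]. *)
have step j (x : V) : exists x', N (x' - x) <= r j /\
    r j * (3 / 4 * opn (tt j)) <= N (S (tt j) x').
  pose z := (r j)%:C *: yy j.
  have Nz : N z <= r j.
    by rewrite NZr ger0_norm ?(ltW (r0 j))// ler_piMr// ltW.
  have NSz : r j * (3 / 4 * opn (tt j)) <= N (S (tt j) z).
    rewrite (eqN (SZ _ _ (tt0 j))) NZr ger0_norm ?(ltW (r0 j))//.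
    by rewrite ler_pM2l.
  have e1 := eqN (SD x z (tt0 j)); have e2 := eqN (Ssub x z (tt0 j)).
  have h : 2 * N (S (tt j) z) <= N (S (tt j) (x + z)) + N (S (tt j) (x - z)).
    rewrite e1 e2; move: (S _ x) (S _ z) => a b.
    have := Ntri 0 (a + b) (a - b); rewrite subr0 sub0r (seminormN NZ).
    have -> : a + b - (a - b) = 2%:C *: b.
      by rewrite opprB (addrC a) addrACA subrr addr0 -mulr2n -scaler_nat; congr (_ *: _); rewrite rmorph_nat.
    by rewrite NZr ger0_norm.
  have [hh|hh] := leP (N (S (tt j) z)) (N (S (tt j) (x + z))).
    by exists (x + z); rewrite addrC addKr (le_trans NSz).
  exists (x - z); rewrite addrC addKr (seminormN NZ); split => //.
  by rewrite (le_trans NSz)//; lra.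
have [nx hnx] := choice (fun jx : nat * V => step jx.1 jx.2).
pose xs := fix xs n := if n is m.+1 then nx (m, xs m) else 0.
have xs_step j : N (xs j.+1 - xs j) <= r j by have [] := hnx (j, xs j).
have xs_big j : r j * (3 / 4 * opn (tt j)) <= N (S (tt j) (xs j.+1)).
  by have [] := hnx (j, xs j).
have rS j : r j.+1 = r j / 3.
  by rewrite /r exprS invfM mulrC.
have xs_dist j k : N (xs (j + k)%N - xs j) <= 3 / 2 * (r j - r (j + k)%N).
  elim: k => [|k IH]; first by rewrite addn0 !subrr N0 mulr0.
  rewrite addnS (le_trans (Ntri (xs (j + k)%N) _ _))//.
  by have := xs_step (j + k)%N; rewrite rS; lra.
have xs_dist' j k : (j <= k)%N -> N (xs k - xs j) <= 3 / 2 * r j.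
  by move=> jk; have := xs_dist j (k - j)%N; rewrite subnKC//; have := r0 k; lra.
have r_small e : 0 < e -> exists n0, forall n, (n0 <= n)%N -> r n <= e.
  move=> e0.
  have : (r n @[n --> \oo] --> (0 : R)).
    rewrite (_ : r = fun n => 3^-1 ^+ n); last by apply/funext => n; rewrite /r exprVn.
    by apply: cvg_expr; rewrite ger0_norm; lra.
  move/cvgrPdist_le => /(_ _ e0)[n0 _ hn0]; exists n0 => n hn1.
  by have := hn0 n hn1; rewrite sub0r normrN ger0_norm// ltW.
have [x hx] : exists x, forall e : R, 0 < e -> exists n0, forall n, (n0 <= n)%N -> N (xs n - x) <= e.
  apply: N_complete => e e0.
  have [n0 hn0] := r_small (e / 3) ltac:(lra).
  exists n0 => m n hm hn'.
  have h1 := xs_dist' _ _ hm; have h2 := xs_dist' _ _ hn'.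
  have := Ntri (xs n0) (xs m) (xs n); have := hn0 n0 (leqnn _).
  by rewrite (NB (xs n0)); lra.
have xlim j : N (xs j - x) <= 3 / 2 * r j.
  apply/ler_addgt0Pr => e e0; have [n0 hn0] := hx e e0.
  have h1 := xs_dist' j _ (leq_maxr n0 j); have h2 := hn0 _ (leq_maxl n0 j).
  by have := Ntri (xs (maxn n0 j)) (xs j) x; rewrite [N (xs j - xs _)]NB; lra.
(* The steps after the [j]-th move the point by at most [r j / 2], so of the
   [3 / 4 * (r j * opn (tt j))] gained there at least a third, one quarter of [r j * opn (tt j)],
   remains. *)
have xbig j : j.+1%:R <= N (S (tt j) x).
  have h1 := xs_big j; have h2 := xlim j.+1; rewrite rS in h2.
  have h3 := opn_le (xs j.+1 - x) (tt0 j).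
  rewrite (eqN (Ssub _ _ (tt0 j))) in h3.
  have h4 := NleD (S (tt j) (xs j.+1)) (S (tt j) x).
  have [_ h5] := htt j.
  have h6 : r j * (4 * 3 ^+ j * j.+1%:R) <= r j * opn (tt j) by rewrite ler_pM2l.
  have h7 : r j * (4 * 3 ^+ j * j.+1%:R) = 4 * j.+1%:R.
    by rewrite /r; field; rewrite expf_neq0.
  rewrite h7 in h6.
  have h8 : opn (tt j) * N (xs j.+1 - x) <= opn (tt j) * (3 / 2 * (r j / 3)).
    by rewrite ler_pM2l.
  have h9 : opn (tt j) * (3 / 2 * (r j / 3)) = (r j * opn (tt j)) / 2 by field.
  have h10 : r j * (3 / 4 * opn (tt j)) = 3 / 4 * (r j * opn (tt j)) by ring.
  by rewrite h9 in h8; rewrite h10 in h1; lra.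
have [d d0 hd] := Scont x (ltr01 : 0 < (1 : R)).
(* For this [n] the time [tt n] is below [d], where the orbit of [x] stays within 1 of [x], although
   its size is at least [n.+1]. *)
pose n := (Num.truncn (Num.max (N x + 1) d^-1)).+1.
have hn1 : Num.max (N x + 1) d^-1 < n%:R by exact: truncnS_gt.
have : N (S (tt n) x - x) <= 1.
  apply: hd; have [/andP[-> h] _] := htt n; rewrite (le_trans h)//=.
  rewrite -[leRHS]invrK lef_pV2 ?posrE ?invr_gt0//.
  apply/ltW; apply: (@lt_trans _ _ n%:R); last by rewrite ltr_nat.
  by apply: le_lt_trans hn1; rewrite le_max lexx orbT.
have := xbig n; have := NleD (S (tt n) x) x.
have : N x + 1 < n%:R by apply: le_lt_trans hn1; rewrite le_max lexx.
by rewrite -natr1; lra.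
Qed.

(** The semigroup law propagates the bound near 0, one factor per step of length [d]. *)
Lemma semigroup_bounded_itv (B : R) : exists M : R, 1 <= M /\
  forall (t : R) x, 0 <= t <= B -> N (S t x) <= M * N x.
Proof.
have [d [M0 [d0 hM0]]] := semigroup_bounded_near0.
pose M1 := Num.max M0 1.
have M11 : 1 <= M1 by rewrite le_max lexx orbT.
have hM1 t x : 0 <= t <= d -> N (S t x) <= M1 * N x.
  by move=> ht; rewrite (le_trans (hM0 t x ht))// ler_wpM2r// le_max lexx.
have key n : forall (t : R) x, 0 <= t <= n%:R * d -> N (S t x) <= M1 ^+ n.+1 * N x.
  elim: n => [|n IH] t x ht.
    by rewrite expr1; apply: hM1; move: ht; rewrite mul0r; lra.
  have [td|dt] := leP t d.
    have h1 : N (S t x) <= M1 * N x by apply: hM1; case/andP: ht => ->.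
    rewrite (le_trans h1)// ler_wpM2r// -[leLHS]expr1.
    exact: ler_weXn2l.
  have e1 : N (S (d + (t - d)) x) = N (S d (S (t - d) x)).
    by apply: eqN; apply: Sadd; lra.
  rewrite subrKC in e1; rewrite e1.
  apply: (le_trans (hM1 d (S (t - d) x) _)); first lra.
  rewrite exprS -mulrA ler_pM2l; last lra.
  by apply: IH; move: ht; rewrite -natr1; lra.
pose n := (Num.truncn (B / d)).+1.
exists (M1 ^+ n.+1); split; first exact: exprn_ege1.
move=> t x /andP[t0 tB]; apply: key; rewrite t0 (le_trans tB)//.
by rewrite -ler_pdivrMr// ltW// truncnS_gt.
Qed.

Let S_dist (M B t : R) x y : (forall (t : R) x, 0 <= t <= B -> N (S t x) <= M * N x) ->
  0 <= t <= B -> N (S t x - S t y) <= M * N (x - y).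
Proof.
move=> hM ht; have /andP[t0 _] := ht.
by rewrite -(eqN (Ssub x y t0)); exact: hM.
Qed.

Let S_add_dist (s t : R) x y : 0 <= s -> 0 <= t ->
  N (S (s + t) x - y) = N (S s (S t x) - y).
Proof.
move=> s0 t0; apply: eqN; rewrite opprB addrA subrK; exact: Sadd.
Qed.

(** Uniformity in [s] holds because [S (s + h) f - S s f] is [S s] applied to [S h f - f]. *)
Lemma semigroup_unif_continuous (B : R) f (e : R) : 0 < e ->
  exists2 d : R, 0 < d & forall s h : R, 0 <= s <= B -> 0 <= h <= d ->
    N (S (s + h) f - S s f) <= e.
Proof.
move=> e0; have [M [M1 hM]] := semigroup_bounded_itv B.
have [d d0 hd] := Scont f (divr_gt0 e0 (lt_le_trans ltr01 M1)).
exists d => // s h hs hh.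
have /andP[s0 _] := hs; have /andP[h0 _] := hh.
rewrite S_add_dist// (le_trans (S_dist _ _ hM hs))//.
by rewrite mulrC -ler_pdivlMr ?hd//; lra.
Qed.

Let avg (F : nat -> V) (m : nat) := (m%:R^-1)%:C *: \sum_(0 <= j < m) F j.

Let avg_cst x m : (0 < m)%N -> avg (fun=> x) m = x.
Proof.
move=> m0; rewrite /avg sumr_const_nat subn0 -[x *+ m]scaler_nat scalerA.
rewrite -[X in _ * X](rmorph_nat (real_complex R)) -rmorphM mulVf ?scale1r//.
by rewrite pnatr_eq0 -lt0n.
Qed.

Let avg_close F G m (e : R) : (0 < m)%N ->
  (forall j, (j < m)%N -> N (F j - G j) <= e) -> N (avg F m - avg G m) <= e.
Proof.
move=> m0 h; have m0' : 0 < m%:R :> R by rewrite ltr0n.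
rewrite /avg -scalerBr -sumrB NZr ger0_norm ?invr_ge0//.
rewrite mulrC ler_pdivrMr// (le_trans (seminorm_sum ND NZ _ _))//.
rewrite mulr_natr -{2}(subn0 m) -sumr_const_nat; exact: ler_sum_nat.
Qed.

Let S_avg (t : R) F m : 0 <= t -> N (S t (avg F m) - avg (fun j => S t (F j)) m) = 0.
Proof.
move=> t0; apply/le_anti; rewrite N_ge0 andbT /avg.
have h1 := SZ (m%:R^-1)%:C (\sum_(0 <= j < m) F j) t0.
have h2 : N (S t (\sum_(0 <= j < m) F j) - \sum_(0 <= j < m) S t (F j)) = 0.
  elim: m {h1} => [|m IH]; first by rewrite !big_geq// subr0 S0.
  rewrite !big_nat_recr//=; apply/le_anti; rewrite N_ge0 andbT.
  have := Ntri (S t (\sum_(0 <= j < m) F j) + S t (F m))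
    (S t (\sum_(0 <= j < m) F j + F m)) (\sum_(0 <= j < m) S t (F j) + S t (F m)).
  by rewrite (SD _ _ t0) opprD addrACA subrr addr0 IH addr0.
rewrite (le_trans (Ntri ((m%:R^-1)%:C *: S t (\sum_(0 <= j < m) F j)) _ _))//.
rewrite h1 add0r -scalerBr.
by rewrite NZr h2 mulr0.
Qed.

Let sum_mul (F : nat -> V) m p :
  \sum_(0 <= k < m * p) F k = \sum_(0 <= j < m) \sum_(0 <= i < p) F (j * p + i)%N.
Proof.
elim: m => [|m IH]; first by rewrite mul0n !big_geq.
rewrite big_nat_recr//= -IH mulSn addnC (@big_cat_nat _ _ _ (m * p)%N)//= ?leq_addr//.
by congr (_ + _); rewrite -{1}(add0n (m * p)%N) big_addn addKn; apply: eq_bigr => i _; rewrite addnC.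
Qed.

Let avg_shift (F : nat -> V) m p :
  \sum_(0 <= j < m) F (p + j)%N - \sum_(0 <= j < m) F j =
  \sum_(0 <= i < p) F (m + i)%N - \sum_(0 <= i < p) F i.
Proof.
have h a c : \sum_(0 <= k < a + c) F k =
    \sum_(0 <= k < a) F k + \sum_(0 <= k < c) F (a + k)%N.
  rewrite (@big_cat_nat _ _ _ a)//= ?leq_addr//; congr (_ + _).
  by rewrite -{1}(add0n a) big_addn addKn; apply: eq_bigr => i _; rewrite addnC.
apply/eqP; rewrite subr_eq addrAC eq_sym subr_eq [X in _ == X]addrC -h.
by rewrite [X in X == _]addrC -h addnC.
Qed.

Let gen f g := forall e : R, 0 < e -> exists2 d : R, 0 < d &
  forall t, 0 < t <= d -> N ((t^-1)%:C *: (S t f - f) - g) <= e.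

(* [v] is the mean of [S t f] over [0 <= t <= b], the limit of the Riemann sums [R_ m];
   the difference quotient of a Riemann sum telescopes. *)
Lemma generator_dense f (e : R) : 0 < e ->
  exists v g, gen v g /\ N (v - f) <= e.
Proof.
move=> e0.
have [b b0 hb] := Scont f e0.
have [M [M1 hM]] := semigroup_bounded_itv (b + 1).
pose smp m j := S (b * (j%:R / m%:R)) f.
pose R_ m := avg (smp m) m.
have frac0 (j m : nat) : 0 <= j%:R / m%:R :> R by rewrite divr_ge0.
have smp0 (j m : nat) : 0 <= b * (j%:R / m%:R) by rewrite mulr_ge0// ltW.
have smpb (j m : nat) : (j <= m)%N -> (0 < m)%N -> b * (j%:R / m%:R) <= b.
  move=> jm m0; rewrite ler_piMr ?(ltW b0)// ler_pdivrMr ?ltr0n// mul1r.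
  by rewrite ler_nat.
have large (d : R) : 0 < d -> exists2 m0, (0 < m0)%N & forall m, (m0 <= m)%N -> m%:R^-1 <= d.
  move=> d0; exists (Num.truncn d^-1).+1 => // m hm.
  rewrite -[leRHS]invrK lef_pV2 ?posrE ?invr_gt0 ?ltr0n//; last first.
    exact: leq_trans hm.
  by rewrite (le_trans (ltW (truncnS_gt _)))// ler_nat.
(* To compare a Riemann sum with its refinement by a factor [p], each coarse sample is written as
   the mean of [p] copies of itself. *)
have refine (eta : R) : 0 < eta -> exists2 m0, (0 < m0)%N & forall m p, (m0 <= m)%N ->
    (0 < p)%N -> N (R_ (m * p)%N - R_ m) <= eta.
  move=> eta0; have [d d0 hd] := semigroup_unif_continuous b f eta0.
  have [m0 m00 hm0] := large _ (divr_gt0 d0 b0).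
  exists m0 => // m p hm p0.
  have m_gt0 : (0 < m)%N by exact: leq_trans hm.
  have -> : R_ m = avg (fun j => avg (fun=> smp m j) p) m.
    congr (_ *: _); apply: eq_bigr => j _; exact/esym/avg_cst.
  have -> : R_ (m * p)%N = avg (fun j => avg (fun i => smp (m * p)%N (j * p + i)%N) p) m.
    rewrite /R_ /avg sum_mul -scaler_sumr scalerA -rmorphM natrM invfM.
    by congr (_ *: _).
  apply: avg_close => // j jm; apply: avg_close => // i ip; rewrite /smp.
  have -> : b * ((j * p + i)%:R / (m * p)%:R) =
      b * (j%:R / m%:R) + b * (i%:R / (m * p)%:R) :> R.
    rewrite natrD !natrM; field.
    by rewrite !pnatr_eq0 -!lt0n p0 m_gt0.
  apply: hd; first by rewrite smp0/= (le_trans (smpb _ _ (ltnW jm) m_gt0))//; lra.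
  rewrite smp0/=; have h1 := hm0 m hm.
  apply: (@le_trans _ _ (b * m%:R^-1)); last by rewrite mulrC -ler_pdivlMr.
  rewrite ler_pM2l// natrM invfM mulrCA ler_piMr ?invr_ge0//.
  by rewrite ler_pdivrMr ?ltr0n// mul1r ler_nat ltnW.
(* Two subdivisions are compared through their common refinement; the index [n.+1] excludes the
   empty one. *)
have [v hv] : exists v, forall e : R, 0 < e -> exists n0, forall n, (n0 <= n)%N -> N (R_ n.+1 - v) <= e.
  apply: (N_complete (u := fun n => R_ n.+1)) => eta eta0.
  have [m0 m00 hm0] := refine _ (ltac:(lra) : 0 < eta / 2).
  exists m0 => m n hm hn; have h1 := hm0 m.+1 n.+1 (leqW hm) isT.
  have h2 := hm0 n.+1 m.+1 (leqW hn) isT; rewrite mulnC in h2.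
  have := Ntri (R_ (m.+1 * n.+1)%N) (R_ m.+1) (R_ n.+1).
  by rewrite [N (R_ m.+1 - R_ (_ * _)%N)]NB; lra.
exists v, (b^-1%:C *: (S b f - f)); split; last first.
  apply/ler_addgt0Pr => eta eta0; have [n0 hn0] := hv eta eta0.
  have h1 := hn0 _ (leqnn n0); rewrite NB in h1.
  have h2 : N (R_ n0.+1 - f) <= e.
    rewrite -[X in _ - X](avg_cst f (ltn0Sn n0)); apply: avg_close => // j jn.
    by apply: hb; rewrite smp0 smpb// ltnW.
  by have := Ntri (R_ n0.+1) v f; lra.
move=> eps eps0.
have M0 : 0 < M by exact: lt_le_trans M1.
have e10 : 0 < eps * b / (M + 1) by rewrite divr_gt0 ?mulr_gt0//; lra.
set e1 := _ / _ in e10.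
have [d d0 hd] := Scont f e10.
exists (Num.min d 1); first by rewrite lt_min d0 ltr01.
move=> h /andP[h0]; rewrite le_min => /andP[hd' h1].
(* The candidate for the generator at [v] is [(S b f - f) / b]. The error bound is proportional to
   [h] and survives the division by [h]. *)
suff key : N (S h v - v - (h / b)%:C *: (S b f - f)) <= h / b * ((M + 1) * e1).
  rewrite (_ : _ - _ = h^-1%:C *: (S h v - v - (h / b)%:C *: (S b f - f))); last first.
    by rewrite [in RHS]scalerBr scalerA -rmorphM mulrA mulVf ?gt_eqF// mul1r.
  rewrite NZr ger0_norm ?invr_ge0 ?(ltW h0)// mulrC ler_pdivrMr//.
  rewrite (le_trans key)// /e1 le_eqVlt; apply/orP; left; apply/eqP; field.
  by rewrite !gt_eqF//; lra.
apply/ler_addgt0Pr => eta0 eta00.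
(* Discretising costs [M * eta] for replacing [v] by a Riemann sum under [S h], and [eta] for each
   of three further approximations. *)
pose eta := eta0 / (M + 3).
have M3 : 0 < M + 3 by lra.
have eta_gt0 : 0 < eta by rewrite divr_gt0.
have -> : eta0 = (M + 3) * eta by rewrite /eta mulrCA divff ?mulr1// gt_eqF.
have [n0 hn0] := hv eta eta_gt0.
have [dd dd0 hdd] := semigroup_unif_continuous (b + 1) f eta_gt0.
have [m1 m10 hm1] := large _ (divr_gt0 dd0 b0).
have N1 : 0 < 1 + N (S b f - f) by have := N_ge0 (S b f - f); lra.
have [m2 m20 hm2] := large _ (divr_gt0 eta_gt0 N1).
pose m := (maxn n0 (maxn m1 m2)).+1.
have hmv : N (R_ m - v) <= eta by apply: hn0; rewrite leq_maxl.
have bm : m%:R^-1 <= dd / b.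
  by apply: hm1; rewrite leqW// leq_max orbC leq_maxl.
have bm2 : m%:R^-1 <= eta / (1 + N (S b f - f)).
  by apply: hm2; rewrite leqW// leq_max orbC leq_maxr.
have m_gt0 : 0 < m%:R :> R by rewrite ltr0n.
(* [p] grid steps of length [b / m] approximate [h] from below. *)
pose p := Num.truncn (h / b * m%:R).
have /andP[p1 p2] : p%:R <= h / b * m%:R < p.+1%:R.
  by apply: truncn_itv; rewrite !mulr_ge0// ?invr_ge0 ltW.
have p1' : p%:R / m%:R <= h / b by rewrite ler_pdivrMr.
have p2' : h / b <= p%:R / m%:R + m%:R^-1.
  by rewrite -{2}[m%:R^-1]mul1r -mulrDl ler_pdivlMr// natr1 ltW.
have pb1 : b * (p%:R / m%:R) <= h by rewrite mulrC -ler_pdivlMr.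
have pb2 : h <= b * (p%:R / m%:R) + b * m%:R^-1.
  by rewrite -mulrDr mulrC -ler_pdivrMr.
have bm' : b * m%:R^-1 <= dd by rewrite mulrC -ler_pdivlMr.
have h_ge0 := ltW h0.
have hB : 0 <= h <= b + 1 by rewrite h_ge0; lra.
have A1 : N (S h v - S h (R_ m)) <= M * eta.
  rewrite (le_trans (S_dist _ _ hM hB))// ler_pM2l//; first by rewrite NB.
have A2 := S_avg (smp m) m h_ge0; rewrite -/(R_ m) in A2.
have A3 : N (avg (fun j => S h (smp m j)) m - avg (fun j => smp m (p + j)%N) m) <= eta.
  apply: avg_close => // j jm; rewrite /smp -S_add_dist//.
  have -> : h + b * (j%:R / m%:R) = b * ((p + j)%:R / m%:R) + (h - b * (p%:R / m%:R)).
    by rewrite natrD; field; rewrite gt_eqF.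
  apply: hdd; last lra.
  rewrite smp0/= natrD mulrDl mulrDr; have := smpb j m (ltnW jm) isT; lra.
have A4 : avg (fun j => smp m (p + j)%N) m - R_ m =
    m%:R^-1%:C *: \sum_(0 <= i < p) (smp m (m + i)%N - smp m i).
  by rewrite /R_ /avg -scalerBr avg_shift sumrB.
(* Each of the [p] surviving differences is [S b f - f] up to a small vector and its image under
   [S b], hence the factor [M + 1]. *)
have A5 : N (m%:R^-1%:C *: \sum_(0 <= i < p) (smp m (m + i)%N - smp m i)
    - (p%:R / m%:R)%:C *: (S b f - f)) <= h / b * ((M + 1) * e1).
  have -> : (p%:R / m%:R)%:C *: (S b f - f) =
      m%:R^-1%:C *: \sum_(0 <= i < p) (S b f - f).
    rewrite sumr_const_nat subn0 -[(S b f - f) *+ p]scaler_nat scalerA -(rmorph_nat (real_complex R) p).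
    by rewrite -rmorphM mulrC.
  rewrite -scalerBr -sumrB NZr ger0_norm ?invr_ge0 ?(ltW m_gt0)//.
  apply: (@le_trans _ _ (m%:R^-1 * (p%:R * ((M + 1) * e1)))); last first.
    rewrite (mulrA m%:R^-1) ler_wpM2r//; last by rewrite mulrC.
    by rewrite mulr_ge0//; lra.
  rewrite ler_pM2l ?invr_gt0// (le_trans (seminorm_sum ND NZ _ _))//.
  rewrite mulr_natl -{2}(subn0 p) -sumr_const_nat; apply: ler_sum_nat => i /= ip.
  have hi : 0 <= b * (i%:R / m%:R) <= d.
    rewrite smp0 /= (le_trans _ hd')// (le_trans _ pb1)// ler_pM2l//.
    by rewrite ler_pM2r ?invr_gt0// ler_nat ltnW.
  have B1 := hd _ hi.
  have B2 : N (smp m (m + i)%N - S b f) <= M * e1.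
    rewrite /smp natrD mulrDl divff ?gt_eqF// mulrDr mulr1 S_add_dist// ?(ltW b0)//.
    apply: (le_trans (S_dist _ _ hM _)); first lra.
    by rewrite ler_pM2l.
  rewrite opprB (addrC f) addrACA (le_trans (ND _ _))// mulrDl mul1r.
  by apply: lerD => //; rewrite addrC NB.
have A6 : N ((p%:R / m%:R)%:C *: (S b f - f) - (h / b)%:C *: (S b f - f)) <= eta.
  rewrite -scalerBl -rmorphB NZr.
  have : `|p%:R / m%:R - h / b| <= m%:R^-1 by rewrite ler_norml; lra.
  have := N_ge0 (S b f - f); move: bm2; rewrite ler_pdivlMr; last first.
    by have := N_ge0 (S b f - f); lra.
  by move: `|_| (N _) => x y; move: (invr_gt0 (m%:R : R)); rewrite m_gt0; nra.
have T1 : N (S h v - avg (fun j => smp m (p + j)%N) m) <= M * eta + eta.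
  have := Ntri (S h (R_ m)) (S h v) (avg (fun j => smp m (p + j)%N) m).
  have := Ntri (avg (fun j => S h (smp m j)) m) (S h (R_ m)) (avg (fun j => smp m (p + j)%N) m).
  by rewrite A2; lra.
set w := (p%:R / m%:R)%:C *: (S b f - f) in A5 A6.
set z := (h / b)%:C *: (S b f - f) in A6 *.
set a := avg _ _ in T1 A4.
rewrite -A4 in A5.
have T2 : N ((S h v - v) - (a - R_ m)) <= M * eta + eta + eta.
  rewrite opprB addrACA (addrC (- v)) addrACA.
  by have := ND (S h v - a) (R_ m - v); lra.
have := Ntri (a - R_ m) (S h v - v) z; have := Ntri w (a - R_ m) z; lra.
Qed.

(* For [f] in the domain of the generator, [t |-> ell (T - t) (S t f)] has zero
   right derivative; the domain is dense. *)
Lemma semigroup_duality (ell : R -> V -> R[i]) (T C : R) : 0 <= T ->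
  (forall t x y, 0 <= t <= T -> ell t (x - y) = ell t x - ell t y) ->
  (forall t (a : R) x, 0 <= t <= T -> ell t (a%:C *: x) = a%:C * ell t x) ->
  (forall t x, 0 <= t <= T -> Normc.normc (ell t x) <= C * N x) ->
  (forall f g, gen f g -> exists K : R, forall t h, 0 <= t -> 0 <= h -> t + h <= T ->
     Normc.normc (ell t f - ell (t + h) f + h%:C * ell (t + h) g) <= K * h ^+ 2 /\
     Normc.normc (ell t g - ell (t + h) g) <= K * h) ->
  forall f, ell 0 (S T f) = ell T f.
Proof.
move=> T0 ellB ellZ ell_le ell_gen.
have [M [M1 hM]] := semigroup_bounded_itv T.
pose nc := @Normc.normc R.
have C0 f : 0 <= C * N f.
  apply: (le_trans _ (ell_le 0 f _)); first exact: normc_ge0.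
  by rewrite lexx.
have eqell t x y : 0 <= t <= T -> N (x - y) = 0 -> ell t x = ell t y.
  move=> ht h; apply/eqP; rewrite -subr_eq0 -ellB//; apply/eqP/Normc.eq0_normc.
  by apply/le_anti; rewrite normc_ge0 (le_trans (ell_le _ _ ht))// h mulr0.
have dense f g : gen f g -> ell 0 (S T f) = ell T f.
  move=> fg.
  (* The domain is invariant, and the generator commutes with the semigroup. *)
  have genS t : 0 <= t <= T -> gen (S t f) (S t g).
    move=> ht e e0; have [d d0 hd] := fg (e / M) (divr_gt0 e0 (lt_le_trans ltr01 M1)).
    have /andP[t0 _] := ht.
    exists d => // h hh; have h0 : 0 <= h by case/andP: hh => /ltW.
    have -> : N (h^-1%:C *: (S h (S t f) - S t f) - S t g) =
        N (S t (h^-1%:C *: (S h f - f)) - S t g).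
      apply: eqN; rewrite opprB addrA subrK.
      apply/le_anti; rewrite N_ge0 andbT.
      apply: (le_trans (Ntri (h^-1%:C *: S t (S h f - f)) _ _)).
      rewrite [X in _ + X]NB (SZ _ _ t0) addr0 -scalerBr NZr.
      rewrite mulr_ge0_le0 ?normr_ge0//.
      apply: (le_trans (Ntri (S t (S h f) - S t f) _ _)).
      rewrite [X in _ + X]NB (Ssub _ _ t0) addr0 opprB addrA subrK -S_add_dist//.
      by rewrite (addrC h) Sadd.
    rewrite (le_trans (S_dist _ _ hM ht))//.
    by rewrite mulrC -ler_pdivlMr ?hd//; lra.
  pose phi t := ell (T - t) (S t f).
  (* The modulus reduces the constancy of the complex function [phi] to an inequality between
     reals. *)
  pose psi t := nc (phi t - phi 0).
  have psi_phi s t : psi s <= psi t + nc (phi s - phi t).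
    have -> : psi s = nc ((phi t - phi 0) + (phi s - phi t)).
      by rewrite /psi; congr nc; ring.
    exact: le_normcD.
  suff h : psi T <= psi 0.
    have : phi T - phi 0 = 0.
      apply: Normc.eq0_normc; apply/le_anti; rewrite normc_ge0 andbT (le_trans h)//.
      by rewrite /psi /nc subrr Normc.normc0.
    move/eqP; rewrite subr_eq0 /phi subrr subr0 => /eqP ->.
    by apply: eqell => //; rewrite T0 lexx.
  apply: le_of_right_dini => // t e ht e0; last first.
    (* Left continuity of [phi], from the uniform continuity of the orbit and the continuity of
       [ell] in time. *)
    have [K hK] := ell_gen _ _ (genS t ltac:(lra)).
    have [K0 K0K] : exists2 K0 : R, 0 <= K0 & K <= K0.
      by exists (Num.max K 0); rewrite le_max lexx ?orbT.
    have e20 : 0 < e / 2 by lra.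
    have C1 : 0 < Num.max C 1 by rewrite lt_max ltr01 orbT.
    have [d1 d10 hd1] := semigroup_unif_continuous T f (divr_gt0 e20 C1).
    pose L := K0 * T + C * N (S t g).
    have L0 : 0 <= L by rewrite addr_ge0// mulr_ge0.
    have d20 : 0 < e / 2 / (L + 1) by rewrite divr_gt0//; lra.
    exists (Num.min d1 (e / 2 / (L + 1))); first by rewrite lt_min d10.
    move=> h /andP[h0]; rewrite le_min => /andP[hd1' hd2'] ht'.
    have [k1 _] := hK (T - t) h ltac:(lra) h0 ltac:(lra).
    have tau : 0 <= T - t + h <= T by lra.
    have k2 : nc (ell (T - t + h) (S t f) - ell (T - t + h) (S (t - h) f)) <= e / 2.
      rewrite -ellB// (le_trans (ell_le _ _ tau))//.
      have := hd1 (t - h) h ltac:(lra) ltac:(lra); rewrite subrK => hh.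
      apply: (@le_trans _ _ (Num.max C 1 * (e / 2 / Num.max C 1))).
        apply: (@le_trans _ _ (Num.max C 1 * N (S t f - S (t - h) f))).
          by rewrite ler_wpM2r// le_max lexx.
        by rewrite ler_pM2l.
      by rewrite mulrCA divff ?mulr1// gt_eqF.
    have k3 : nc (h%:C * ell (T - t + h) (S t g)) <= h * (C * N (S t g)).
      rewrite /nc Normc.normcM normc_real ger0_norm// ler_wpM2l//; exact: ell_le.
    have k4 : K * h ^+ 2 <= K0 * T * h.
      rewrite expr2 mulrA ler_wpM2r//.
      by apply: (@le_trans _ _ (K0 * h)); [rewrite ler_wpM2r|rewrite ler_wpM2l//; lra].
    have k5 : h * L <= e / 2.
      by move: hd2'; rewrite ler_pdivlMr; nra.
    apply: (le_trans (psi_phi t (t - h))); rewrite lerD2l /phi opprB addrCA (addrC h).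
    set a := ell (T - t) (S t f) in k1 *; set b := ell _ (S t f) in k1 k2.
    set c := ell _ (S (t - h) f) in k2 *; set u := _ * ell _ _ in k1 k3.
    have -> : a - c = (a - b + u) + ((b - c) - u).
      by ring.
    have := le_normcD (a - b + u) ((b - c) - u); have := le_normcD (b - c) (- u).
    rewrite normcN -/nc; rewrite -/nc in k1.
    have : h * L = K0 * T * h + h * (C * N (S t g)) by rewrite /L; ring.
    lra.
  (* The right derivative of [phi] is 0: the first-order change of the orbit,
     [h * ell (T - t - h) (S t g)], and that of [ell], [h * ell (T - t) (S t g)], cancel up to
     [K * h ^+ 2]. *)
  have [K hK] := ell_gen _ _ (genS t ltac:(lra)).
  have [K0 K0K] : exists2 K0 : R, 0 <= K0 & K <= K0.
    by exists (Num.max K 0); rewrite le_max lexx ?orbT.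
  have C1 : 0 < Num.max C 1 by rewrite lt_max ltr01 orbT.
  have e20 : 0 < e / 2 by lra.
  have [d1 d10 hd1] := genS t ltac:(lra) _ (divr_gt0 e20 C1).
  have d20 : 0 < e / 4 / (K0 + 1) by rewrite divr_gt0//; lra.
  exists (Num.min d1 (e / 4 / (K0 + 1))); first by rewrite lt_min d10.
  move=> h /andP[h0]; rewrite le_min => /andP[hd1' hd2'] ht'.
  have h0' := ltW h0.
  have [k1 k2] := hK (T - t - h) h ltac:(lra) ltac:(lra) ltac:(lra).
  rewrite subrK in k1 k2.
  have tau : 0 <= T - t - h <= T by lra.
  have k3 : nc (ell (T - t - h) (S (t + h) f) - ell (T - t - h) (S t f)
      - h%:C * ell (T - t - h) (S t g)) <= h * (e / 2).
    rewrite -ellB// -ellZ// -ellB//.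
    rewrite (le_trans (ell_le _ _ tau))//.
    have -> : N (S (t + h) f - S t f - h%:C *: S t g) =
        h * N (h^-1%:C *: (S h (S t f) - S t f) - S t g).
      have -> : N (S (t + h) f - S t f - h%:C *: S t g) =
          N (S h (S t f) - S t f - h%:C *: S t g).
        apply: eqN; rewrite -(addrA (S (t + h) f)) -(addrA (S h (S t f))).
        rewrite opprD addrACA subrr addr0 addrC (addrC t).
        rewrite addrC; apply: Sadd => //; lra.
      have -> : S h (S t f) - S t f - h%:C *: S t g =
          h%:C *: (h^-1%:C *: (S h (S t f) - S t f) - S t g).
        by rewrite scalerBr scalerA -rmorphM divff ?gt_eqF// rmorph1 scale1r.
      by rewrite NZr ger0_norm.
    have hh := hd1 h ltac:(lra).
    rewrite mulrCA ler_pM2l//.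
    apply: (@le_trans _ _ (Num.max C 1 * (e / 2 / Num.max C 1))).
      apply: (@le_trans _ _ (Num.max C 1 * N (h^-1%:C *: (S h (S t f) - S t f) - S t g))).
        by rewrite ler_wpM2r// le_max lexx.
      by rewrite ler_pM2l.
    by rewrite mulrCA divff ?mulr1// gt_eqF.
  have k4 : nc (h%:C * (ell (T - t - h) (S t g) - ell (T - t) (S t g))) <= h * (K * h).
    by rewrite /nc Normc.normcM normc_real ger0_norm// ler_wpM2l.
  have k5 : (K0 + 1) * h <= e / 4 by move: hd2'; rewrite ler_pdivlMr ?(mulrC h)//; lra.
  have k6 : K * h <= e / 4.
    by apply: (le_trans _ k5); rewrite ler_wpM2r//; lra.
  apply: (le_trans (psi_phi (t + h) t)); rewrite lerD2l /phi opprD addrA.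
  set a := ell _ (S (t + h) f) in k3 *; set b := ell (T - t - h) (S t f) in k1 k3 *.
  set c := ell (T - t) (S t f) in k1 *; set u := ell _ _ in k3 k2 k4.
  set w := ell (T - t) (S t g) in k1 k2 k4.
  have -> : a - c = (a - b - h%:C * u) + (b - c + h%:C * w + h%:C * (u - w)) by ring.
  have := le_normcD (a - b - h%:C * u) (b - c + h%:C * w + h%:C * (u - w)).
  have := le_normcD (b - c + h%:C * w) (h%:C * (u - w)).
  rewrite -/nc; rewrite -/nc in k1.
  have : K * h ^+ 2 <= e / 4 * h by rewrite expr2 mulrA ler_wpM2r.
  have : h * (K * h) <= e / 4 * h by rewrite mulrC ler_wpM2r.
  lra.
move=> f; apply/eqP; rewrite -subr_eq0; apply/eqP/Normc.eq0_normc/le_anti.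
rewrite normc_ge0 andbT; apply/ler_addgt0Pr => e e0; rewrite add0r.
have Cf0 : 0 < Num.max C 1 by rewrite lt_max ltr01 orbT.
have e1 : 0 < e / (Num.max C 1 * (M + 1)) by rewrite divr_gt0 ?mulr_gt0//; lra.
have [v [g [vg hv]]] := generator_dense f e1.
have hT : 0 <= T <= T by rewrite T0 lexx.
have h0 : (0 : R) <= 0 <= T by rewrite lexx T0.
have -> : ell 0 (S T f) - ell T f = (ell 0 (S T f) - ell 0 (S T v)) + (ell T v - ell T f).
  by rewrite (dense _ _ vg); ring.
apply: (le_trans (le_normcD _ _)); rewrite -!ellB//.
have h1 := ell_le 0 (S T f - S T v) h0; have h2 := ell_le T (v - f) hT.
have h3 := S_dist f v hM hT; rewrite (NB f) in h3.
have h4 : C * N (S T f - S T v) <= Num.max C 1 * (M * N (v - f)).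
  apply: (@le_trans _ _ (Num.max C 1 * N (S T f - S T v))).
    by rewrite ler_wpM2r// le_max lexx.
  by rewrite ler_pM2l.
have h5 : C * N (v - f) <= Num.max C 1 * N (v - f) by rewrite ler_wpM2r// le_max lexx.
move: hv; rewrite ler_pdivlMr; last by rewrite mulr_gt0//; lra.
have -> : N (v - f) * (Num.max C 1 * (M + 1)) =
    Num.max C 1 * (M * N (v - f)) + Num.max C 1 * N (v - f) by ring.
lra.
Qed.

End Semigroup.

(** * Completely monotone sequences and summation by parts *)

Section MonotoneSequences.
Context {R : realType}.
Implicit Types (a b c : nat -> R) (k m n M : nat).

Definition fdiff c m := c m - c m.+1.

(** Complete monotonicity truncated at order [k]. The sign in [fdiff] makes every iterated
    difference nonnegative. *)
Fixpoint cm_seq k c : Prop :=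
  (forall m, 0 <= c m) /\ if k is k'.+1 then cm_seq k' (fdiff c) else True.

Lemma cm_seq_ge0 k c m : cm_seq k c -> 0 <= c m.
Proof. by case: k => [|k] []. Qed.

Lemma cm_seqW k c : cm_seq k.+1 c -> cm_seq k c.
Proof.
elim: k c => [|k IH] c; first by case.
by case=> c0 /IH; split.
Qed.

Lemma cm_seq_shift k c : cm_seq k c -> cm_seq k (fun m => c m.+1).
Proof.
elim: k c => [|k IH] c [c0 h]; split=> //; try by move=> m; exact: c0.
exact: (IH (fdiff c)).
Qed.

Lemma cm_seqD k a b : cm_seq k a -> cm_seq k b -> cm_seq k (a \+ b).
Proof.
elim: k a b => [|k IH] a b [a0 ha] [b0 hb]; split => //;
  try by move=> m; rewrite addr_ge0.
rewrite (_ : fdiff _ = fdiff a \+ fdiff b); first exact: IH.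
by apply/funext => m; rewrite /fdiff /=; ring.
Qed.

(** Leibniz rule for differences, in which one of the two terms carries a shifted factor. *)
Lemma cm_seqM k a b : cm_seq k a -> cm_seq k b -> cm_seq k (a \* b).
Proof.
elim: k a b => [|k IH] a b; first by case=> a0 _ [b0 _]; split=> // m; rewrite mulr_ge0.
move=> ha hb; split.
  by move=> m; rewrite mulr_ge0//; [exact: cm_seq_ge0 ha|exact: cm_seq_ge0 hb].
rewrite (_ : fdiff _ = (fdiff a \* b) \+ ((fun m => a m.+1) \* fdiff b)); last first.
  by apply/funext => m; rewrite /fdiff /=; ring.
apply: cm_seqD; apply: IH.
- by case: ha.
- exact: cm_seqW.
- by apply: cm_seq_shift; exact: cm_seqW.
- by case: hb.
Qed.

(** By Pascal's rule a difference lowers both indices of the binomial coefficient by one. *)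
Lemma cm_seq_bin p M : cm_seq p (fun m => 'C(M - m, p)%:R).
Proof.
elim: p M => [|p IH] M; first by split=> // m; rewrite ler0n.
split; first by move=> m; rewrite ler0n.
rewrite (_ : fdiff _ = fun m => 'C(M - m, p.+1)%:R - 'C(M - m.+1, p.+1)%:R)//.
(* For the last difference Pascal's rule would fail past [M], where 'C(0, 0) = 1; in that case only
   its sign is needed. *)
case: p IH => [_|p IH].
  split=> // m; rewrite subr_ge0 ler_nat !bin1; exact: leq_sub2l.
rewrite (_ : (fun m => _) = fun m => 'C(M.-1 - m, p.+1)%:R); first exact: IH.
apply/funext => m; case: (ltnP m M) => [mM|Mm].
  have -> : (M - m)%N = (M - m.+1).+1 by rewrite subnSK.
  rewrite binS natrD addrAC subrr add0r; congr (_%:R); congr 'C(_, _).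
  by case: M mM {IH} => // M _ ; rewrite subSS.
have -> : (M - m = 0)%N by apply/eqP; rewrite subn_eq0.
have -> : (M - m.+1 = 0)%N by apply/eqP; rewrite subn_eq0 leqW.
have -> : (M.-1 - m = 0)%N by apply/eqP; rewrite subn_eq0 (leq_trans (leq_pred M)).
by rewrite subrr.
Qed.

(** With [c = 1] and no truncation this is the negative binomial series of (1 - z)^(-n-1). *)
Definition negbin_sum M n c (z : R[i]) : R[i] :=
  \sum_(0 <= m < M) ('C(m + n, n)%:R * c m)%:C * z ^+ m.

(** Pascal's rule and a shift of the index; the vanishing of [c] at [M] removes the boundary
    term. *)
Lemma negbin_sum_rec M n c z : (forall m, (M <= m)%N -> c m = 0) ->
  (1 - z) * negbin_sum M n.+1 c z =
  negbin_sum M n c z - z * negbin_sum M n.+1 (fdiff c) z.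
Proof.
move=> cM; rewrite /negbin_sum.
case: M cM => [|M] cM; first by rewrite !big_geq// !mulr0 subrr.
suff h : z * (\sum_(0 <= m < M.+1) ('C(m + n.+1, n.+1)%:R * c m)%:C * z ^+ m) =
    z * \sum_(0 <= m < M.+1) ('C(m + n.+1, n.+1)%:R * fdiff c m)%:C * z ^+ m +
    \sum_(0 <= m < M.+1) (('C(m + n.+1, n.+1)%:R - 'C(m + n, n)%:R) * c m)%:C * z ^+ m.
  rewrite mulrBl mul1r h opprD addrA -addrAC; congr (_ - _).
  rewrite -sumrB; apply: eq_bigr => m _.
  by rewrite -mulrBl -rmorphB/= -mulrBl subKr.
rewrite [X in _ + X]big_nat_recl//= add0n !binn subrr mul0r rmorph0 mul0r add0r.
have -> : \sum_(0 <= i < M) (('C(i.+1 + n.+1, n.+1)%:R - 'C(i.+1 + n, n)%:R) * c i.+1)%:C * z ^+ i.+1 =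
   z * \sum_(0 <= i < M.+1) ('C(i + n.+1, n.+1)%:R * c i.+1)%:C * z ^+ i.
  rewrite big_nat_recr//= (cM M.+1)// mulr0 rmorph0 mul0r addr0 mulr_sumr.
  apply: eq_bigr => i _.
  by rewrite (addSn i n.+1) binS natrD -(addSnnS i n) addrK exprS mulrCA.
rewrite -mulrDr -big_split/=; congr (_ * _); apply: eq_bigr => m _.
by rewrite -mulrDl -rmorphD/= -mulrDr subrK.
Qed.

Lemma negbin_sum0 M c z : (0 < M)%N -> (forall m, (M <= m)%N -> c m = 0) ->
  (1 - z) * negbin_sum M 0 c z = (c 0)%:C - z * negbin_sum M 0 (fdiff c) z.
Proof.
case: M => // M _ cM; rewrite /negbin_sum.
under eq_bigr do rewrite bin0 mul1r; under [in RHS]eq_bigr do rewrite bin0 mul1r.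
have h : \sum_(0 <= m < M.+1) (c m)%:C * z ^+ m =
    (c 0)%:C + z * \sum_(0 <= m < M.+1) (c m.+1)%:C * z ^+ m.
  rewrite big_nat_recl//= expr0 mulr1 [in RHS]big_nat_recr//= (cM M.+1)// rmorph0 mul0r addr0.
  by rewrite mulr_sumr; congr (_ + _); apply: eq_bigr => i _; rewrite exprS mulrCA.
rewrite mulrBl mul1r {1}h -addrA -mulrBr -sumrB; congr (_ + _).
rewrite -mulrN -sumrN; congr (_ * _); apply: eq_bigr => m _.
by rewrite -mulrBl -mulNr -rmorphB -rmorphN /= /fdiff opprB.
Qed.

Lemma fdiff_vanish M c : (forall m, (M <= m)%N -> c m = 0) ->
  forall k m, (M <= m)%N -> iter k fdiff c m = 0.
Proof.
move=> cM; elim=> [|k IH] m Mm /=; first exact: cM.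
by rewrite /fdiff !IH ?subrr// leqW.
Qed.

(** At [z = 1] the left side of the recursion vanishes, so the value does not depend on [n]. For
    completely monotone [c] all terms are nonnegative, and the sum of their moduli is thereby
    computed exactly. *)
Lemma negbin_sum_at1 M n c : (0 < M)%N -> (forall m, (M <= m)%N -> c m = 0) ->
  negbin_sum M n (iter n.+1 fdiff c) 1 = (c 0)%:C.
Proof.
move=> M0 cM; elim: n => [|n IH].
  have := negbin_sum0 1 M0 cM; rewrite subrr mul0r mul1r.
  by move/eqP; rewrite eq_sym subr_eq0 => /eqP.
have := negbin_sum_rec n 1 (fdiff_vanish cM n.+1); rewrite subrr mul0r mul1r IH.
by move/eqP; rewrite eq_sym subr_eq0 => /eqP.
Qed.

Lemma cm_seq_iter k d c m : cm_seq k c -> (d <= k)%N -> 0 <= iter d fdiff c m.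
Proof.
elim: k d c => [|k IH] [|d] c ck dk //=; try exact: (cm_seq_ge0 _ ck).
by rewrite -iterS iterSr; apply: IH => //; case: ck.
Qed.

(* With [z] on the unit circle away from 1, a bound exponential in [n] although
   the sum of the absolute values of the terms is much larger. *)
Lemma negbin_sum_le M n c (z : R[i]) : (0 < M)%N ->
  (forall m, (M <= m)%N -> c m = 0) -> cm_seq n.+1 c ->
  Normc.normc z <= 1 -> 0 < Normc.normc (1 - z) ->
  Normc.normc (negbin_sum M n c z) <= (2 / Normc.normc (1 - z)) ^+ n.+1 * c 0.
Proof.
move=> M0 cM; set nc := @Normc.normc R; move=> cn z1 z10.
have c0 := cm_seq_ge0 0 cn.
(* [d] counts the divisions by [1 - z]. With [d = 0] all [n + 1] differences are taken and the sum
   of the moduli is at most [c 0]; each division leaves two terms that obey the previous bound,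
   whence the factor 2. *)
suff key d : forall n c, (d <= n.+1)%N -> (forall m, (M <= m)%N -> c m = 0) ->
    cm_seq n.+1 c -> nc (negbin_sum M n (iter (n.+1 - d) fdiff c) z) <=
    (2 / nc (1 - z)) ^+ d * c 0.
  by have := key n.+1 n c (leqnn _) cM cn; rewrite subnn.
elim: d {n c cM cn c0} => [|d IH] n c dn cM cn; have c0 := cm_seq_ge0 0 cn.
  rewrite subn0 expr0 mul1r.
  have e1 := negbin_sum_at1 n M0 cM.
  have -> : c 0 = nc (negbin_sum M n (iter n.+1 fdiff c) 1).
    by rewrite e1 /nc normc_real ger0_norm.
  have -> : nc (negbin_sum M n (iter n.+1 fdiff c) 1) =
      \sum_(0 <= m < M) 'C(m + n, n)%:R * iter n.+1 fdiff c m.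
    rewrite /negbin_sum; under eq_bigr do rewrite expr1n mulr1.
    rewrite -rmorph_sum. rewrite /nc normc_real ger0_norm// sumr_ge0// => m _.
    by rewrite mulr_ge0//; exact: (cm_seq_iter m cn).
  rewrite /negbin_sum.
  have nsum (F : nat -> R[i]) : nc (\sum_(0 <= m < M) F m) <= \sum_(0 <= m < M) nc (F m).
    elim/big_rec2 : _ => [|i x y _ h]; first by rewrite /nc Normc.normc0.
    by rewrite (le_trans (le_normcD _ _))// lerD2l.
  rewrite (le_trans (nsum _))//; apply: ler_sum => m _.
  have h0 : 0 <= 'C(m + n, n)%:R * iter n.+1 fdiff c m.
    by rewrite mulr_ge0//; exact: (cm_seq_iter m cn).
  rewrite /nc Normc.normcM normc_real ger0_norm// ler_piMr//.
  elim: m {h0} => [|m ihm]; first by rewrite expr0 Normc.normc1.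
  by rewrite exprS Normc.normcM mulr_ile1 ?normc_ge0.
have e : (n.+1 - d.+1)%N = (n - d)%N by rewrite subSS.
rewrite e; set ee := iter (n - d) fdiff c.
have h2 : nc (negbin_sum M n (fdiff ee) z) <= (2 / nc (1 - z)) ^+ d * c 0.
  by rewrite -[fdiff ee]iterS -subSn//; apply: IH => //; exact: ltnW.
suff h : nc ((1 - z) * negbin_sum M n ee z) <= 2 * ((2 / nc (1 - z)) ^+ d * c 0).
  move: h; rewrite /nc Normc.normcM -/nc => h.
  rewrite exprS -mulrA -(ler_pM2l z10) [leRHS]mulrA [nc (1 - z) * (_ / _)]mulrC.
  by rewrite divfK ?gt_eqF.
have hz : nc (- (z * negbin_sum M n (fdiff ee) z)) <= (2 / nc (1 - z)) ^+ d * c 0.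
  rewrite /nc normcN Normc.normcM (le_trans _ h2)// ler_piMl//; exact: normc_ge0.
case: n dn cn e @ee h2 hz => [|n] dn cn e ee h2 hz.
  have d0 : d = 0%N by case: d dn {IH e ee h2 hz}.
  rewrite negbin_sum0//.
  rewrite (le_trans (le_normcD _ _))// mulr2n mulrDl mul1r lerD//.
by rewrite d0 expr0 mul1r /ee d0 /nc normc_real subn0 ger0_norm.
rewrite negbin_sum_rec; last exact: (fdiff_vanish cM).
rewrite (le_trans (le_normcD _ _))// mulr2n mulrDl mul1r lerD//.
by apply: IH => //; exact: cm_seqW.
Qed.

End MonotoneSequences.

(** * Completely monotone functions *)

Section MonotoneFunctions.
Context {R : realType}.
Implicit Types (D Z : set R) (f g : R -> R) (k : nat).

(** The sign is imposed on [D], and the vanishing of [f] and of its derivatives up to order [k] on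
    [Z], which will be the cut-off frequency. Derivatives are two-sided on all of (0, +oo), so the
    right end point of the integration interval is an interior point. *)
Fixpoint cm D Z k f : Prop :=
  (forall x : R, (D x -> 0 <= f x) /\ (Z x -> f x = 0)) /\
  if k is k'.+1 then
    exists2 g : R -> R, (forall x : R, 0 < x -> is_derive x 1 f (- g x)) & cm D Z k' g
  else True.

Lemma cm_ge0 D Z k f x : cm D Z k f -> D x -> 0 <= f x.
Proof. by case: k => [|k] [h _]; exact: (proj1 (h x)). Qed.

Lemma cm_eq0 D Z k f x : cm D Z k f -> Z x -> f x = 0.
Proof. by case: k => [|k] [h _]; exact: (proj2 (h x)). Qed.

Lemma cmW D Z k f : cm D Z k.+1 f -> cm D Z k f.
Proof.
elim: k f => [|k IH] f; first by case.
by case=> f0 [g fg /IH gk]; split=> //; exists g.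
Qed.

Lemma cmD D Z k f g : cm D Z k f -> cm D Z k g -> cm D Z k (f \+ g).
Proof.
elim: k f g => [|k IH] f g [f0 hf] [g0 hg]; split => //;
  try by move=> x; have [h1 h2] := f0 x; have [h3 h4] := g0 x; split=> h;
         rewrite /= ?addr_ge0 ?h1 ?h3// h2// h4// addr0.
case: hf hg => [f1 df hf1] [g1 dg hg1]; exists (f1 \+ g1); last exact: IH.
move=> x x0; have := df x x0; have := dg x x0 => ? ?.
by apply: is_derive_eq; rewrite opprD.
Qed.

(** Leibniz rule; the vanishing on [Z] is inherited from the first factor alone. *)
Lemma cmM D Z k f g : cm D Z k f -> cm D set0 k g -> cm D Z k (f \* g).
Proof.
elim: k f g => [|k IH] f g.
  case=> f0 _ [g0 _]; split=> // x; have [h1 h2] := f0 x; have [h3 h4] := g0 x.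
  by split=> h; rewrite /= ?mulr_ge0 ?h1 ?h3// h2// mul0r.
move=> hf hg; split.
  move=> x; split=> h; last by rewrite /= (cm_eq0 hf h) mul0r.
  by rewrite mulr_ge0//; [exact: cm_ge0 hf h|exact: cm_ge0 hg h].
have hf' := cmW hf; have hg' := cmW hg.
case: hf hg => [f0 [f1 df hf1]] [g0 [g1 dg hg1]].
exists ((f1 \* g) \+ (f \* g1)); last by apply: cmD; apply: IH.
move=> x x0; have := df x x0; have := dg x x0 => ? ?.
by apply: is_derive_eq; rewrite /= /GRing.scale/=; ring.
Qed.

Lemma cm_cst D k (a : R) : 0 <= a -> cm D set0 k (cst a).
Proof.
elim: k a => [|k IH] a a0; split => //.
exists (cst 0); last exact: IH.
by move=> x x0; apply: is_derive_eq; rewrite /= oppr0.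
Qed.

Lemma cm_powRN D k (b : R) : (forall x : R, D x -> 0 < x) -> 0 <= b ->
  cm D set0 k (fun x => x `^ (- b)).
Proof.
move=> D0; elim: k b => [|k IH] b b0; split => //;
  try by move=> x; split=> // _; exact: powR_ge0.
exists (cst b \* (fun x => x `^ (- (b + 1)))); last first.
  by apply: cmM; [exact: cm_cst|apply: IH; lra].
move=> x x0; apply: is_derive_eq; first exact: is_derive1_powR.
by rewrite /= mulNr opprD.
Qed.

(** Minus the derivative is the function itself times t a x^(a-1), a nonpositive power because
    [a <= 1]; the product rule closes the induction on the order. *)
Lemma cm_expR_powR D k (t a : R) : (forall x : R, D x -> 0 < x) -> 0 <= t ->
  0 <= a <= 1 -> cm D set0 k (fun x => expR (- t * x `^ a)).
Proof.
move=> D0 t0 a01; elim: k => [|k IH]; split => //;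
  try by move=> x; split=> // _; exact: expR_ge0.
exists ((cst (t * a) \* (fun x => x `^ (- (1 - a)))) \* (fun x => expR (- t * x `^ a))).
  move=> x x0.
  have h : is_derive x 1 (fun x => - t * x `^ a) (- t * (a * x `^ (a - 1))).
    have := is_derive1_powR a x0 => ?.
    by rewrite (_ : (fun x => _) = (- t) \*: (fun x : R => x `^ a)); [exact: is_deriveZ|].
  rewrite (_ : (fun x => _) = expR \o (fun x => - t * x `^ a))//.
  have h2 : is_derive x 1 (expR \o (fun x => - t * x `^ a))
      (expR (- t * x `^ a) * (- t * (a * x `^ (a - 1)))) by exact: is_derive1_comp.
  apply: is_derive_eq.
  by rewrite /= opprB; ring.
apply: cmM => //; apply: cmM; last by apply: cm_powRN => //; lra.
by apply: cm_cst; apply: mulr_ge0; lra.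
Qed.

(** The exponent exceeds the order, so every derivative up to order [k] keeps a factor
    [1 - x / l]. *)
Lemma cm_expr D k (l : R) p : 0 < l -> (forall x, D x -> x <= l) -> (k < p)%N ->
  cm D [set l] k (fun x => (1 - x / l) ^+ p).
Proof.
move=> l0 Dl; elim: k p => [|k IH] p kp; split => //;
  try by move=> x; split=> [Dx|->]; [rewrite exprn_ge0// subr_ge0 ler_pdivrMr// mul1r Dl|
         rewrite divff ?gt_eqF// subrr expr0n; case: p kp].
exists ((fun x => (1 - x / l) ^+ p.-1) \* cst (p%:R / l)); last first.
  apply: cmM; first by apply: IH; case: p kp.
  by apply: cm_cst; rewrite divr_ge0// ltW.
move=> x x0.
have h : is_derive x 1 (fun x : R => 1 - x / l) (- l^-1).
  rewrite (_ : (fun x => _) = cst 1 - (l^-1 \*: (@id R))); last first.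
    by apply/funext => y /=; rewrite fctE /= /GRing.scale /= mulrC.
  by apply: is_derive_eq; rewrite /GRing.scale/=; ring.
rewrite (_ : (fun x => _) = (fun x : R => 1 - x / l) ^+ p); last first.
  by apply/funext => y; rewrite exprfctE.
by apply: is_derive_eq; rewrite /GRing.scale /=; ring.
Qed.

Lemma cm_decr D Z k f x y : (forall z : R, 0 < z -> D z) -> cm D Z k.+1 f ->
  0 < x -> x <= y -> f y <= f x.
Proof.
move=> D0 [f0 [g df gk]] x0 xy.
have cf : {within `[x, y], continuous f}.
  apply: derivable_within_continuous => z; rewrite in_itv /= => /andP[xz _].
  by have [] := df z (lt_le_trans x0 xz).
move: xy; rewrite le_eqVlt => /predU1P[->//|xy].
have df' z : z \in `]x, y[ -> is_derive z 1 f (- g z).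
  by rewrite in_itv /= => /andP[xz _]; apply: df; exact: lt_trans xz.
have [c cI e] := MVT xy df' cf.
move: cI; rewrite in_itv /= => /andP[xc cy].
have : 0 <= g c by apply: (cm_ge0 gk); apply: D0; exact: lt_trans xc.
have : 0 < y - x by lra.
by move: e; nra.
Qed.

(** Unit differences commute with derivation; the extra order is spent on the monotonicity that
    gives their sign. *)
Lemma cm_fdiff D k f : (forall z : R, 0 < z <-> D z) -> cm D set0 k.+1 f ->
  cm D set0 k (fun x => f x - f (x + 1)).
Proof.
move=> D0; elim: k f => [|k IH] f fk; split => //;
  try by move=> x; split=> // /D0 x0; rewrite subr_ge0 (cm_decr _ fk)//; [move=> z /D0|lra].
case: fk => f0 [g df gk]; exists (fun x => g x - g (x + 1)); last exact: IH.
move=> x x0; have x10 : 0 < x + 1 by lra.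
have h1 := df x x0.
have h2 : is_derive x 1 (fun x => f (x + 1)) (- g (x + 1)).
  have := df _ x10 => d1.
  have ds : is_derive x 1 (fun x : R => x + 1) 1.
    rewrite (_ : (fun x => _) = id + cst (1 : R))//.
    by apply: is_derive_eq; rewrite addr0.
  rewrite (_ : (fun x => _) = f \o (fun x => x + 1))// -[- _]mulr1.
  exact: is_derive1_comp.
rewrite (_ : (fun x => _) = f - (fun x => f (x + 1)))//.
by apply: is_derive_eq; ring.
Qed.

(** Sampling starts at 1 because derivatives are available on (0, +oo) only: x^alpha is singular at
    0. *)
Lemma cm_seq_of_cm D k f : (forall z : R, 0 < z <-> D z) -> cm D set0 k f ->
  cm_seq k (fun m => f m.+1%:R).
Proof.
move=> D0; elim: k f => [|k IH] f fk.
  by split=> // m; apply: (cm_ge0 fk); apply/D0.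
split; first by move=> m; apply: (cm_ge0 fk); apply/D0.
have := IH _ (cm_fdiff D0 fk).
by congr cm_seq; apply/funext => m; rewrite /fdiff natr1.
Qed.

(** The nested witnesses are collected into one family: on (0, +oo), [c j] is (-1)^j times the
    derivative of order [j]. *)
Lemma cm_derivatives D Z k f : cm D Z k f -> exists c : nat -> R -> R,
  [/\ c 0 = f, forall j (x : R), (j < k)%N -> 0 < x -> is_derive x 1 (c j) (- c j.+1 x) &
      forall j x, (j <= k)%N -> (D x -> 0 <= c j x) /\ (Z x -> c j x = 0)].
Proof.
elim: k f => [|k IH] f.
  by case=> f0 _; exists (fun=> f); split => // j x _; exact: f0.
case=> f0 [g df /IH[c [c0 dc cge]]].
exists (fun j => if j is j'.+1 then c j' else f); split => //.
  by move=> [|j] x; [rewrite c0 => _; exact: df|exact: dc].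
by move=> [|j] x; [move=> _; exact: f0|exact: cge].
Qed.

End MonotoneFunctions.

(** * Modulus, real part and imaginary part *)

Lemma normc_sqr (R : rcfType) (z : R[i]) :
  Normc.normc z ^+ 2 = complex.Re z ^+ 2 + complex.Im z ^+ 2.
Proof. by case: z => a b /=; rewrite sqr_sqrtr// addr_ge0// sqr_ge0. Qed.

Lemma normc_Re (R : rcfType) (z : R[i]) : `|complex.Re z| <= Normc.normc z.
Proof.
rewrite -(@ler_pXn2r _ 2) ?nnegrE ?normr_ge0 ?normc_ge0 // normc_sqr real_normK ?num_real//.
by rewrite lerDl sqr_ge0.
Qed.

Lemma normc_Im (R : rcfType) (z : R[i]) : `|complex.Im z| <= Normc.normc z.
Proof.
rewrite -(@ler_pXn2r _ 2) ?nnegrE ?normr_ge0 ?normc_ge0 // normc_sqr real_normK ?num_real//.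
by rewrite lerDr sqr_ge0.
Qed.

Lemma normc_le (R : rcfType) (z : R[i]) :
  Normc.normc z <= `|complex.Re z| + `|complex.Im z|.
Proof.
rewrite -(@ler_pXn2r _ 2)// ?nnegrE ?normc_ge0 ?addr_ge0// normc_sqr.
by rewrite sqrrD !real_normK ?num_real// lerD2r lerDl mulrn_wge0 ?mulr_ge0.
Qed.

Lemma cReM (R : rcfType) (z w : R[i]) :
  complex.Re (z * w) = complex.Re z * complex.Re w - complex.Im z * complex.Im w.
Proof. by case: z; case: w. Qed.

Lemma cImM (R : rcfType) (z w : R[i]) :
  complex.Im (z * w) = complex.Re z * complex.Im w + complex.Im z * complex.Re w.
Proof. by case: z => a b; case: w => c d /=; rewrite addrC addrC. Qed.

Lemma cReD (R : rcfType) (z w : R[i]) : complex.Re (z + w) = complex.Re z + complex.Re w.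
Proof. by case: z; case: w. Qed.

Lemma cImD (R : rcfType) (z w : R[i]) : complex.Im (z + w) = complex.Im z + complex.Im w.
Proof. by case: z; case: w. Qed.

Lemma cReN (R : rcfType) (z : R[i]) : complex.Re (- z) = - complex.Re z.
Proof. by case: z. Qed.

Lemma cImN (R : rcfType) (z : R[i]) : complex.Im (- z) = - complex.Im z.
Proof. by case: z. Qed.

Lemma complex_ext (R : rcfType) (z w : R[i]) : complex.Re z = complex.Re w ->
  complex.Im z = complex.Im w -> z = w.
Proof. by case: z => a b; case: w => c d /= -> ->. Qed.

(** * The L2 seminorm of complex functions *)

Section L2facts.
Context {R : realType} {d : measure_display} {X : measurableType d}.
Context (mu : {measure set X -> \bar R}) (D : set X).
Hypothesis mD : measurable D.
Implicit Types f g : X -> R[i].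
Let nc := @Normc.normc R.

Lemma CmeasurableD f g : Cmeasurable D f -> Cmeasurable D g ->
  Cmeasurable D (fun x => f x + g x).
Proof.
move=> [f1 f2] [g1 g2]; split.
- under eq_fun do rewrite cReD; exact: measurable_funD.
- under eq_fun do rewrite cImD; exact: measurable_funD.
Qed.

Lemma CmeasurableM f g : Cmeasurable D f -> Cmeasurable D g ->
  Cmeasurable D (fun x => f x * g x).
Proof.
move=> [f1 f2] [g1 g2]; split.
- under eq_fun do rewrite cReM; apply: measurable_funB; exact: measurable_funM.
- under eq_fun do rewrite cImM; apply: measurable_funD; exact: measurable_funM.
Qed.

Lemma Cmeasurable_cst (a : R[i]) : Cmeasurable D (fun=> a).
Proof. by split; exact: measurable_cst. Qed.

Lemma CmeasurableN f : Cmeasurable D f -> Cmeasurable D (fun x => - f x).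
Proof.
move=> [f1 f2]; split.
- by under eq_fun do rewrite cReN; exact: measurableT_comp.
- by under eq_fun do rewrite cImN; exact: measurableT_comp.
Qed.

Lemma CmeasurableB f g : Cmeasurable D f -> Cmeasurable D g ->
  Cmeasurable D (fun x => f x - g x).
Proof. by move=> hf hg; apply: CmeasurableD => //; exact: CmeasurableN. Qed.

Lemma measurable_normc_sqr f : Cmeasurable D f ->
  measurable_fun D (fun x => nc (f x) ^+ 2).
Proof.
move=> [f1 f2]; rewrite /nc; under eq_fun do rewrite normc_sqr.
by apply: measurable_funD; apply: measurable_funX.
Qed.

Lemma measurable_normc f : Cmeasurable D f -> measurable_fun D (fun x => nc (f x)).
Proof.
move=> mf.
rewrite (_ : (fun x => _) = Num.sqrt \o (fun x => nc (f x) ^+ 2)); last first.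
  by apply/funext => x /=; rewrite sqrtr_sqr ger0_norm ?normc_ge0.
apply: measurableT_comp; last exact: measurable_normc_sqr.
by apply: continuous_measurable_fun; exact: sqrt_continuous.
Qed.

Definition L2sq f : \bar R := (\int[mu]_(x in D) (nc (f x) ^+ 2)%:E)%E.

Lemma L2norm_sq f : (L2norm mu D f `^ 2)%E = L2sq f.
Proof.
rewrite /L2norm poweR_Lnorm//.
rewrite /L2sq [in RHS]integral_mkcond; apply: eq_integral => x _.
rewrite !patchE; case: ifPn => _; last by rewrite abse0 poweR0r.
rewrite abse_EFin poweR_EFin ger0_norm ?normc_ge0//.
by rewrite (powR_mulrn 2) ?normc_ge0.
Qed.

Lemma L2norm_ge0 f : (0 <= L2norm mu D f)%E. Proof. exact: Lnorm_ge0. Qed.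

Lemma L2_sqP f : L2 mu D f <-> Cmeasurable D f /\ (L2sq f < +oo)%E.
Proof.
rewrite /L2 -L2norm_sq; split => -[h1 h2]; split => //; first exact: poweR_lty.
by apply: lty_poweRy h2.
Qed.

Definition n2 f : R := fine (L2norm mu D f).

Lemma n2_ge0 f : 0 <= n2 f.
Proof. by rewrite fine_ge0// L2norm_ge0. Qed.

Lemma L2norm_fin f : L2 mu D f -> L2norm mu D f = (n2 f)%:E.
Proof. by case=> _ h; rewrite /n2 fineK// ge0_fin_numE// L2norm_ge0. Qed.

Lemma L2sq_n2 f : L2 mu D f -> L2sq f = (n2 f ^+ 2)%:E.
Proof.
by move=> hf; rewrite -L2norm_sq L2norm_fin// poweR_EFin (powR_mulrn 2) ?n2_ge0.
Qed.

Lemma n2_le f (e : R) : 0 <= e -> L2 mu D f -> (L2sq f <= (e ^+ 2)%:E)%E -> n2 f <= e.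
Proof.
move=> e0 hf; rewrite L2sq_n2// lee_fin ler_pXn2r ?nnegrE ?n2_ge0//.
Qed.

Lemma L2norm_restrict f : L2norm mu D f =
  ('N[mu]_2%:E[EFin \o ((fun x => nc (f x)) \_ D)])%E.
Proof. by rewrite /L2norm -restrict_EFin. Qed.

(** Minkowski's inequality for the moduli, extended by 0 outside [D]. *)
Lemma L2norm_triangle f g h : Cmeasurable D f -> Cmeasurable D g -> Cmeasurable D h ->
  (forall x, D x -> nc (h x) <= nc (f x) + nc (g x)) ->
  (L2norm mu D h <= L2norm mu D f + L2norm mu D g)%E.
Proof.
move=> mf mg mh hle; rewrite !L2norm_restrict.
have mr k : Cmeasurable D k -> measurable_fun setT ((fun x => nc (k x)) \_ D).
  by move=> mk; apply/(measurable_restrictT _ _).1 => //; exact: measurable_normc.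
have := @minkowski_EFin _ _ _ mu _ _ _ (mr _ mf) (mr _ mg) (ler1n R 2).
apply: le_trans; rewrite unlock gt0_ler_poweR ?invr_ge0//.
- by rewrite in_itv/= leey integral_ge0// => x _; exact: poweR_ge0.
- by rewrite in_itv/= leey integral_ge0// => x _; exact: poweR_ge0.
have mp (k : X -> R) : measurable_fun setT k -> measurable_fun setT (fun x => (`|(EFin \o k) x| `^ 2)%E).
  move=> mk; apply: (eq_measurable_fun (fun x => (`|k x| ^+ 2)%:E)).
    by move=> x _; rewrite /= (powR_mulrn 2).
  by apply/measurable_EFinP; apply: measurable_funX; exact: measurableT_comp.
apply: ge0_le_integral => //.
- by move=> x _; exact: poweR_ge0.
- by apply: mp; exact: mr.
- by apply: mp; apply: measurable_funD; exact: mr.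
move=> x _ /=; rewrite lee_fin ge0_ler_powR ?nnegrE//.
rewrite !patchE; case: ifPn => xD; last by rewrite addr0.
rewrite !ger0_norm ?addr_ge0 ?normc_ge0//; apply: hle.
by rewrite inE in xD.
Qed.

Lemma n2D f g : L2 mu D f -> L2 mu D g ->
  L2 mu D (fun x => f x + g x) /\ n2 (fun x => f x + g x) <= n2 f + n2 g.
Proof.
move=> hf hg.
have h : (L2norm mu D (fun x => f x + g x)%R <= L2norm mu D f + L2norm mu D g)%E.
  case: hf hg => mf _ [mg _]; apply: L2norm_triangle => //; first exact: CmeasurableD.
  by move=> x _; exact: le_normcD.
rewrite (L2norm_fin hf) (L2norm_fin hg) -EFinD in h.
have L : L2 mu D (fun x => f x + g x).
  split; first by apply: CmeasurableD; [exact: (proj1 hf)|exact: (proj1 hg)].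
  by rewrite (le_lt_trans h)// ltry.
by split => //; rewrite -lee_fin -L2norm_fin.
Qed.

Lemma n2Z (a : R[i]) f : L2 mu D f ->
  L2 mu D (fun x => a * f x) /\ n2 (fun x => a * f x) = nc a * n2 f.
Proof.
move=> hf; have hsq : L2sq (fun x => a * f x) = ((nc a ^+ 2)%:E * L2sq f)%E.
  have mq : measurable_fun D (fun x => (nc (f x) ^+ 2)%:E).
    by apply/measurable_EFinP; apply: measurable_normc_sqr; case: hf.
  rewrite /L2sq -(ge0_integralZl_EFin _ mD _ mq) ?sqr_ge0//; last first.
    by move=> x _; rewrite lee_fin sqr_ge0.
  by apply: eq_integral => x _; rewrite -EFinM -exprMn /nc Normc.normcM.
have L : L2 mu D (fun x => a * f x).
  apply/L2_sqP; split.
    by apply: CmeasurableM; [exact: Cmeasurable_cst|case: hf].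
  by rewrite hsq L2sq_n2// -EFinM ltry.
split=> //.
have h0 : nc a * n2 f >= 0 by rewrite mulr_ge0// ?n2_ge0// normc_ge0.
apply/eqP; rewrite -(@eqrXn2 _ 2)// ?n2_ge0//; apply/eqP/EFin_inj.
by rewrite -L2sq_n2// hsq L2sq_n2// -EFinM exprMn.
Qed.

Lemma L2_0 : L2 mu D (fun=> 0).
Proof.
apply/L2_sqP; split; first exact: Cmeasurable_cst.
rewrite /L2sq; under eq_integral do rewrite /nc Normc.normc0 expr0n.
by rewrite integral0.
Qed.

Lemma n2_eq0 f : L2 mu D f -> n2 f = 0 <-> eqL2 mu D f (fun=> 0).
Proof.
move=> hf; have [mf _] := hf.
have me : measurable_fun D (fun x => (nc (f x) ^+ 2)%:E).
  by apply/measurable_EFinP; exact: measurable_normc_sqr.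
have sqE : L2sq f = (\int[mu]_(x in D) `|(nc (f x) ^+ 2)%:E|)%E.
  by apply: eq_integral => x _; rewrite gee0_abs// lee_fin sqr_ge0.
split.
  move=> h; have : L2sq f = 0 by rewrite L2sq_n2// h expr0n.
  rewrite sqE => /(ae_eq_integral_abs mu mD me); apply: filterS => x h1 Dx.
  have := h1 Dx => -[] /eqP; rewrite sqrf_eq0 => /eqP; exact: Normc.eq0_normc.
move=> h; have : L2sq f = 0.
  rewrite sqE; apply/(ae_eq_integral_abs mu mD me).
  apply: filterS h => x h1 Dx; rewrite /nc h1// Normc.normc0 expr0n//.
by rewrite L2sq_n2// => -[] /eqP; rewrite sqrf_eq0 => /eqP.
Qed.

End L2facts.

(** * Completeness of L2 (Riesz-Fischer) *)

Lemma cvg_fast (R : realType) (a : nat -> R) (C : R) :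
  (forall j, `|a j.+1 - a j| <= C * (2 ^+ j)^-1) -> cvgn a.
Proof.
move=> h.
have C0 : 0 <= C by have := h 0%N; rewrite expr0 invr1 mulr1; apply: le_trans.
have hs : cvgn (series (telescope a)).
  apply: normed_cvg; rewrite /normed_series_of /=.
  apply: (@series_le_cvg _ _ (geometric C 2^-1)) => //.
  - by move=> n /=; rewrite mulr_ge0.
  - by move=> n /=; rewrite exprVn; exact: h.
  - by apply: is_cvg_geometric_series; rewrite ger0_norm; lra.
rewrite (_ : a = (fun n => a 0%N + series (telescope a) n)); last first.
  by apply/funext => n; exact: eq_sum_telescope.
by apply: is_cvgD => //; exact: is_cvg_cst.
Qed.

Section Completeness.
Context {R : realType} {d : measure_display} {X : measurableType d}.
Context (mu : {measure set X -> \bar R}) (D : set X).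
Hypothesis mD : measurable D.
Let nc := @Normc.normc R.

Lemma n2B (f g : X -> R[i]) : L2 mu D f -> L2 mu D g ->
  L2 mu D (fun x => f x - g x) /\ n2 mu D (fun x => f x - g x) <= n2 mu D f + n2 mu D g.
Proof.
move=> hf hg; have [h1 h2] := n2Z mD (-1) hg.
have e : (fun x => f x - g x) = (fun x => f x + -1 * g x).
  by apply/funext => x; rewrite mulN1r.
rewrite e; have [h3 h4] := n2D mD hf h1; split => //.
by move: h4; rewrite h2 normcN Normc.normc1 mul1r.
Qed.

Lemma n2BC (f g : X -> R[i]) : n2 mu D (fun x => f x - g x) = n2 mu D (fun x => g x - f x).
Proof.
rewrite /n2 /L2norm; congr (fine (Lnorm _ _ _)); congr (_ \_ _).
by apply/funext => x; rewrite -normcN opprB.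
Qed.

Let ae_cvg (v : nat -> X -> R[i]) (w : X -> R[i]) :=
  {ae mu, forall x, D x -> complex.Re (v j x) @[j --> \oo] --> complex.Re (w x) /\
                           complex.Im (v j x) @[j --> \oo] --> complex.Im (w x)}.

(** Of the decay [16 ^- j] of the squared norms, [4 ^+ j] is given back as a weight. Where the
    weighted series is finite, that is almost everywhere, the moduli decay like [2 ^- j]. *)
Lemma L2sq_sum_finite (g : nat -> X -> R[i]) : (forall j, L2 mu D (g j)) ->
  (forall j, n2 mu D (g j) <= (4 ^+ j)^-1) ->
  (\int[mu]_(x in D) (\sum_(j <oo) (4 ^+ j * nc (g j x) ^+ 2)%:E) <= 2%:E)%E.
Proof.
move=> gL hg.
have r0 j : 0 < (4 ^+ j)^-1 :> R by rewrite invr_gt0 exprn_gt0.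
have mg j : measurable_fun D (fun x => (4 ^+ j * nc (g j x) ^+ 2)%:E).
  apply/measurable_EFinP; apply: measurable_funM; first exact: measurable_cst.
  by apply: measurable_normc_sqr; case: (gL j).
have g0 j x : (0 <= (4 ^+ j * nc (g j x) ^+ 2)%:E)%E.
  by rewrite lee_fin mulr_ge0 ?sqr_ge0// exprn_ge0.
rewrite integral_nneseries//; apply: lime_le.
  by apply: is_cvg_nneseries => // n _ _; exact: integral_ge0.
apply: nearW => n.
(* The exact partial sum of the geometric series makes the induction close. *)
suff : (\sum_(0 <= i < n) \int[mu]_(x in D) (4 ^+ i * nc (g i x) ^+ 2)%:E
    <= (4 / 3 - 4 / 3 * (4 ^+ n)^-1)%:E)%E.
  by move/le_trans; apply; rewrite lee_fin; have := r0 n; lra.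
elim: n => [|n IH]; first by rewrite big_geq// lee_fin expr0; lra.
rewrite big_nat_recr//=.
have -> : (\int[mu]_(x in D) (4 ^+ n * nc (g n x) ^+ 2)%:E)%E =
    (4 ^+ n * n2 mu D (g n) ^+ 2)%:E.
  under eq_integral do rewrite EFinM.
  rewrite ge0_integralZl_EFin ?exprn_ge0//.
  - by rewrite -/(L2sq mu D _) (L2sq_n2 (gL n)).
  - by move=> x _; rewrite lee_fin sqr_ge0.
  - by apply/measurable_EFinP; apply: measurable_normc_sqr; case: (gL n).
apply: le_trans (leeD IH (lexx _)) _; rewrite -EFinD lee_fin (exprS 4 n) invfM.
have h2 : 4 ^+ n * n2 mu D (g n) ^+ 2 <= 4 ^+ n * (4 ^+ n)^-1 ^+ 2.
  by rewrite ler_pM2l ?exprn_gt0// ler_pXn2r ?nnegrE ?n2_ge0// ltW.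
have h3 : 4 ^+ n * (4 ^+ n)^-1 ^+ 2 = (4 ^+ n)^-1 :> R by field; rewrite expf_neq0.
by lra.
Qed.

Lemma L2_fast_cvg (v : nat -> X -> R[i]) : (forall j, L2 mu D (v j)) ->
  (forall j, n2 mu D (fun x => v j.+1 x - v j x) <= (4 ^+ j)^-1) ->
  exists2 w, Cmeasurable D w & ae_cvg v w.
Proof.
move=> vL vv.
have mv j : Cmeasurable D (v j) by case: (vL j).
have gL j : L2 mu D (fun x => v j.+1 x - v j x) by have [] := n2B (vL j.+1) (vL j).
pose g j x := 4 ^+ j * nc (v j.+1 x - v j x) ^+ 2.
have gE0 j x : (0 <= (g j x)%:E)%E by rewrite lee_fin mulr_ge0 ?sqr_ge0// exprn_ge0.
have mg j : measurable_fun D (fun x => (g j x)%:E).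
  apply/measurable_EFinP; apply: measurable_funM; first exact: measurable_cst.
  by apply: measurable_normc_sqr; case: (gL j).
pose h x := (\sum_(j <oo) (g j x)%:E)%E.
have mh : measurable_fun D h by exact: ge0_emeasurable_sum.
have h0 x : (0 <= h x)%E by apply: nneseries_ge0.
have inth : mu.-integrable D h.
  apply/integrableP; split => //; rewrite (le_lt_trans _ (ltry 2))//.
  rewrite (le_trans _ (L2sq_sum_finite gL vv))//.
  by under eq_integral do rewrite gee0_abs//.
have hfin : {ae mu, forall x, D x -> h x \is a fin_num} by exact: (integrable_ae mD inth).
pose E := D `&` [set x | h x \is a fin_num].
have mE : measurable E by exact: emeasurable_fin_num.
have bnd x j : E x -> nc (v j.+1 x - v j x) <= (fine (h x) + 1) * (2 ^+ j)^-1.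
  move=> [Dx hx].
  have hj : g j x <= fine (h x).
    rewrite -lee_fin fineK//.
    have := @nneseries_lim_ge R (fun j => (g j x)%:E) xpredT 0 j.+1 (fun n _ _ => gE0 n x).
    by apply: le_trans; rewrite big_nat_recr//= leeDr// sume_ge0.
  have hge : 0 <= fine (h x) by rewrite fine_ge0.
  have p0 : 0 < 2 ^+ j :> R by rewrite exprn_gt0.
  have n0 : 0 <= nc (v j.+1 x - v j x) by exact: normc_ge0.
  rewrite ler_pdivlMr// -(@ler_pXn2r _ 2) ?nnegrE ?mulr_ge0 ?(ltW p0) ?addr_ge0//.
  rewrite exprMn -exprM mulnC exprM (_ : 2 ^+ 2 = 4); last by rewrite expr2; lra.
  by rewrite mulrC (le_trans hj)// expr2; nra.
(* Cutting off to [E] makes the sequences converge everywhere, so that their limits are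
   measurable. *)
pose p j x := complex.Re (v j x) * \1_E x.
pose q j x := complex.Im (v j x) * \1_E x.
have mp j : measurable_fun D (p j).
  by apply: measurable_funM; [case: (mv j)|exact: measurable_indic].
have mq j : measurable_fun D (q j).
  by apply: measurable_funM; [case: (mv j)|exact: measurable_indic].
have pE x : E x -> p ^~ x = (fun j => complex.Re (v j x)).
  by move=> Ex; apply/funext => j; rewrite /p indicE mem_set// mulr1.
have qE x : E x -> q ^~ x = (fun j => complex.Im (v j x)).
  by move=> Ex; apply/funext => j; rewrite /q indicE mem_set// mulr1.
have cp x : cvgn (p ^~ x).
  have [Ex|Ex] := pselect (E x).
    rewrite pE//; apply: (cvg_fast (C := fine (h x) + 1)) => j.
    by rewrite -cReN -cReD; exact: le_trans (normc_Re _) (bnd _ _ Ex).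
  rewrite (_ : p ^~ x = cst 0); first exact: is_cvg_cst.
  by apply/funext => j; rewrite /p indicE memNset// mulr0.
have cq x : cvgn (q ^~ x).
  have [Ex|Ex] := pselect (E x).
    rewrite qE//; apply: (cvg_fast (C := fine (h x) + 1)) => j.
    by rewrite -cImN -cImD; exact: le_trans (normc_Im _) (bnd _ _ Ex).
  rewrite (_ : q ^~ x = cst 0); first exact: is_cvg_cst.
  by apply/funext => j; rewrite /q indicE memNset// mulr0.
exists (fun x => limn (p ^~ x) +i* limn (q ^~ x)).
  split => /=.
  - exact: (@measurable_fun_cvg _ _ _ _ p).
  - exact: (@measurable_fun_cvg _ _ _ _ q).
apply: filterS hfin => x hx Dx; have Ex : E x by split => //; exact: hx.
rewrite /= -(pE x Ex) -(qE x Ex); split; [exact: cp|exact: cq].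
Qed.

(** Fatou's lemma in the index [i], the integrands converging almost everywhere. *)
Lemma L2sq_lim_le (v : nat -> X -> R[i]) (w : X -> R[i]) j (r : R) : 0 <= r ->
  (forall i, L2 mu D (v i)) -> Cmeasurable D w -> ae_cvg v w ->
  (forall i, (j <= i)%N -> n2 mu D (fun x => v i x - v j x) <= r) ->
  (L2sq mu D (fun x => w x - v j x)%R <= (r ^+ 2)%:E)%E.
Proof.
move=> r0 vL mw hvw vv.
have mv i : Cmeasurable D (v i) by case: (vL i).
have LB i : L2 mu D (fun x => v i x - v j x) by have [] := n2B (vL i) (vL j).
pose F i x := (nc (v i x - v j x) ^+ 2)%:E.
have mF i : measurable_fun D (F i).
  by apply/measurable_EFinP; apply: measurable_normc_sqr; case: (LB i).
have F0 i x : (0 <= F i x)%E by rewrite lee_fin sqr_ge0.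
have -> : L2sq mu D (fun x => w x - v j x)%R = (\int[mu]_(x in D) limn_einf (F^~ x))%E.
  apply: ge0_ae_eq_integral => //.
  - by apply/measurable_EFinP; apply: measurable_normc_sqr; exact: CmeasurableB.
  - apply: measurableT_comp => //; apply: measurable_fun_limn_esup => n.
    exact: measurableT_comp.
  - by move=> x _; rewrite lee_fin sqr_ge0.
  - move=> x _; rewrite limn_einf_lim; apply: lime_ge; first exact: is_cvg_einfs.
    by apply: nearW => n; apply: le_ereal_inf_tmp => _ [i _ <-]; exact: F0.
  apply: filterS hvw => x hx Dx; have [cRe cIm] := hx Dx.
  apply/esym; suff hc : F ^~ x @ \oo --> (nc (w x - v j x) ^+ 2)%:E.
    by have [-> _] := cvg_limn_einf_sup hc.
  apply: cvg_EFin; first exact: nearW.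
  rewrite /= /nc normc_sqr cReD cImD cReN cImN /=.
  rewrite (_ : _ \o _ = fun i => (complex.Re (v i x) - complex.Re (v j x)) ^+ 2 +
    (complex.Im (v i x) - complex.Im (v j x)) ^+ 2); last first.
    by apply/funext => i /=; rewrite normc_sqr cReD cImD cReN cImN.
  by apply: cvgD; rewrite !expr2; apply: cvgM; apply: cvgB => //; exact: cvg_cst.
apply: le_trans (@fatou _ _ _ mu D mD F mF (fun n x _ => F0 n x)) _.
rewrite limn_einf_lim; apply: lime_le; first exact: is_cvg_einfs.
(* [maxn n j], because the bound holds only from index [j] on. *)
apply: nearW => n; apply: (@le_trans _ _ (\int[mu]_(x in D) F (maxn n j) x)%E).
  by apply: ereal_inf_lbound; exists (maxn n j) => //=; exact: leq_maxl.
rewrite -/(L2sq mu D _) (L2sq_n2 (LB _)) lee_fin ler_pXn2r ?nnegrE ?n2_ge0//.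
by apply: vv; exact: leq_maxr.
Qed.

Lemma L2_complete (u : nat -> X -> R[i]) : (forall n, L2 mu D (u n)) ->
  (forall e : R, 0 < e -> exists n0, forall m n, (n0 <= m)%N -> (n0 <= n)%N ->
     n2 mu D (fun x => u m x - u n x) <= e) ->
  exists v, L2 mu D v /\ forall e : R, 0 < e ->
    exists n0, forall n, (n0 <= n)%N -> n2 mu D (fun x => u n x - v x) <= e.
Proof.
move=> uL ucauchy.
have r0 j : 0 < (4 ^+ j)^-1 :> R by rewrite invr_gt0 exprn_gt0.
have [k hk] := choice (fun j => ucauchy _ (r0 j)).
(* The indices are made monotone so that each bound applies to all later terms of the
   subsequence. *)
have [K [kK Kmono]] : exists K : nat -> nat, (forall j, (k j <= K j)%N) /\
    (forall i j, (i <= j)%N -> (K i <= K j)%N).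
  exists (fun j => \max_(i < j.+1) k i); split.
    by move=> j; rewrite (leq_bigmax (ord_max : 'I_j.+1)).
  move=> i j ij; apply/bigmax_leqP => a _.
  have aj : (a < j.+1)%N by rewrite (leq_trans (ltn_ord a)).
  exact: (leq_bigmax (Ordinal aj)).
have vv i j : (j <= i)%N -> n2 mu D (fun x => u (K i) x - u (K j) x) <= (4 ^+ j)^-1.
  by move=> ji; apply: hk; [rewrite (leq_trans (kK j))// Kmono|exact: kK].
have vL j : L2 mu D (u (K j)) by exact: uL.
have [w mw hw] := L2_fast_cvg vL (fun j => vv _ _ (leqnSn j)).
have wlim j := L2sq_lim_le (ltW (r0 j)) vL mw hw (fun i => vv i j).
have wvL j : L2 mu D (fun x => w x - u (K j) x).
  apply/L2_sqP; split; first by apply: CmeasurableB => //; case: (vL j).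
  by rewrite (le_lt_trans (wlim j))// ltry.
have wL : L2 mu D w.
  have [h _] := n2D mD (wvL 0%N) (vL 0%N).
  have e : w = (fun x => w x - u (K 0%N) x + u (K 0%N) x).
    by apply/funext => x; rewrite subrK.
  by rewrite e.
exists w; split => // e e0.
have [j hj] : exists j, 2 * (4 ^+ j)^-1 <= e.
  have : ((4^-1 : R) ^+ n @[n --> \oo] --> (0 : R)).
    by apply: cvg_expr; rewrite ger0_norm; lra.
  move/cvgrPdist_le => /(_ (e / 2) ltac:(lra))[n0 _ hn0]; exists n0.
  by have := hn0 n0 (leqnn _); rewrite sub0r normrN exprVn ger0_norm ?(ltW (r0 _))//; lra.
exists (K j) => n hn.
have [_ h1] := n2D mD (proj1 (n2B (uL n) (vL j))) (proj1 (n2B (vL j) wL)).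
have e1 : (fun x => u n x - w x) = (fun x => (u n x - u (K j) x) + (u (K j) x - w x)).
  by apply/funext => x; rewrite addrA subrK.
rewrite e1 (le_trans h1)//.
have h2 : n2 mu D (fun x => u n x - u (K j) x) <= (4 ^+ j)^-1.
  by apply: hk; [exact: leq_trans (kK j) hn|exact: kK].
have h3 : n2 mu D (fun x => u (K j) x - w x) <= (4 ^+ j)^-1.
  by rewrite n2BC; apply: n2_le => //; exact: ltW.
by lra.
Qed.

End Completeness.

(** * L2 as a vector space of functions *)

Section L2Space.
Context {R : realType} {d : measure_display} {X : measurableType d}.
Context (mu : {measure set X -> \bar R}) (D : set X).

(** The measurability of [D] is an argument because closure under linear combinations depends on it,
    and the algebraic instances are attached to this predicate. *)
Definition L2_pred of measurable D : {pred X -> R[i]} := [pred f | `[< L2 mu D f >]].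

Context (mD : measurable D).

Lemma L2_predP f : reflect (L2 mu D f) (f \in L2_pred mD).
Proof. exact: asboolP. Qed.

Lemma L2_submod_closed : submod_closed (L2_pred mD).
Proof.
split; first by apply/L2_predP; exact: L2_0.
move=> a f g /L2_predP hf /L2_predP hg; apply/L2_predP.
by have [hf' _] := n2Z mD a hf; have [] := n2D mD hf' hg.
Qed.

HB.instance Definition _ := GRing.isSubmodClosed.Build _ _ (L2_pred mD) L2_submod_closed.

Record L2_space := L2Space { L2_fun : X -> R[i]; L2_funP : L2_fun \in L2_pred mD }.

HB.instance Definition _ := [isSub for L2_fun].
HB.instance Definition _ := [Choice of L2_space by <:].
HB.instance Definition _ := [SubChoice_isSubLmodule of L2_space by <:].

End L2Space.

(** * Limits at 0 from the right in epsilon-delta form *)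

Section RightLimit.
Context {R : realType}.

Lemma at_right0P (P : R -> Prop) : (\forall t \near (0 : R)^'+, P t) <->
  exists2 d : R, 0 < d & forall t, 0 < t <= d -> P t.
Proof.
split=> [|[d d0 h]]; last first.
  near=> t; apply: h; apply/andP; split; near: t.
  - exact: nbhs_right_gt.
  - exact: nbhs_right_le.
rewrite /at_right /within /= => /nbhs_ballP[e /= e0 he].
exists (e / 2); first by rewrite divr_gt0.
move=> t /andP[t0 te]; apply: he => //; rewrite /ball /= sub0r normrN gtr0_norm//.
by lra.
Unshelve. all: by end_near. Qed.

Lemma cvge0_at_right (phi : R -> \bar R) : (forall t, 0 < t -> (0 <= phi t < +oo)%E) ->
  phi t @[t --> 0^'+] --> 0%E <->
  forall e : R, 0 < e -> exists2 d : R, 0 < d &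
    forall t, 0 < t <= d -> fine (phi t) <= e.
Proof.
move=> phi0; split.
  move/fine_cvgP => [_ /cvgrPdist_le h] e /h /at_right0P[d d0 hd]; exists d => // t td.
  have := hd t td; rewrite sub0r normrN; apply: le_trans; exact: ler_norm.
move=> h; apply/fine_cvgP; split.
  apply/at_right0P; exists 1 => // t /andP[t0 _].
  by have /andP[p0 p1] := phi0 t t0; rewrite ge0_fin_numE.
apply/cvgrPdist_le => e /h[d d0 hd]; apply/at_right0P; exists d => // t td.
rewrite sub0r normrN /= ger0_norm ?hd// fine_ge0//.
by have /andP[] := phi0 t (proj1 (andP td)).
Qed.

End RightLimit.

(** * The duality principle for semigroups on L2 *)

Section Duality.
Context {R : realType}.
Notation leb := (@lebesgue_measure R).
Context (D : set R) (mD : @measurable _ (measurableTypeR R) D) (S : R -> (R -> R[i]) -> R -> R[i]).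
Hypothesis HS : c0_semigroup D S.

Notation V := (L2_space leb mD).
Let N (x : V) := n2 leb D (L2_fun x).

Let VL2 (x : V) : L2 leb D (L2_fun x).
Proof. by apply/(L2_predP leb mD _); exact: L2_funP. Qed.

Let mk f (hf : L2 leb D f) : V := L2Space (introT (L2_predP leb mD f) hf).

(** Only for [t >= 0] is [S t] known to preserve L2; otherwise [x] is a default value. *)
Let St (t : R) (x : V) : V :=
  if pselect (L2 leb D (S t (L2_fun x))) is left h then mk h else x.

Let StE (t : R) x : 0 <= t -> L2_fun (St t x) = S t (L2_fun x).
Proof.
by move=> t0; rewrite /St; case: pselect => // -[]; exact: (c0_L2 HS).
Qed.

Let n2_eqL2 f g : L2 leb D f -> L2 leb D g -> eqL2 leb D f g ->
  n2 leb D (fun x => f x - g x) = 0.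
Proof.
move=> hf hg h; apply/(n2_eq0 mD (proj1 (n2B mD hf hg))).
by apply: filterS h => x h Dx; rewrite h// subrr.
Qed.

Lemma generatorP f g : L2 leb D f -> L2 leb D g -> generator D S f g <->
  forall e : R, 0 < e -> exists2 d : R, 0 < d & forall t, 0 < t <= d ->
    n2 leb D (fun x => (t^-1)%:C * (S t f x - f x) - g x) <= e.
Proof.
move=> hf hg.
have h (t : R) : 0 < t ->
    (0 <= L2norm leb D (fun x => (t^-1)%:C * (S t f x - f x) - g x)%R < +oo)%E.
  move=> t0; rewrite L2norm_ge0 /=.
  have [h1 _] := n2B mD (c0_L2 HS (ltW t0) hf) hf.
  have [h2 _] := n2Z mD (t^-1)%:C h1.
  by have [[]] := n2B mD h2 hg.
have hh := cvge0_at_right h; split; first by case=> _ _ /hh.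
by move=> k; split => //; apply/hh.
Qed.

(** The last hypothesis says that t |-> [ell t f] has derivative [ell t g], with a quadratic
    remainder, when [g] is the image of [f] under the generator: [ell] is a weak solution of the
    adjoint equation. *)
Lemma c0_duality (ell : R -> (R -> R[i]) -> R[i]) (T C : R) : 0 <= T ->
  (forall t f g, 0 <= t <= T -> L2 leb D f -> L2 leb D g ->
     ell t (fun x => f x - g x) = ell t f - ell t g) ->
  (forall t a f, 0 <= t <= T -> L2 leb D f ->
     ell t (fun x => a * f x) = a * ell t f) ->
  (forall t f, 0 <= t <= T -> L2 leb D f ->
     Normc.normc (ell t f) <= C * n2 leb D f) ->
  (forall f g, generator D S f g -> exists K : R, forall t h,
     0 <= t -> 0 <= h -> t + h <= T ->
     Normc.normc (ell t f - ell (t + h) f + h%:C * ell (t + h) g) <= K * h ^+ 2 /\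
     Normc.normc (ell t g - ell (t + h) g) <= K * h) ->
  forall f, L2 leb D f -> ell 0 (S T f) = ell T f.
Proof.
move=> T0 ellB ellZ ell_le ell_gen f hf.
have -> : S T f = L2_fun (St T (mk hf)) by rewrite StE.
apply: (@semigroup_duality R V N _ _ _ St _ _ _ _ _ (fun t x => ell t (L2_fun x)) T C T0 _ _ _ _ (mk hf)).
- by move=> x y; exact: (proj2 (n2D mD (VL2 x) (VL2 y))).
- by move=> a x; exact: (proj2 (n2Z mD a (VL2 x))).
- move=> u hu; have [v [vL hv]] := L2_complete mD (fun n => VL2 (u n)) hu.
  by exists (mk vL).
- move=> t a x y t0.
  have Ha := proj1 (n2Z mD a (VL2 x)).
  have Hs := c0_L2 HS t0 (VL2 x).
  apply: (etrans _ (n2_eqL2 _ _ (c0_linear HS a t0 (VL2 x) (VL2 y)))).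
  + by rewrite /N /= !StE.
  + exact: (c0_L2 HS t0 (proj1 (n2D mD Ha (VL2 y)))).
  + exact: (proj1 (n2D mD (proj1 (n2Z mD a Hs)) (c0_L2 HS t0 (VL2 y)))).
- move=> t t0; have [M hM] := c0_bounded HS t0; exists M => x.
  have := hM _ (VL2 x); rewrite /N StE// (L2norm_fin (VL2 x)).
  by rewrite (L2norm_fin (c0_L2 HS t0 (VL2 x))) -EFinM lee_fin.
- move=> x; apply: (etrans _ (n2_eqL2 _ _ (c0_id HS (VL2 x)))) => //.
  + by rewrite /N /= StE.
  + exact: (c0_L2 HS).
- move=> s t x s0 t0.
  have st0 : 0 <= s + t by rewrite addr_ge0.
  apply: (etrans _ (n2_eqL2 _ _ (c0_add HS s0 t0 (VL2 x)))).
  + by rewrite /N /= !StE.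
  + exact: (c0_L2 HS).
  + by apply: (c0_L2 HS) => //; apply: (c0_L2 HS).
- move=> x e e0.
  have h (t : R) : 0 < t ->
      (0 <= L2norm leb D (fun y => S t (L2_fun x) y - L2_fun x y)%R < +oo)%E.
    move=> t0; rewrite L2norm_ge0 /=.
    by have [[]] := n2B mD (c0_L2 HS (ltW t0) (VL2 x)) (VL2 x).
  have [d d0 hd] := (cvge0_at_right h).1 (c0_continuous HS (VL2 x)) e e0.
  exists d => // t /andP[t0 td].
  move: t0; rewrite le_eqVlt => /predU1P[<-|t0].
    suff -> : N (St 0 x - x) = 0 by exact: ltW.
    rewrite /N /= StE//; apply: n2_eqL2 => //; first exact: (c0_L2 HS).
    exact: (c0_id HS).
  by have := hd t; rewrite t0 td => /(_ isT); rewrite /N /= StE// ltW.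
- by move=> t x y ht; exact: (ellB t _ _ ht (VL2 x) (VL2 y)).
- by move=> t a x ht; exact: (ellZ t _ _ ht (VL2 x)).
- by move=> t x ht; exact: (ell_le t _ ht (VL2 x)).
move=> f1 g1 hfg; apply: ell_gen; apply/generatorP => //.
move=> e /hfg[d d0 hd]; exists d => // t td; have := hd t td.
by rewrite /N /= StE//; case/andP: td => /ltW.
Qed.

End Duality.

(** * Integrals of complex functions *)

Section ComplexIntegral.
Context {R : realType} {d : measure_display} {X : measurableType d}.
Context (mu : {measure set X -> \bar R}) (D : set X).
Hypothesis mD : measurable D.
Let nc := @Normc.normc R.
Implicit Types f g q : X -> R[i].

Lemma Cintegrable_le f (h : X -> R) : Cmeasurable D f -> mu.-integrable D (EFin \o h) ->
  (forall x, D x -> nc (f x) <= h x) -> Cintegrable mu D f.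
Proof.
move=> [m1 m2] ih hle; split.
- apply: (le_integrable mD _ _ ih); first exact/measurable_EFinP.
  move=> x Dx; rewrite lee_fin (le_trans (normc_Re _))//.
  by rewrite (le_trans (hle x Dx))// ler_norm.
- apply: (le_integrable mD _ _ ih); first exact/measurable_EFinP.
  move=> x Dx; rewrite lee_fin (le_trans (normc_Im _))//.
  by rewrite (le_trans (hle x Dx))// ler_norm.
Qed.

Lemma integrable_normc_sqr f : L2 mu D f -> mu.-integrable D (fun x => (nc (f x) ^+ 2)%:E).
Proof.
move=> /(L2_sqP mu D)[mf hf]; apply/integrableP; split.
  by apply/measurable_EFinP; exact: measurable_normc_sqr.
rewrite (le_lt_trans _ hf)// /L2sq le_eqVlt; apply/orP; left; apply/eqP.
by apply: eq_integral => x _; rewrite gee0_abs// lee_fin sqr_ge0.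
Qed.

Lemma Cintegrable_mul f g : L2 mu D f -> L2 mu D g -> Cintegrable mu D (fun x => f x * g x).
Proof.
move=> hf hg.
apply: (@Cintegrable_le _ (fun x => nc (f x) ^+ 2 + nc (g x) ^+ 2)).
- by apply: CmeasurableM; [case: hf|case: hg].
- exact: (integrableD mD (integrable_normc_sqr hf) (integrable_normc_sqr hg)).
move=> x Dx; rewrite /nc Normc.normcM.
have := normc_ge0 (f x); have := normc_ge0 (g x).
by rewrite !expr2; nra.
Qed.

Lemma Cintegrable_measurable f : Cintegrable mu D f -> Cmeasurable D f.
Proof. by move=> [/integrableP[m1 _] /integrableP[m2 _]]; split; exact/measurable_EFinP. Qed.

Lemma CintegralB f g : Cintegrable mu D f -> Cintegrable mu D g ->
  Cintegral mu D (fun x => f x - g x) = Cintegral mu D f - Cintegral mu D g.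
Proof.
move=> [f1 f2] [g1 g2]; rewrite /Cintegral; apply: complex_ext => /=.
- by rewrite -RintegralB//; apply: eq_Rintegral => x _; rewrite cReD cReN.
- by rewrite -RintegralB//; apply: eq_Rintegral => x _; rewrite cImD cImN.
Qed.

Lemma CintegralD f g : Cintegrable mu D f -> Cintegrable mu D g ->
  Cintegral mu D (fun x => f x + g x) = Cintegral mu D f + Cintegral mu D g.
Proof.
move=> [f1 f2] [g1 g2]; rewrite /Cintegral; apply: complex_ext => /=.
- by rewrite -RintegralD//; apply: eq_Rintegral => x _; rewrite cReD.
- by rewrite -RintegralD//; apply: eq_Rintegral => x _; rewrite cImD.
Qed.

Lemma CintegrableD f g : Cintegrable mu D f -> Cintegrable mu D g ->
  Cintegrable mu D (fun x => f x + g x).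
Proof.
move=> [f1 f2] [g1 g2]; split.
- under eq_fun do rewrite cReD EFinD; exact: integrableD.
- under eq_fun do rewrite cImD EFinD; exact: integrableD.
Qed.

Lemma CintegralZ (a : R[i]) f : Cintegrable mu D f ->
  Cintegral mu D (fun x => a * f x) = a * Cintegral mu D f.
Proof.
move=> [f1 f2]; rewrite /Cintegral.
have h (b : R) (g : X -> R) : mu.-integrable D (EFin \o g) ->
    mu.-integrable D (EFin \o (fun x => b * g x)).
  by move=> hg; exact: (integrableZl mD b hg).
apply: complex_ext => /=.
- rewrite [RHS]cReM /= -!RintegralZl// -RintegralB//; [|exact: h|exact: h].
  by apply: eq_Rintegral => x _; rewrite cReM.
- rewrite [RHS]cImM /= -!RintegralZl// -RintegralD//; [|exact: h|exact: h].
  by apply: eq_Rintegral => x _; rewrite cImM.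
Qed.

Lemma CintegrableZ (a : R[i]) f : Cintegrable mu D f ->
  Cintegrable mu D (fun x => a * f x).
Proof.
move=> hf; have [f1 f2] := hf.
have h (b : R) (g : X -> R) : mu.-integrable D (EFin \o g) ->
    mu.-integrable D (EFin \o (fun x => b * g x)).
  by move=> hg; exact: (integrableZl mD b hg).
split.
- under eq_fun do rewrite cReM EFinB; apply: integrableB => //; exact: h.
- under eq_fun do rewrite cImM EFinD; apply: integrableD => //; exact: h.
Qed.

Lemma eq_Cintegral f g : (forall x, D x -> f x = g x) ->
  Cintegral mu D f = Cintegral mu D g.
Proof.
move=> fg; rewrite /Cintegral; congr (_ +i* _).
- by apply: eq_Rintegral => x; rewrite inE => /fg ->.
- by apply: eq_Rintegral => x; rewrite inE => /fg ->.
Qed.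

Lemma ae_eq_Cintegral f g : Cmeasurable D f -> Cmeasurable D g ->
  eqL2 mu D f g -> Cintegral mu D f = Cintegral mu D g.
Proof.
move=> [f1 f2] [g1 g2] fg; rewrite /Cintegral /Rintegral; congr (fine _ +i* fine _).
- apply: ae_eq_integral => //; try exact/measurable_EFinP.
  by apply: filterS fg => x fg Dx; rewrite fg.
- apply: ae_eq_integral => //; try exact/measurable_EFinP.
  by apply: filterS fg => x fg Dx; rewrite fg.
Qed.

(** The constant 2 comes from estimating real and imaginary parts separately; it is harmless against
    exponential rates. *)
Lemma normc_Cintegral_le f : Cintegrable mu D f ->
  ((nc (Cintegral mu D f))%:E <= 2%:E * \int[mu]_(x in D) (nc (f x))%:E)%E.
Proof.
move=> hf; have [f1 f2] := hf; have mf := Cintegrable_measurable hf.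
have mn : measurable_fun D (fun x => (nc (f x))%:E).
  by apply/measurable_EFinP; exact: measurable_normc.
have n0 x : D x -> (0 <= (nc (f x))%:E)%E by rewrite lee_fin normc_ge0.
apply: (@le_trans _ _ (\int[mu]_(x in D) `|(complex.Re (f x))%:E| +
    \int[mu]_(x in D) `|(complex.Im (f x))%:E|)%E).
  apply: (@le_trans _ _ (`|Rintegral mu D (fun x => complex.Re (f x))| +
     `|Rintegral mu D (fun x => complex.Im (f x))|)%:E).
    by rewrite lee_fin /nc (le_trans (normc_le _)).
  rewrite EFinD !EFin_normr_Rintegral//; apply: leeD.
  - by apply: le_abse_integral => //; exact/measurable_EFinP/(proj1 mf).
  - by apply: le_abse_integral => //; exact/measurable_EFinP/(proj2 mf).
have -> : (2%:E = 1 + 1 :> \bar R)%E by rewrite -EFinD.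
rewrite ge0_muleDl// !mul1e; apply: leeD; apply: ge0_le_integral => //.
- by apply: measurableT_comp => //; exact/measurable_EFinP/(proj1 mf).
- by move=> x _; rewrite lee_fin normc_Re.
- by apply: measurableT_comp => //; exact/measurable_EFinP/(proj2 mf).
- by move=> x _; rewrite lee_fin normc_Im.
Qed.

Lemma normc_pairing_le f g : L2 mu D f -> L2 mu D g ->
  nc (Cintegral mu D (fun x => f x * g x)) <= 2 * n2 mu D f * n2 mu D g.
Proof.
move=> hf hg.
have h := normc_Cintegral_le (Cintegrable_mul hf hg).
rewrite -lee_fin (le_trans h)// -mulrA EFinM lee_pmul2l//.
have mr k : L2 mu D k -> measurable_fun setT ((fun x => nc (k x)) \_ D).
  by move=> [mk _]; apply/(measurable_restrictT _ _).1 => //; exact: measurable_normc.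
have := @hoelder _ _ _ mu _ _ 2 2 (mr _ hf) (mr _ hg).
rewrite -!L2norm_restrict (L2norm_fin hf) (L2norm_fin hg) -EFinM.
move=> /(_ ltac:(lra) ltac:(lra) ltac:(lra)); apply: le_trans.
rewrite Lnorm1 integral_mkcond le_eqVlt; apply/orP; left; apply/eqP.
apply: eq_integral => x _; rewrite /= !patchE; case: ifPn => _ /=.
  by rewrite /nc Normc.normcM ger0_norm// mulr_ge0 ?normc_ge0.
by rewrite mulr0 normr0.
Qed.

End ComplexIntegral.

Lemma cReJ (R : rcfType) (z : R[i]) : complex.Re z^* = complex.Re z.
Proof. by case: z. Qed.

Lemma cImJ (R : rcfType) (z : R[i]) : complex.Im z^* = - complex.Im z.
Proof. by case: z. Qed.

(** * From null-controllability to an observability bound *)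

Section Control.
Context {R : realType}.
Notation leb := (@lebesgue_measure R).
Notation RR := (measurableTypeR R).
Context (D : set R) (mD : @measurable _ RR D) (S : R -> (R -> R[i]) -> R -> R[i]).
Hypothesis HS : c0_semigroup D S.
Context (omega : set R) (momega : @measurable _ RR omega).
Let nc := @Normc.normc R.

Let W (T : R) : set (RR * RR) := `[0, T]%classic `*` (omega `&` D).

Let mW T : measurable (W T).
Proof. by apply: measurableX; [exact: measurable_itv|exact: measurableI]. Qed.

Let energy (T : R) (u : R * R -> R[i]) (z : RR * RR) : \bar R :=
  ((fun z => (nc (u z) ^+ 2)%:E) \_ (W T)) z.

(** Tonelli's theorem: [U s] is the squared norm of the slice at time [s]. Measurability of a slice
    in [x] comes from the extension of [u] by 0 to the whole plane. *)
Lemma control_energy (T : R) (u : R * R -> R[i]) :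
  L2 (leb \x leb)%E (`[0, T] `*` (omega `&` D)) u ->
  exists2 U : R -> \bar R,
    [/\ measurable_fun setT (U : RR -> \bar R), forall s, (0 <= U s)%E &
      (\int[leb]_(s in `[0%R, T]) U s < +oo)%E] &
    forall s, 0 <= s <= T -> (U s < +oo)%E ->
      L2 leb D (control_term omega u s) /\ L2sq leb D (control_term omega u s) = U s.
Proof.
move=> hu; have /L2_sqP[mu Eu] := hu.
have mE : measurable_fun setT (energy T u).
  have mf := measurable_normc_sqr mu.
  have mf2 := proj2 (measurable_EFinP _ _) mf.
  exact: (proj1 (measurable_restrictT _ (@mW T)) mf2).
have E0 z : (0 <= energy T u z)%E.
  by rewrite /energy patchE; case: ifPn => // _; rewrite lee_fin sqr_ge0.
exists (fubini_F leb (energy T u)).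
  split.
  - exact: measurable_fun_fubini_tonelli_F.
  - by move=> s; apply: integral_ge0.
  - apply: le_lt_trans Eu; rewrite /L2sq [leRHS]integral_mkcond.
    rewrite [leRHS](_ : _ = (\int[leb \x leb]_z energy T u z)%E)//.
    rewrite (@fubini_tonelli1 _ _ _ _ _ leb leb (energy T u) mE E0).
    have F0 s : (0 <= fubini_F leb (energy T u) s)%E.
      by apply: integral_ge0 => x _; exact: E0.
    rewrite integral_mkcond; apply: ge0_le_integral => //.
    + by move=> s _; exact: erestrict_ge0.
    + apply: (proj1 (measurable_restrictT _ _)); first exact: measurable_itv.
      by apply: measurable_funTS; exact: measurable_fun_fubini_tonelli_F.
    + exact: measurable_fun_fubini_tonelli_F.
    + by move=> s _; rewrite patchE; case: ifPn.
move=> s hs Us.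
have sIcc : `[0, T]%classic s by rewrite /= in_itv.
have Wx x : D x -> (x \in omega) = ((s, x) \in W T).
  move=> Dx; apply/idP/idP; rewrite !inE => h; first by split.
  by case: h => _ [].
pose F1 := (fun z => complex.Re (u z)) \_ (W T).
pose F2 := (fun z => complex.Im (u z)) \_ (W T).
have mF1 : measurable_fun setT F1 by exact: (proj1 (measurable_restrictT _ (@mW T)) (proj1 mu)).
have mF2 : measurable_fun setT F2 by exact: (proj1 (measurable_restrictT _ (@mW T)) (proj2 mu)).
have ctlE x : D x -> control_term omega u s x = F1 (s, x) +i* F2 (s, x).
  move=> Dx; rewrite /control_term indicE /F1 /F2 !patchE -Wx//.
  case: ifPn => h; last by rewrite rmorph0 mul0r.
  by rewrite rmorph1 mul1r; case: (u _).
have mctl : Cmeasurable (D : set RR) (control_term omega u s).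
  split.
  - apply: (eq_measurable_fun (fun x : RR => F1 (s, x))).
      by move=> x; rewrite inE => Dx; rewrite ctlE.
    by apply: measurable_funTS; exact: measurable_fun_pair2.
  - apply: (eq_measurable_fun (fun x : RR => F2 (s, x))).
      by move=> x; rewrite inE => Dx; rewrite ctlE.
    by apply: measurable_funTS; exact: measurable_fun_pair2.
have sqE : L2sq leb D (control_term omega u s) = fubini_F leb (energy T u) s.
  rewrite /L2sq /fubini_F integral_mkcond; apply: eq_integral => x _.
  rewrite /energy !patchE; case: (boolP (x \in D)) => hx.
    have Dx : D x by rewrite inE in hx.
    rewrite /control_term indicE -Wx//; case: ifPn => h.
      by rewrite rmorph1 mul1r.
    by rewrite rmorph0 mul0r /nc Normc.normc0 expr0n.
  case: ifPn => // /set_mem [_ [_ Dx]]; exfalso; move: hx; rewrite notin_setE; exact.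
by split => //; apply/L2_sqP; rewrite sqE.
Qed.

(** Duhamel's formula at time [T] is paired with the conjugate of [q 0]. Duality turns the integrand
    into the pairing of the control at time [s] with [q (T - s)], whose integrand is at most [B]
    times |u| kappa, hence at most [B] times |u|^2 + kappa^2. The weight [kappa] provides
    integrability on an unbounded domain. *)
Lemma control_bound (T Ck : R) (f0 : R -> R[i]) (kappa : R -> R) :
  0 <= T -> L2 leb D f0 -> 0 <= Ck -> measurable_fun (D : set RR) kappa ->
  (\int[leb]_(x in D) (kappa x ^+ 2)%:E <= Ck%:E)%E ->
  (exists u : R * R -> R[i],
    L2 (leb \x leb)%E (`[0, T] `*` (omega `&` D)) u /\
    exists f : R -> R -> R[i],
      mild_solution D S omega T f0 u f /\ eqL2 leb D (f T) (fun=> 0)) ->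
  exists C : R, forall (q : R -> R -> R[i]) (B : R), 0 <= B ->
    (forall t, 0 <= t <= T -> L2 leb D (q t)) ->
    (forall t f, 0 <= t <= T -> L2 leb D f ->
       Cintegral leb D (fun x => S t f x * q 0 x) = Cintegral leb D (fun x => f x * q t x)) ->
    (forall t x, 0 <= t <= T -> D x -> omega x -> nc (q t x) <= B * kappa x) ->
    nc (Cintegral leb D (fun x => f0 x * q T x)) <= C * B.
Proof.
move=> T0 f0L Ck0 mk hk [u [uL [f [hf fT]]]].
have [U [mU U0 iU] hU] := control_energy uL.
have iUfin : (\int[leb]_(s in `[0%R, T]) U s)%E \is a fin_num.
  by rewrite ge0_fin_numE//; apply: integral_ge0 => s _; exact: U0.
(* The factor 4 is a factor 2 for each of the complex integrals in time and in space. *)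
exists (4 * (fine (\int[leb]_(s in `[0%R, T]) U s)%E + T * Ck)) => q B B0 qL dual qle.
have hTT : 0 <= T <= T by rewrite T0 lexx.
have h0T : (0 : R) <= 0 <= T by rewrite lexx T0.
have [fTL [vL _ vint]] := hf T hTT.
(* [inner] conjugates its second argument; this conjugation compensates for it. *)
pose g x := (q 0 x)^*.
have nJ z : nc (z^*) = nc z by case: z => a b; rewrite /nc /= sqrrN.
have gL : L2 leb D g.
  have [[m1 m2] h] := qL 0 h0T; split.
    split; rewrite /g; under eq_fun do rewrite (cReJ, cImJ); first by [].
    exact: measurableT_comp.
  suff -> : L2norm leb D g = L2norm leb D (q 0) by [].
  by rewrite /L2norm; congr (Lnorm _ _ (_ \_ _)); apply/funext => x; rewrite -/nc nJ.
have [Gint Geq] := vint g gL.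
have inE' h : inner leb D h g = Cintegral leb D (fun x => h x * q 0 x).
  by apply: eq_Cintegral => x _; rewrite /g -[X in h x * X = _]/(conjc (conjc (q 0 x))) conjcK.
have lhs : inner leb D (fun x => f T x - S T f0 x) g = - Cintegral leb D (fun x => f0 x * q T x).
  rewrite inE' -(dual T f0 hTT f0L).
  have SL := c0_L2 HS T0 f0L.
  have q0L := qL 0 h0T.
  apply: (@etrans _ _ (Cintegral leb D (fun x => -1 * (S T f0 x * q 0 x)))).
    apply: (ae_eq_Cintegral mD).
    - exact: (CmeasurableM (proj1 vL) (proj1 q0L)).
    - apply: CmeasurableM; first exact: Cmeasurable_cst.
      exact: (CmeasurableM (proj1 SL) (proj1 q0L)).
    - by apply: filterS fT => x h Dx; rewrite h// sub0r mulN1r mulNr.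
  by rewrite (CintegralZ mD)// ?mulN1r//; exact: (Cintegrable_mul mD).
rewrite lhs in Geq.
have -> : nc (Cintegral leb D (fun x => f0 x * q T x)) =
    nc (Cintegral leb `[0, T] (fun s => inner leb D (S (T - s) (control_term omega u s)) g)).
  by rewrite -Geq /nc normcN.
have mI : @measurable _ RR `[0, T]%classic by exact: measurable_itv.
rewrite -lee_fin (le_trans (normc_Cintegral_le mI Gint))//.
pose H s := (2%:E * (B%:E * (U s + Ck%:E)))%E.
apply: (@le_trans _ _ (2%:E * \int[leb]_(s in `[0%R, T]) H s)%E).
  rewrite lee_pmul2l//; apply: ae_ge0_le_integral => //.
  - by move=> s _; rewrite lee_fin normc_ge0.
  - apply/measurable_EFinP; apply: measurable_normc; exact: (Cintegrable_measurable Gint).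
  - by move=> s _; rewrite /H !mule_ge0 ?adde_ge0 ?lee_fin.
  - apply: measurable_funTS; rewrite /H; apply: measurable_funeM; apply: measurable_funeM.
    by apply: emeasurable_funD => //; exact: measurable_cst.
  have UI : leb.-integrable `[0, T]%classic U.
    apply/integrableP; split; first exact: measurable_funTS.
    by apply: le_lt_trans iU; under eq_integral do rewrite gee0_abs//.
  have Ufin := integrable_ae mI UI.
  apply: filterS Ufin => s hU' hsT; have := hU' hsT; rewrite ge0_fin_numE// => Us.
  have hs : 0 <= s <= T by move: hsT; rewrite /= in_itv.
  have hTs : 0 <= T - s <= T by lra.
  have [cL csq] := hU s hs Us.
  rewrite inE' dual//.
  apply: (le_trans (normc_Cintegral_le mD (Cintegrable_mul mD cL (qL _ hTs)))).
  rewrite /H lee_pmul2l// -csq.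
  have mc2 : measurable_fun (D : set RR) (fun x => (nc (control_term omega u s x) ^+ 2)%:E).
    by apply/measurable_EFinP; apply: measurable_normc_sqr; case: cL.
  have mk2 : measurable_fun (D : set RR) (fun x => (kappa x ^+ 2)%:E).
    by apply/measurable_EFinP; exact: measurable_funX.
  have c20 x : (0 <= (nc (control_term omega u s x) ^+ 2)%:E)%E by rewrite lee_fin sqr_ge0.
  have k20 x : (0 <= (kappa x ^+ 2)%:E)%E by rewrite lee_fin sqr_ge0.
  have msum : measurable_fun (D : set RR)
      (fun x => (nc (control_term omega u s x) ^+ 2)%:E + (kappa x ^+ 2)%:E)%E.
    exact: emeasurable_funD.
  apply: (@le_trans _ _ (\int[leb]_(x in D)
      (B%:E * ((nc (control_term omega u s x) ^+ 2)%:E + (kappa x ^+ 2)%:E)))%E).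
    apply: ge0_le_integral => //.
    - by move=> x _; rewrite lee_fin normc_ge0.
    - apply/measurable_EFinP; apply: measurable_normc.
      by apply: CmeasurableM; [case: cL|case: (qL _ hTs)].
    - exact: measurable_funeM.
    move=> x Dx; rewrite -EFinD -EFinM lee_fin Normc.normcM -/nc.
    have [xo|xo] := pselect (omega x).
      have := qle _ x hTs Dx xo.
      have := normc_ge0 (control_term omega u s x); rewrite -/nc.
      move: (nc (control_term _ _ _ _)) (nc (q _ _)) (kappa x) => a1 a2 a3 ha1 ha2.
      apply: (@le_trans _ _ (a1 * (B * a3))); first by rewrite ler_wpM2l.
      by rewrite mulrCA ler_wpM2l// !expr2; nra.
    rewrite {1}/control_term indicE memNset// rmorph0 mul0r /nc Normc.normc0 mul0r.
    by rewrite mulr_ge0// addr_ge0// sqr_ge0.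
  rewrite ge0_integralZl_EFin//; last by move=> x _; rewrite adde_ge0.
  rewrite lee_wpmul2l ?lee_fin// ge0_integralD//.
  by apply: leeD.
have mU' : measurable_fun (`[0, T]%classic : set RR) U by exact: measurable_funTS.
rewrite /H ge0_integralZl_EFin//; last 2 first.
- by move=> s _; rewrite mule_ge0 ?lee_fin// adde_ge0// lee_fin.
- by apply: measurable_funeM; apply: emeasurable_funD => //; exact: measurable_cst.
rewrite ge0_integralZl_EFin//; last 2 first.
- by move=> s _; rewrite adde_ge0// lee_fin.
- by apply: emeasurable_funD => //; exact: measurable_cst.
rewrite ge0_integralD//.
have -> : (\int[leb]_(x in `[0%R, T]) Ck%:E = (Ck * T)%:E)%E.
  rewrite integral_cst//= lebesgue_measure_itv/= lte_fin.
  case: ltP => [T0'|T0']; first by rewrite sube0 -EFinM.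
  by rewrite mule0 (_ : T = 0) ?mulr0//; apply/le_anti; rewrite T0'.
rewrite -(fineK iUfin) -EFinD -!EFinM lee_fin le_eqVlt; apply/orP; left; apply/eqP.
by ring.
Qed.

End Control.

Lemma cIm_sum (R : rcfType) (I : Type) (s : seq I) (F : I -> R[i]) :
  complex.Im (\sum_(i <- s) F i) = \sum_(i <- s) complex.Im (F i).
Proof. by elim: s => [|i s IH]; rewrite ?big_nil// !big_cons cImD IH. Qed.

(** * Unimodular exponentials and Taylor estimates for exponential decay *)

Section Cis.
Context {R : realType}.
Implicit Types x y t h l : R.

Lemma normc_cis x : Normc.normc (cis x) = 1.
Proof. by rewrite /Normc.normc /cis cos2Dsin2 sqrtr1. Qed.

Lemma cisD x y : cis (x + y) = cis x * cis y.
Proof. by rewrite /cis; apply: complex_ext => /=; rewrite ?cosD ?sinD//; ring. Qed.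

Lemma cis0 : cis (0 : R) = 1.
Proof. by rewrite /cis cos0 sin0. Qed.

Lemma cis_natmul n x : cis (n%:R * x) = cis x ^+ n.
Proof.
elim: n => [|n IH]; first by rewrite mul0r cis0 expr0.
by rewrite -natr1 mulrDl mul1r cisD IH exprSr.
Qed.

Lemma Cmeasurable_cis (D : set (measurableTypeR R)) (c : R) (a : R) :
  Cmeasurable D (fun x : measurableTypeR R => cis (c * (x - a))).
Proof.
have m : measurable_fun D (fun x : measurableTypeR R => c * (x - a)).
  by apply: measurable_funM => //; exact: measurable_funB.
split => /=.
- by apply: measurableT_comp m; apply: continuous_measurable_fun; exact: continuous_cos.
- by apply: measurableT_comp m; apply: continuous_measurable_fun; exact: continuous_sin.
Qed.

Lemma Cmeasurable_cisM (D : set (measurableTypeR R)) (y : R) :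
  Cmeasurable D (fun x : measurableTypeR R => cis (x * y)).
Proof.
have h := Cmeasurable_cis D y 0.
rewrite (_ : (fun t => _) = (fun x : measurableTypeR R => cis (y * (x - 0))))//.
by apply/funext => t; rewrite subr0 mulrC.
Qed.

Lemma Cmeasurable_cisNM (D : set (measurableTypeR R)) (y : R) :
  Cmeasurable D (fun x : measurableTypeR R => cis (- (x * y))).
Proof. by under eq_fun do rewrite -mulrN; exact: Cmeasurable_cisM. Qed.

Lemma expR_decay1 t h l : 0 <= l -> 0 <= t -> 0 <= h ->
  `|expR (- t * l) - expR (- (t + h) * l)| <= h * l.
Proof.
move=> l0 t0 h0.
have -> : expR (- (t + h) * l) = expR (- t * l) * expR (- (h * l)).
  by rewrite -expRD; congr expR; ring.
have e1 : expR (- t * l) <= 1 by rewrite -expR0 ler_expR; nra.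
have e2 : 0 < expR (- t * l) := expR_gt0 _.
have e3 := expR_ge1Dx (- (h * l)).
have hl : 0 <= h * l by rewrite mulr_ge0.
have e4 : expR (- (h * l)) <= 1 by rewrite -expR0 ler_expR; lra.
move: (expR (- t * l)) (expR (- (h * l))) e1 e2 e3 e4 => a c e1 e2 e3 e4.
rewrite ger0_norm; nra.
Qed.

(** With s = h l the quantity is exp(-t l) (1 - (1 + s) exp(-s)), and the last factor lies between 0
    and s^2. This is the quadratic remainder required by the duality principle. *)
Lemma expR_decay2 t h l : 0 <= l -> 0 <= t -> 0 <= h ->
  `|expR (- t * l) - expR (- (t + h) * l) - h * l * expR (- (t + h) * l)|
  <= l ^+ 2 * h ^+ 2.
Proof.
move=> l0 t0 h0.
have -> : expR (- (t + h) * l) = expR (- t * l) * expR (- (h * l)).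
  by rewrite -expRD; congr expR; ring.
have e1 : expR (- t * l) <= 1 by rewrite -expR0 ler_expR; nra.
have e2 : 0 < expR (- t * l) := expR_gt0 _.
have e3 := expR_ge1Dx (- (h * l)).
have e5 := expR_ge1Dx (h * l).
have e6 : expR (h * l) * expR (- (h * l)) = 1 by rewrite -expRD subrr expR0.
have hl : 0 <= h * l by rewrite mulr_ge0.
have e7 := expR_gt0 (- (h * l)).
have e8 : l ^+ 2 * h ^+ 2 = (h * l) ^+ 2 by ring.
rewrite e8.
move: (h * l) (expR (h * l)) (expR (- t * l)) (expR (- (h * l))) e1 e2 e3 e5 e6 hl e7.
move=> s d a c e1 e2 e3 e5 e6 hl e7.
have k1 : (1 + s) * c <= 1 by nra.
have k2 : 1 - (1 + s) * c <= s ^+ 2 by rewrite expr2; nra.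
have -> : a - a * c - s * (a * c) = a * (1 - (1 + s) * c) by ring.
by rewrite ger0_norm; nra.
Qed.

End Cis.

(** * Fourier modes of the indicator of an interval *)

Section Indicator.
Context {R : realType}.
Notation leb := (@lebesgue_measure R).
Notation RR := (measurableTypeR R).

Lemma Rintegral_FTC (F f : R -> R) (a b : R) : a < b ->
  (forall x, a <= x <= b -> is_derive x 1 F (f x)) ->
  (forall x, a <= x <= b -> {for x, continuous f}) ->
  Rintegral leb `[a, b]%classic f = F b - F a.
Proof.
move=> ab dF cf.
have cF x : a <= x <= b -> {for x, continuous F}.
  by move=> /dF [dF' _]; exact/differentiable_continuous/derivable1_diffP.
rewrite /Rintegral (@continuous_FTC2 R f F a b)//.
- apply: continuous_in_subspaceT => x; rewrite inE /= in_itv /=; exact: cf.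
- split.
  + by move=> x; rewrite in_itv /= => /andP[/ltW ax /ltW xb]; case: (dF x) => //; rewrite ax.
  + by apply: cvg_at_right_filter; apply: cF; rewrite lexx ltW.
  + by apply: cvg_at_left_filter; apply: cF; rewrite lexx ltW.
- move=> x; rewrite in_itv /= => /andP[/ltW ax /ltW xb].
  have [//|_ <-] := dF x _; first by rewrite ax.
  by rewrite derive1E.
Qed.

Lemma lebesgue_itvcc_lty (a b : R) : (leb (`[a, b]%classic : set RR) < +oo)%E.
Proof. by rewrite lebesgue_measure_itv /=; case: ifP => _; rewrite ?ltry// -EFinD ltry. Qed.

Lemma Cmeasurable_indic (D A : set RR) : measurable A ->
  Cmeasurable D (fun x => (\1_A x)%:C : R[i]).
Proof. by move=> mA; split => /=; [exact: measurable_indic|exact: measurable_cst]. Qed.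

Lemma L2_indic (D : set RR) (a b : R) : measurable D ->
  L2 leb D (fun x => (\1_(`[a, b]%classic) x)%:C).
Proof.
move=> mD; have mI : @measurable _ RR `[a, b]%classic by exact: measurable_itv.
apply/L2_sqP; split; first exact: Cmeasurable_indic.
apply: (@le_lt_trans _ _ (leb (`[a, b]%classic : set RR))).
  rewrite -[leRHS]mul1e -(integral_cst leb mI) [leRHS]integral_mkcond /L2sq integral_mkcond.
  apply: ge0_le_integral => //.
  - by move=> x _; apply: erestrict_ge0 => y _; rewrite lee_fin sqr_ge0.
  - apply: (proj1 (measurable_restrictT _ _)) => //; apply/measurable_EFinP.
    by apply: measurable_normc_sqr; exact: Cmeasurable_indic.
  - by apply: (proj1 (measurable_restrictT _ _)) => //; exact: measurable_cst.
  move=> x _; rewrite !patchE indicE; case: ifPn => _; case: ifPn => _ //.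
  - by rewrite normc_real ger0_norm// expr1n.
  - by rewrite normc_real normr0 expr0n.
exact: lebesgue_itvcc_lty.
Qed.

(** The interval starts at the centre [a] of the mode, which gives the imaginary part the same sign
    for every [k > 0]; the real part would change sign with [k]. *)
Lemma indic_mode_Im (D : set RR) (a b k : R) : measurable D -> 0 < b -> 0 < k ->
  (forall x, a <= x <= a + b -> D x) ->
  complex.Im (Cintegral leb D (fun x => (\1_(`[a, a + b]%classic) x)%:C * cis (- k * (x - a))))
  = - (1 - cos (k * b)) / k.
Proof.
move=> mD b0 k0 ID; rewrite /Cintegral /=.
have -> : Rintegral leb D (fun x : RR =>
    complex.Im ((\1_(`[a, a + b]%classic) x)%:C * cis (- k * (x - a)))) =
    Rintegral leb `[a, a + b]%classic (fun x => sin (- k * (x - a))).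
  rewrite [LHS]Rintegral_mkcond [RHS]Rintegral_mkcond; congr Rintegral; apply/funext => x.
  rewrite !patchE indicE cImM /=; case: (boolP (x \in `[a, a + b]%classic)) => xI.
    rewrite mul1r mul0r addr0 mem_set//; apply: ID.
    by move: xI; rewrite inE /= in_itv.
  by rewrite !mul0r addr0; case: ifP.
have dF (x : R) : is_derive x 1 (fun x => cos (- k * (x - a)) / k) (sin (- k * (x - a))).
  have h : is_derive x 1 (fun x => - k * (x - a)) (- k).
    rewrite (_ : (fun x => _) = (- k) \*: (id - cst a))//.
    by apply: is_derive_eq; rewrite subr0 /GRing.scale /= mulr1.
  have h2 : is_derive x 1 (cos \o (fun x => - k * (x - a))) (- sin (- k * (x - a)) * - k).
    exact: is_derive1_comp.
  rewrite (_ : (fun x => _) = k^-1 \*: (cos \o (fun x => - k * (x - a)))); last first.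
    by apply/funext => y /=; rewrite mulrC.
  by apply: is_derive_eq; rewrite /GRing.scale /=; field; exact: lt0r_neq0.
have cf (x : R) : {for x, continuous (fun x => sin (- k * (x - a)))}.
  apply: continuous_comp; last exact: continuous_sin.
  by apply: cvgM; [exact: cvg_cst|apply: cvgB; [exact: cvg_id|exact: cvg_cst]].
rewrite (@Rintegral_FTC _ _ a (a + b) _ (fun x _ => dF x) (fun x _ => cf x)) ?ltrDl//.
have -> : - k * (a + b - a) = - (k * b) by ring.
rewrite subrr mulr0 cos0 cosN; field; exact: lt0r_neq0.
Qed.

End Indicator.

(** * The torus: action on Fourier modes and test functions *)

Section Torus.
Context {R : realType}.
Notation leb := (@lebesgue_measure R).
Notation RR := (measurableTypeR R).
Context (alpha : R) (S : R -> (R -> R[i]) -> R -> R[i]).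
Let D : set R := `[0, 2 * pi[%classic.
Hypothesis HS : semigroup_generated_by D (minus_frac_laplacian torus alpha) S.
Let nc := @Normc.normc R.

Let mD : @measurable _ RR D. Proof. exact: measurable_itv. Qed.

Let D_le : (leb D = (2 * pi)%:E)%E.
Proof.
by rewrite /D lebesgue_measure_itv/= lte_fin mulr_gt0 ?pi_gt0// sube0.
Qed.

Lemma torus_bounded_L2 (f : R -> R[i]) (C : R) : Cmeasurable (D : set RR) f ->
  (forall x, D x -> nc (f x) <= C) -> L2 leb D f.
Proof.
move=> mf fC; apply/L2_sqP; split => //.
apply: (@le_lt_trans _ _ (\int[leb]_(x in D) (C ^+ 2)%:E)%E).
  apply: ge0_le_integral => //.
  - by move=> x _; rewrite lee_fin sqr_ge0.
  - by apply/measurable_EFinP; exact: measurable_normc_sqr.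
  - move=> x Dx; rewrite lee_fin ler_pXn2r ?nnegrE ?normc_ge0//; first exact: fC.
    by rewrite (le_trans _ (fC x Dx))// normc_ge0.
rewrite integral_cst// [X in (_ * X)%E](_ : _ = (2 * pi)%:E); last exact: D_le.
by rewrite -EFinM ltry.
Qed.

Let mode (m : nat) (x : R) : R[i] := cis (- m%:R * (x - 0)).

Let modeL m : L2 leb D (mode m).
Proof.
apply: (torus_bounded_L2 (C := 1)); first exact: Cmeasurable_cis.
by move=> x _; rewrite /nc normc_cis.
Qed.

Let generator_mode f g m : generator D S f g ->
  Cintegral leb D (fun x => g x * mode m x) =
  - (m%:R `^ alpha)%:C * Cintegral leb D (fun x => f x * mode m x).
Proof.
move=> /(proj2 HS f g) [fL gL hc]; have := hc m.
have c0 : ((2 * pi)^-1)%:C != 0 :> R[i].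
  by rewrite -(rmorph0 (real_complex R)) (inj_eq (@complexI R)) invr_eq0 gt_eqF// mulr_gt0// pi_gt0.
rewrite /fourier_coef mulrCA => /(mulfI c0).
have e f' : Cintegral leb `[0, 2 * pi[ (fun x => f' x * cis (- (m%:~R * x))) =
    Cintegral leb D (fun x => f' x * mode m x).
  by apply: eq_Cintegral => x _; rewrite /mode subr0 mulNr.
rewrite !e.
have -> : Cintegral leb D (fun x => - g x * mode m x) =
    - Cintegral leb D (fun x => g x * mode m x).
  rewrite -mulN1r -(CintegralZ mD).
    by apply: eq_Cintegral => x _; rewrite mulN1r mulNr.
  apply: (Cintegrable_mul mD) => //.
  have [h _] := n2Z mD (-1) gL; move: h; congr L2.
  by apply/funext => x; rewrite mulrN mulN1r opprK.
rewrite normr_nat => h; rewrite mulNr -h opprK//.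
Qed.

(** The functional [expR (- s * l)] times [J] solves the adjoint equation, since composing [J] with
    the generator multiplies it by [- l]; its values at times 0 and [t] are then compared. *)
Lemma torus_mode_duality m (t : R) f : 0 <= t -> L2 leb D f ->
  Cintegral leb D (fun x => S t f x * mode m x) =
  (expR (- t * m%:R `^ alpha))%:C * Cintegral leb D (fun x => f x * mode m x).
Proof.
move=> t0 fL; pose J f := Cintegral leb D (fun x => f x * mode m x).
pose l := m%:R `^ alpha; have l0 : 0 <= l by exact: powR_ge0.
have Jint f' : L2 leb D f' -> Cintegrable leb D (fun x => f' x * mode m x).
  by move=> f'L; exact: (Cintegrable_mul mD).
suff : (expR (- 0 * l))%:C * J (S t f) = (expR (- t * l))%:C * J f.
  by rewrite oppr0 mul0r expR0 rmorph1 mul1r.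
apply: (@c0_duality R D mD S (proj1 HS) (fun s f => (expR (- s * l))%:C * J f) t
  (2 * n2 leb D (mode m)) t0) => //.
- move=> s f1 f2 _ h1 h2; rewrite -mulrBr; congr (_ * _).
  rewrite /J -(CintegralB mD); [|exact: Jint|exact: Jint].
  by apply: eq_Cintegral => x _; rewrite mulrBl.
- move=> s a f1 _ h1; rewrite mulrCA; congr (_ * _).
  rewrite /J -(CintegralZ mD); last exact: Jint.
  by apply: eq_Cintegral => x _; rewrite mulrA.
- move=> s f1 /andP[s0 _] h1; rewrite Normc.normcM normc_real ger0_norm ?expR_ge0//.
  have h := normc_pairing_le mD h1 (modeL m).
  rewrite (le_trans _ (eq_ind _ (fun z => nc (J f1) <= z) h _ _))//.
    by rewrite ler_piMl ?normc_ge0// -expR0 ler_expR; nra.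
  by ring.
move=> f1 g1 hfg; exists (l ^+ 2 * nc (J f1) + l * nc (J g1)) => s h s0 h0 _.
have Jg : J g1 = - l%:C * J f1 by exact: generator_mode.
split.
  have -> : (expR (- s * l))%:C * J f1 - (expR (- (s + h) * l))%:C * J f1 +
      h%:C * ((expR (- (s + h) * l))%:C * J g1) =
      (expR (- s * l) - expR (- (s + h) * l) - h * l * expR (- (s + h) * l))%:C * J f1.
    by rewrite Jg !rmorphB !rmorphM /=; ring.
  rewrite Normc.normcM normc_real.
  apply: (@le_trans _ _ (l ^+ 2 * h ^+ 2 * nc (J f1))).
    by rewrite ler_wpM2r ?normc_ge0// expR_decay2.
  rewrite mulrDl -[leLHS]addr0 lerD//; first by rewrite mulrAC.
  by rewrite !mulr_ge0// ?sqr_ge0 ?normc_ge0.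
rewrite -mulrBl -rmorphB Normc.normcM normc_real.
apply: (@le_trans _ _ (h * l * nc (J g1))).
  by rewrite ler_wpM2r ?normc_ge0// expR_decay1.
rewrite mulrDl -[leLHS]add0r lerD//; last by rewrite -mulrA mulrC.
by rewrite !mulr_ge0// ?sqr_ge0 ?normc_ge0.
Qed.

Lemma torus_mode_duality_shift m (a t : R) f : 0 <= t -> L2 leb D f ->
  Cintegral leb D (fun x => S t f x * cis (- m%:R * (x - a))) =
  (expR (- t * m%:R `^ alpha))%:C * Cintegral leb D (fun x => f x * cis (- m%:R * (x - a))).
Proof.
move=> t0 fL.
have e f' : L2 leb D f' -> Cintegral leb D (fun x => f' x * cis (- m%:R * (x - a))) =
    cis (m%:R * a) * Cintegral leb D (fun x => f' x * mode m x).
  move=> f'L; rewrite -(CintegralZ mD); last exact: (Cintegrable_mul mD).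
  apply: eq_Cintegral => x _; rewrite mulrCA -cisD /mode; congr (_ * cis _); ring.
by rewrite (e _ (c0_L2 (proj1 HS) t0 fL)) (e _ fL) torus_mode_duality// mulrCA.
Qed.

(* A truncation of [\sum_m 'C(m + n, n) z^m = (1 - z)^-(n+1)]: the cut-off
   ['C(M - m, n+1)] is a finite completely monotone sequence. *)
Definition torus_coef n M (t : R) m : R :=
  'C(M - m, n.+1)%:R * expR (- t * m.+1%:R `^ alpha).

(** Frequencies start at 1, as does the sampling of x^alpha in [torus_coef]. *)
Definition torus_test (a : R) n M (t : R) (x : R) : R[i] :=
  \sum_(0 <= m < M) ('C(m + n, n)%:R * torus_coef n M t m)%:C * cis (- m.+1%:R * (x - a)).

(** With z = e^(-i(x-a)) this is [z] times a negative binomial sum whose coefficients are a product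
    of two completely monotone sequences, the cut-off and the sampled exponential. Uniformity in [t]
    holds because the exponential is at most 1. *)
Lemma torus_test_le (a : R) n M (t : R) x rho : 0 <= alpha <= 1 -> (0 < M)%N -> 0 <= t ->
  0 < rho -> rho <= nc (1 - cis (- (x - a))) ->
  nc (torus_test a n M t x) <= (2 / rho) ^+ n.+1 * 'C(M, n.+1)%:R.
Proof.
move=> a01 M0 t0 rho0 hrho; set z := cis (- (x - a)).
have -> : torus_test a n M t x = z * negbin_sum M n (torus_coef n M t) z.
  rewrite /negbin_sum mulr_sumr; apply: eq_bigr => m _.
  by rewrite [RHS]mulrCA -exprS -cis_natmul mulNr mulrN.
rewrite /nc Normc.normcM normc_cis mul1r.
have c0 : torus_coef n M t 0 <= 'C(M, n.+1)%:R.
  rewrite /torus_coef subn0 ler_piMr// -[leRHS]expR0 ler_expR.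
  by rewrite mulNr oppr_le0 mulr_ge0// powR_ge0.
have cge0 : 0 <= torus_coef n M t 0 by rewrite mulr_ge0// expR_ge0.
apply: (le_trans (negbin_sum_le M0 _ _ _ _)).
- by move=> m Mm; rewrite /torus_coef (_ : (M - m = 0)%N) ?mul0r//; apply/eqP; rewrite subn_eq0.
- apply: (cm_seqM (cm_seq_bin _ _)).
  apply: (@cm_seq_of_cm _ [set y : R | 0 < y] n.+1 (fun y => expR (- t * y `^ alpha))) => //.
  exact: cm_expR_powR.
- by rewrite normc_cis.
- exact: lt_le_trans hrho.
have h0 : 0 < Normc.normc (1 - z) by exact: lt_le_trans hrho.
apply: ler_pM => //; first by rewrite exprn_ge0// divr_ge0// ltW.
rewrite lerXn2r ?nnegrE ?divr_ge0 ?(ltW rho0) ?(ltW h0)//.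
by rewrite ler_pM2l// lef_pV2.
Qed.

Lemma torus_test_Cmeasurable (a : R) n M (t : R) :
  Cmeasurable (D : set RR) (torus_test a n M t).
Proof.
pose c m := ('C(m + n, n)%:R * torus_coef n M t m)%:C.
suff h k : Cmeasurable (D : set RR) (fun x => \sum_(0 <= m < k) c m * cis (- m.+1%:R * (x - a))).
  exact: (h M).
elim: k => [|k IH].
  by under eq_fun do rewrite big_geq//; exact: Cmeasurable_cst.
under eq_fun do rewrite big_nat_recr//=.
apply: CmeasurableD => //.
by apply: CmeasurableM; [exact: Cmeasurable_cst|exact: Cmeasurable_cis].
Qed.

Lemma torus_test_L2 (a : R) n M (t : R) : L2 leb D (torus_test a n M t).
Proof.
apply: (torus_bounded_L2 (C := \sum_(0 <= m < M) `|'C(m + n, n)%:R * torus_coef n M t m|)).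
  exact: torus_test_Cmeasurable.
move=> x _; rewrite /torus_test; elim/big_rec2 : _ => [|m c s _ h].
  by rewrite /nc Normc.normc0.
rewrite (le_trans (le_normcD _ _))// lerD//.
by rewrite Normc.normcM normc_cis mulr1 normc_real.
Qed.

Lemma Cintegral_torus_test (a : R) n M (t : R) f : L2 leb D f ->
  Cintegral leb D (fun x => f x * torus_test a n M t x) =
  \sum_(0 <= m < M) ('C(m + n, n)%:R * torus_coef n M t m)%:C *
    Cintegral leb D (fun x => f x * cis (- m.+1%:R * (x - a))).
Proof.
move=> fL.
have modeL' m : L2 leb D (fun x => cis (- m%:R * (x - a))).
  apply: (torus_bounded_L2 (C := 1)); first exact: Cmeasurable_cis.
  by move=> x _; rewrite /nc normc_cis.
pose c m := ('C(m + n, n)%:R * torus_coef n M t m)%:C.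
rewrite /torus_test.
(* The upper limit varies alone, while the coefficients still refer to the fixed [M]. *)
suff h : forall M', Cintegrable leb D (fun x => f x * \sum_(0 <= m < M') c m * cis (- m.+1%:R * (x - a)))
   /\ Cintegral leb D (fun x => f x * \sum_(0 <= m < M') c m * cis (- m.+1%:R * (x - a))) =
  \sum_(0 <= m < M') c m * Cintegral leb D (fun x => f x * cis (- m.+1%:R * (x - a))).
  by have [_ ->] := h M.
elim=> [|M' [IH1 IH2]].
  rewrite big_geq//; under eq_fun do rewrite big_geq// mulr0.
  split; first by split => /=; exact: integrable0.
  by rewrite /Cintegral /= /Rintegral integral0.
have i1 : Cintegrable leb D (fun x => f x * cis (- M'.+1%:R * (x - a))).
  exact: (Cintegrable_mul mD).
have i2 := CintegrableZ mD (c M') i1.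
rewrite big_nat_recr//=.
have -> : (fun x => f x * \sum_(0 <= m < M'.+1) c m * cis (- m.+1%:R * (x - a))) =
  (fun x => f x * \sum_(0 <= m < M') c m * cis (- m.+1%:R * (x - a)) +
            c M' * (f x * cis (- M'.+1%:R * (x - a)))).
  by apply/funext => x; rewrite big_nat_recr//= mulrDr [f x * (c M' * _)]mulrCA.
split; first exact: (CintegrableD mD).
by rewrite (CintegralD mD)// IH2 (CintegralZ mD).
Qed.

Lemma torus_test_duality (a : R) n M (t : R) f : 0 <= t -> L2 leb D f ->
  Cintegral leb D (fun x => S t f x * torus_test a n M 0 x) =
  Cintegral leb D (fun x => f x * torus_test a n M t x).
Proof.
move=> t0 fL; rewrite !Cintegral_torus_test//; last exact: (c0_L2 (proj1 HS)).
apply: eq_bigr => m _; rewrite torus_mode_duality_shift// mulrA -rmorphM.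
by rewrite /torus_coef oppr0 mul0r expR0 mulr1 mulrA.
Qed.

Lemma torus_test_pairing_ge (a b : R) n M (t : R) m : (m < M)%N ->
  0 <= a -> 0 < b -> a + b < 2 * pi ->
  'C(m + n, n)%:R * torus_coef n M t m * ((1 - cos (m.+1%:R * b)) / m.+1%:R) <=
  nc (Cintegral leb D (fun x => (\1_(`[a, a + b]%classic) x)%:C * torus_test a n M t x)).
Proof.
move=> mM a0 b0 ab.
have fL : L2 leb D (fun x => (\1_(`[a, a + b]%classic) x)%:C) by exact: L2_indic.
apply: le_trans (normc_Im _); rewrite (Cintegral_torus_test _ _ _ _ fL).
have ID x : a <= x <= a + b -> D x by rewrite /D /= in_itv /=; lra.
pose F i := 'C(i + n, n)%:R * torus_coef n M t i * ((1 - cos (i.+1%:R * b)) / i.+1%:R).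
have F0 i : 0 <= F i.
  by rewrite /F /torus_coef !mulr_ge0// ?expR_ge0// ?invr_ge0// subr_ge0 cos_le1.
have -> : complex.Im (\sum_(0 <= i < M) ('C(i + n, n)%:R * torus_coef n M t i)%:C *
    Cintegral leb D (fun x => (\1_(`[a, a + b]%classic) x)%:C * cis (- i.+1%:R * (x - a)))) =
    - \sum_(0 <= i < M) F i.
  rewrite cIm_sum -sumrN; apply: eq_bigr => i _.
  by rewrite cImM indic_mode_Im//= mul0r addr0 /F mulNr mulrN.
rewrite normrN ger0_norm ?sumr_ge0// -/(F m).
rewrite (@big_cat_nat _ _ _ m)//= ?(ltnW mM)// (@big_ltn _ _ _ m)//.
rewrite addrCA lerDl addr_ge0// sumr_ge0//.
Qed.

End Torus.

(** * Fubini's theorem and regularity of Fourier integrals *)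

Section FourierTools.
Context {R : realType}.
Notation leb := (@lebesgue_measure R).
Notation RR := (measurableTypeR R).
Let nc := @Normc.normc R.

Lemma integral_oneDsqrV_sq :
  (\int[leb]_x (((1 + x ^+ 2)^-1 : R) ^+ 2)%:E <= pi%:E)%E.
Proof.
have pos (x : R) : 0 < 1 + x ^+ 2 by rewrite ltr_pwDl// sqr_ge0.
have cf : continuous (fun x : R => (1 + x ^+ 2)^-1).
  move=> x; apply: cvgV; first by rewrite gt_eqF.
  by apply: cvgD; [exact: cvg_cst|apply: exprn_continuous].
apply: (@le_trans _ _ (\int[leb]_x ((1 + x ^+ 2)^-1 : R)%:E)%E).
  apply: ge0_le_integral => //.
  - by move=> x _; rewrite lee_fin sqr_ge0.
  - apply/measurable_EFinP; apply: measurable_funX; exact: continuous_measurable_fun.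
  - by apply/measurable_EFinP; exact: continuous_measurable_fun.
  - move=> x _; rewrite lee_fin expr2 ler_piMr ?invr_ge0 ?(ltW (pos x))//.
    by rewrite invf_le1// lerDl sqr_ge0.
rewrite ge0_symfun_integralT//; last 2 first.
- by move=> x; rewrite invr_ge0 ltW.
- by move=> x /=; rewrite sqrrN.
rewrite -set_itvcy (@ge0_continuous_FTC2y _ _ (@atan R) 0 (pi / 2)).
- by rewrite atan0 sube0 -EFinM lee_fin; lra.
- by move=> x _; rewrite invr_ge0 ltW.
- exact: continuous_subspaceT.
- exact: cvgy_atan.
- by move=> x _; exact: derivable_atan.
- by apply: cvg_at_right_filter; exact: continuous_atan.
- by move=> x _; rewrite derive1_atan.
Qed.

(** Extended by 0, [G] is integrable on the plane, being dominated by [h] in [x] while [B] has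
    finite measure. *)
Lemma Rfubini (A B : set RR) (G : R * R -> R) (h : R -> R) : measurable A -> measurable B ->
  measurable_fun ((A `*` B) : set (RR * RR)) G -> leb.-integrable A (EFin \o h) ->
  (leb B < +oo)%E -> (forall x y, A x -> B y -> `|G (x, y)| <= h x) ->
  Rintegral leb A (fun x => Rintegral leb B (fun y => G (x, y))) =
  Rintegral leb B (fun y => Rintegral leb A (fun x => G (x, y))).
Proof.
move=> mA mB mG ih lB hG.
have mAB : measurable ((A `*` B) : set (RR * RR)) by exact: measurableX.
pose G' : RR * RR -> \bar R := (EFin \o G) \_ (A `*` B).
have mG' : measurable_fun setT G'.
  by apply: (proj1 (measurable_restrictT _ mAB)); exact/measurable_EFinP.
have mabs : measurable_fun setT (abse \o G') by exact: measurableT_comp.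
have hfin : (\int[leb]_(x in A) (h x)%:E \is a fin_num)%E by exact: integrable_fin_num.
have bfin : (leb : {measure set RR -> \bar R}) B = (fine (leb B))%:E.
  by rewrite fineK// ge0_fin_numE.
have mGx x : A x -> measurable_fun B (fun y : RR => G (x, y)).
  move=> Ax; have h1 : measurable_fun setT (fun y : RR => (G \_ (A `*` B)) (x, y)).
    by apply: measurable_fun_pair2; exact: (proj1 (measurable_restrictT _ mAB)).
  apply: (eq_measurable_fun (fun y : RR => (G \_ (A `*` B)) (x, y))).
    by move=> y; rewrite inE => By; rewrite patchE mem_set.
  exact: measurable_funTS.
have mGy y : B y -> measurable_fun A (fun x : RR => G (x, y)).
  move=> By; have h1 : measurable_fun setT (fun x : RR => (G \_ (A `*` B)) (x, y)).
    by apply: measurable_fun_pair1; exact: (proj1 (measurable_restrictT _ mAB)).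
  apply: (eq_measurable_fun (fun x : RR => (G \_ (A `*` B)) (x, y))).
    by move=> x; rewrite inE => Ax; rewrite patchE mem_set.
  exact: measurable_funTS.
have ix x : A x -> leb.-integrable B (fun y : RR => (G (x, y))%:E).
  move=> Ax; apply: (@le_integrable _ _ _ leb B mB _ (fun=> (h x)%:E)).
  - by apply/measurable_EFinP; exact: mGx.
  - by move=> y By; rewrite lee_fin (le_trans (hG x y Ax By))// ler_norm.
  - apply/integrableP; split; first exact: measurable_cst.
    by rewrite (integral_cst leb mB `|(h x)%:E|%E) bfin -EFinM ltry.
have iy y : B y -> leb.-integrable A (fun x : RR => (G (x, y))%:E).
  move=> By; apply: (le_integrable mA _ _ ih).
  - by apply/measurable_EFinP; exact: mGy.
  - by move=> x Ax; rewrite lee_fin (le_trans (hG x y Ax By))// ler_norm.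
have G'x x : A x -> (\int[leb]_y G' (x, y) = \int[leb]_(y in B) (G (x, y))%:E)%E.
  move=> Ax; rewrite [RHS]integral_mkcond; apply: eq_integral => y _.
  rewrite /G' !patchE; case: (boolP (y \in B)) => yB.
    by rewrite mem_set//; split => //; rewrite inE in yB.
  by case: ifPn => // /set_mem [_ /mem_set]; rewrite (negbTE yB).
have G'y y : B y -> (\int[leb]_x G' (x, y) = \int[leb]_(x in A) (G (x, y))%:E)%E.
  move=> By; rewrite [RHS]integral_mkcond; apply: eq_integral => x _.
  rewrite /G' !patchE; case: (boolP (x \in A)) => xA.
    by rewrite mem_set//; split => //; rewrite inE in xA.
  by case: ifPn => // /set_mem [/mem_set]; rewrite (negbTE xA).
have iG' : (leb \x leb)%E.-integrable setT G'.
  apply/(integrable12ltyP leb leb mG').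
  have h0 x : A x -> (0 <= (`|h x|)%:E)%E by rewrite lee_fin.
  apply: (@le_lt_trans _ _ (\int[leb]_(x in A) (`|h x|%:E * (leb : {measure set RR -> \bar R}) B))%E); last first.
    rewrite bfin ge0_integralZr//; last 2 first.
    - apply/measurable_EFinP; apply: measurableT_comp => //.
      by apply/measurable_EFinP; exact: measurable_int ih.
    - by rewrite lee_fin fine_ge0.
    rewrite lte_mul_pinfty ?ltry//.
      by apply: integral_ge0.
    rewrite ge0_fin_numE ?integral_ge0//.
    by case/integrableP: ih.
  rewrite [leRHS]integral_mkcond; apply: ge0_le_integral => //.
  - by move=> x _; exact: integral_ge0.
  - exact: (measurable_fun_fubini_tonelli_F (abse \o G') mabs (fun=> abse_ge0 _)).
  - apply: (proj1 (measurable_restrictT _ mA)); apply: emeasurable_funM; last exact: measurable_cst.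
    apply/measurable_EFinP; apply: measurableT_comp => //.
    by apply/measurable_EFinP; exact: measurable_int ih.
  move=> x _; rewrite patchE; case: ifPn => xA.
    have Ax : A x by rewrite inE in xA.
    have -> : (`|h x|%:E * (leb : {measure set RR -> \bar R}) B = \int[leb]_(y in B) `|h x|%:E)%E by rewrite integral_cst.
    rewrite [leRHS]integral_mkcond; apply: ge0_le_integral => //.
    - by apply: measurableT_comp => //; exact: measurable_fun_pair2.
    - by apply: (proj1 (measurable_restrictT _ mB)); exact: measurable_cst.
    move=> y _; rewrite /G' !patchE.
    case: (boolP (y \in B)) => yB.
      rewrite mem_set /=; last by split => //; rewrite inE in yB.
      by rewrite lee_fin (le_trans (hG x y Ax _)) ?ler_norm//; rewrite inE in yB.
    by case: ifPn => [/set_mem [_ /mem_set]|_]; [rewrite (negbTE yB)|rewrite abse0].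
  rewrite (_ : (fun y => _) = cst 0%E) ?integral0//; apply/funext => y.
  rewrite /G' patchE; case: ifPn => [/set_mem [/mem_set]|_]; last by rewrite abse0.
  by rewrite (negbTE xA).
have := Fubini iG'.
have -> : (\int[leb]_x \int[leb]_y G' (x, y) =
    \int[leb]_(x in A) (Rintegral leb B (fun y => G (x, y)))%:E)%E.
  rewrite [RHS]integral_mkcond; apply: eq_integral => x _; rewrite patchE; case: ifPn => xA.
    have Ax : A x by rewrite inE in xA.
    by rewrite G'x// fineK//; exact: (integrable_fin_num mB (ix x Ax)).
  rewrite (_ : (fun y => G' (x, y)) = cst 0%E) ?integral0//; apply/funext => y.
  by rewrite /G' patchE; case: ifPn => // /set_mem [/mem_set]; rewrite (negbTE xA).
have -> : (\int[leb]_y \int[leb]_x G' (x, y) =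
    \int[leb]_(y in B) (Rintegral leb A (fun x => G (x, y)))%:E)%E.
  rewrite [RHS]integral_mkcond; apply: eq_integral => y _; rewrite patchE; case: ifPn => yB.
    have By : B y by rewrite inE in yB.
    by rewrite G'y// fineK//; exact: (integrable_fin_num mA (iy y By)).
  rewrite (_ : (fun x => G' (x, y)) = cst 0%E) ?integral0//; apply/funext => x.
  by rewrite /G' patchE; case: ifPn => // /set_mem [_ /mem_set]; rewrite (negbTE yB).
by rewrite /Rintegral => ->.
Qed.

Lemma Cfubini (A B : set RR) (G : R * R -> R[i]) (h : R -> R) : measurable A -> measurable B ->
  Cmeasurable ((A `*` B) : set (RR * RR)) G -> leb.-integrable A (EFin \o h) ->
  (leb B < +oo)%E -> (forall x y, A x -> B y -> nc (G (x, y)) <= h x) ->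
  Cintegral leb A (fun x => Cintegral leb B (fun y => G (x, y))) =
  Cintegral leb B (fun y => Cintegral leb A (fun x => G (x, y))).
Proof.
move=> mA mB [m1 m2] ih lB hG; rewrite /Cintegral /=; congr (_ +i* _).
- apply: (Rfubini (G := fun z => complex.Re (G z)) mA mB m1 ih lB) => x y Ax By.
  exact: le_trans (normc_Re _) (hG x y Ax By).
- apply: (Rfubini (G := fun z => complex.Im (G z)) mA mB m2 ih lB) => x y Ax By.
  exact: le_trans (normc_Im _) (hG x y Ax By).
Qed.

Lemma integrable_normc (A : set RR) (g : R -> R[i]) : measurable A -> Cintegrable leb A g ->
  leb.-integrable A (EFin \o (fun x => nc (g x))).
Proof.
move=> mA hg; have [g1 g2] := hg; have mg := Cintegrable_measurable hg.
have H := integrableD mA (integrable_abse g1) (integrable_abse g2).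
apply: (le_integrable mA _ _ H).
- by apply/measurable_EFinP; exact: measurable_normc.
- move=> x _; rewrite /= lee_fin ger0_norm ?normc_ge0//.
  by rewrite (le_trans (normc_le _))// ler_norm.
Qed.

Lemma cis_lip (u v : R) : nc (cis u - cis v) <= 2 * `|u - v|.
Proof.
wlog uv : u v / v <= u.
  move=> h; have [/h//|/ltW /h] := leP v u.
  by rewrite /nc -normcN opprB distrC.
have key (F dF : R -> R) : (forall x : R, is_derive x 1 F (dF x)) -> (forall x, `|dF x| <= 1) ->
    `|F u - F v| <= `|u - v|.
  move=> d b; move: uv; rewrite le_eqVlt => /predU1P[->|vu]; first by rewrite !subrr.
  have cF : {within `[v, u], continuous F}.
    by apply: derivable_within_continuous => x _; case: (d x).
  have [c _ ->] := MVT vu (fun x _ => d x) cF.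
  by rewrite normrM ler_piMl.
rewrite (le_trans (normc_le _))// cReD cImD cReN cImN /= mulr2n mulrDl mul1r lerD//.
- apply: (key cos (fun x => - sin x)) => x.
  by rewrite normrN; exact: sin_max.
- apply: (key sin cos) => x.
  exact: cos_max.
Qed.

(** For frequencies in a bounded set the phase is Lipschitz in [y], hence so is the transform, which
    is therefore continuous. *)
Lemma fourier_Cmeasurable (A D : set RR) (M : R) (g : R -> R[i]) : measurable A ->
  (forall t, A t -> `|t| <= M) -> Cintegrable leb A g ->
  Cmeasurable D (fun y : RR => Cintegral leb A (fun t => g t * cis (- (t * y)))).
Proof.
move=> mA AM ig; pose Phi y := Cintegral leb A (fun t => g t * cis (- (t * y))).
have ign := integrable_normc mA ig.
have mc := Cmeasurable_cisNM A.
have igc y : Cintegrable leb A (fun t => g t * cis (- (t * y))).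
  apply: (Cintegrable_le mA _ ign).
    by apply: CmeasurableM => //; exact: (Cintegrable_measurable ig).
  by move=> t _; rewrite Normc.normcM normc_cis mulr1.
pose I := fine (\int[leb]_(t in A) (nc (g t))%:E).
have I_fin : (\int[leb]_(t in A) (nc (g t))%:E)%E = I%:E.
  by rewrite fineK//; exact: integrable_fin_num.
have I0 : 0 <= I by rewrite fine_ge0// integral_ge0// => t _; rewrite lee_fin normc_ge0.
pose M' := `|M|.
have lip y y' : nc (Phi y - Phi y') <= (4 * M' * I) * `|y - y'|.
  rewrite /Phi -(CintegralB mA)//.
  have i2 : Cintegrable leb A (fun t => g t * cis (- (t * y)) - g t * cis (- (t * y'))).
    have := CintegrableD mA (igc y) (CintegrableZ mA (-1) (igc y')).
    by congr Cintegrable; apply/funext => t; rewrite mulN1r.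
  rewrite -lee_fin (le_trans (normc_Cintegral_le mA i2))//.
  apply: (@le_trans _ _ (2%:E * \int[leb]_(t in A) ((2 * M' * `|y - y'|)%:E * (nc (g t))%:E))%E).
    rewrite lee_pmul2l//; apply: ge0_le_integral => //.
    - by move=> t _; rewrite lee_fin normc_ge0.
    - by apply/measurable_EFinP; apply: measurable_normc; exact: (Cintegrable_measurable i2).
    - apply: measurable_funeM; apply/measurable_EFinP; apply: measurable_normc.
      exact: (Cintegrable_measurable ig).
    move=> t At; rewrite -EFinM lee_fin -mulrBr Normc.normcM mulrC ler_wpM2r ?normc_ge0//.
    rewrite (le_trans (cis_lip _ _))// -mulrA ler_pM2l// opprK addrC -mulrBr normrM distrC.
    by rewrite ler_wpM2r// (le_trans (AM t At))// ler_norm.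
  have mg : measurable_fun A (fun t => (nc (g t))%:E).
    by apply/measurable_EFinP; apply: measurable_normc; exact: (Cintegrable_measurable ig).
  have g0 t : A t -> (0 <= (nc (g t))%:E)%E by rewrite lee_fin normc_ge0.
  rewrite (ge0_integralZl_EFin _ mA g0 mg)//; last by rewrite !mulr_ge0// normr_ge0.
  by rewrite I_fin -!EFinM lee_fin le_eqVlt; apply/orP; left; apply/eqP; ring.
have lipc (h : R -> R) : (forall y y', `|h y - h y'| <= (4 * M' * I) * `|y - y'|) -> continuous h.
  move=> hl y; apply/cvgrPdist_le => e e0.
  have C0 : 0 <= 4 * M' * I by rewrite !mulr_ge0// normr_ge0.
  apply/nbhs_ballP; exists (e / (4 * M' * I + 1)); first by rewrite /= divr_gt0//; lra.
  move=> z; rewrite /ball /= ltr_pdivlMr; last lra.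
  move=> hz; rewrite (le_trans (hl y z))// (le_trans _ (ltW hz))// mulrC ler_wpM2l//.
  by rewrite lerDl.
split; apply: measurable_funTS; apply: continuous_measurable_fun; apply: lipc => y y'.
- by rewrite -cReN -cReD; exact: le_trans (normc_Re _) (lip y y').
- by rewrite -cImN -cImD; exact: le_trans (normc_Im _) (lip y y').
Qed.

End FourierTools.

(** * The multiplication formula for the Fourier-Plancherel transform *)

Section Parseval.
Context {R : realType}.
Notation leb := (@lebesgue_measure R).
Notation RR := (measurableTypeR R).
Let nc := @Normc.normc R.

Lemma L2_sub (A D : set RR) f : measurable A -> measurable D -> A `<=` D ->
  L2 leb D f -> L2 leb A f /\ n2 leb A f <= n2 leb D f.
Proof.
move=> mA mD AD hf; have /L2_sqP[[m1 m2] hq] := hf.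
have mf : Cmeasurable A f by split; [exact: measurable_funS m1|exact: measurable_funS m2].
have le : (L2sq leb A f <= L2sq leb D f)%E.
  apply: ge0_subset_integral => //.
  - by apply/measurable_EFinP; apply: measurable_normc_sqr; split.
  - by move=> x _; rewrite lee_fin sqr_ge0.
have fA : L2 leb A f by apply/L2_sqP; split => //; exact: le_lt_trans hq.
split => //; apply: n2_le => //; first exact: n2_ge0.
by rewrite -(L2sq_n2 hf).
Qed.

Lemma Rintegral_sym_itv_cvg (g : R -> R) : leb.-integrable setT (EFin \o g) ->
  Rintegral leb `[- N%:R, N%:R]%classic g @[N --> \oo] --> Rintegral leb setT g.
Proof.
move=> ig.
have mg := measurable_int _ ig.
pose f_ (N : nat) : RR -> \bar R := (EFin \o g) \_ `[- N%:R, N%:R]%classic.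
have mI (N : nat) : @measurable _ RR `[- N%:R, N%:R]%classic by exact: measurable_itv.
have mf_ N : measurable_fun setT (f_ N).
  by apply: (proj1 (measurable_restrictT _ (mI N))); exact: measurable_funTS.
have h : ((fun n => \int[leb]_(x in setT) f_ n x) @ \oo --> \int[leb]_(x in setT) (EFin \o g) x)%E.
  have [] // := @dominated_convergence _ _ _ leb setT measurableT f_ (EFin \o g) (abse \o (EFin \o g)).
  - apply: aeW => x _; apply: cvg_near_cst.
    exists (Num.truncn `|x|).+1 => // N /= hN.
    rewrite /f_ patchE mem_set//= in_itv /= -ler_norml.
    by rewrite (le_trans (ltW (truncnS_gt _)))// ler_nat.
  - exact: integrable_abse.
  - apply: aeW => x n _; rewrite /f_ patchE; case: ifPn => // _.
    by rewrite abse0 /= lee_fin.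
rewrite /Rintegral; apply: fine_cvg; rewrite fineK; last exact: integrable_fin_num.
apply: cvg_trans h; apply: near_eq_cvg; apply: nearW => N /=.
by rewrite [RHS]integral_mkcond.
Qed.

Lemma L2_bounded (A : set RR) (B : R) (K : R -> R[i]) : measurable A -> (leb A < +oo)%E ->
  Cmeasurable A K -> (forall t, A t -> nc (K t) <= B) -> L2 leb A K.
Proof.
move=> mA lA mK KB; apply/L2_sqP; split => //.
apply: (@le_lt_trans _ _ (\int[leb]_(x in A) (B ^+ 2)%:E)%E); last first.
  rewrite (integral_cst leb mA) lte_mul_pinfty//; by rewrite lee_fin sqr_ge0.
apply: ge0_le_integral => //.
- by move=> x _; rewrite lee_fin sqr_ge0.
- by apply/measurable_EFinP; exact: measurable_normc_sqr.
- move=> x Ax; rewrite lee_fin lerXn2r ?nnegrE ?normc_ge0 ?KB//.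
  by rewrite (le_trans _ (KB x Ax))// normc_ge0.
Qed.

Lemma Cintegrable_L2 (A : set RR) (f : R -> R[i]) : measurable A -> (leb A < +oo)%E ->
  L2 leb A f -> Cintegrable leb A f.
Proof.
move=> mA lA fL; have : Cintegrable leb A (fun x => f x * 1).
  apply: Cintegrable_mul => //.
  have m1 : Cmeasurable (A : set RR) (fun=> 1 : R[i]) by split; exact: measurable_cst.
  apply: (@L2_bounded _ 1) => //; by move=> t _; rewrite /nc normc_real normr1.
by congr Cintegrable; apply/funext => x; rewrite mulr1.
Qed.

(** Fubini's theorem on the product of [[-N, N]] and [A], where [f] is integrable and the kernel
    bounded. *)
Lemma fourier_truncated_pairing (A : set RR) (B : R) (K f : R -> R[i]) N : measurable A ->
  (leb A < +oo)%E -> Cmeasurable A K ->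
  (forall t, A t -> nc (K t) <= B) -> L2 leb setT f ->
  Cintegral leb A (fun t => fourier_truncated N f t * K t) =
  Cintegral leb `[- N%:R, N%:R] (fun x => f x * Cintegral leb A (fun t => K t * cis (- (t * x)))).
Proof.
move=> mA lA mK KB fL.
pose I : set RR := `[- N%:R, N%:R]%classic.
have mI : measurable I by exact: measurable_itv.
have lI : (leb I < +oo)%E by exact: lebesgue_itvcc_lty.
have cL (D : set RR) y : measurable D -> (leb D < +oo)%E -> L2 leb D (fun t : RR => cis (- (t * y))).
  move=> mD lD; apply: (@L2_bounded _ 1) => //; first exact: Cmeasurable_cisNM.
  by move=> t _; rewrite /nc normc_cis.
have KL : L2 leb A K by exact: L2_bounded lA mK KB.
have fI : L2 leb I f := (L2_sub mI measurableT (@subsetT _ I) fL).1.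
pose G (z : R * R) := f z.1 * (K z.2 * cis (- (z.2 * z.1))).
transitivity (Cintegral leb A (fun t => Cintegral leb I (fun x => G (x, t)))).
  apply: eq_Cintegral => t At; rewrite mulrC /fourier_truncated -(CintegralZ mI).
    by apply: eq_Cintegral => x _; rewrite /G /= [t * x]mulrC; ring.
  exact: Cintegrable_mul fI (cL _ _ mI lI).
transitivity (Cintegral leb I (fun x => Cintegral leb A (fun t => G (x, t)))); last first.
  apply: eq_Cintegral => x Ix; rewrite /G /= (CintegralZ mA)//.
  exact: Cintegrable_mul KL (cL _ _ mA lA).
symmetry; apply: (Cfubini (h := fun x => nc (f x) * B)) => //.
- have mf : Cmeasurable ((I `*` A) : set (RR * RR)) (fun z => f z.1).
    have [[m1 m2] _] := fL.
    split; apply: measurable_funTS.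
    - exact: (measurableT_comp m1 (@measurable_fst _ _ RR RR)).
    - exact: (measurableT_comp m2 (@measurable_fst _ _ RR RR)).
  have mK2 : Cmeasurable ((I `*` A) : set (RR * RR)) (fun z => K z.2).
    have sub (k : R -> R) : measurable_fun A k ->
        measurable_fun ((I `*` A) : set (RR * RR)) (fun z => k z.2).
      move=> mk; have mk' := (proj1 (measurable_restrictT _ mA)) mk.
      apply: (eq_measurable_fun (fun z => (k \_ A) z.2)).
        by move=> z; rewrite inE => -[_ zA]; rewrite patchE mem_set.
      apply: measurable_funTS.
      exact: (measurableT_comp mk' (@measurable_snd _ _ RR RR)).
    by split; [exact: (sub (fun t => complex.Re (K t)) mK.1)|exact: (sub (fun t => complex.Im (K t)) mK.2)].
  apply: CmeasurableM => //; apply: CmeasurableM => //.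
  have m : measurable_fun ((I `*` A) : set (RR * RR)) (fun z => - (z.2 * z.1)).
    apply: measurable_funTS; apply: measurable_funN; apply: measurable_funM.
      exact: measurable_snd.
    exact: measurable_fst.
  split => /=.
  + by apply: measurableT_comp m; apply: continuous_measurable_fun; exact: continuous_cos.
  + by apply: measurableT_comp m; apply: continuous_measurable_fun; exact: continuous_sin.
- have iN := integrable_normc mI (Cintegrable_L2 mI lI fI).
  rewrite (_ : EFin \o _ = (fun x => B%:E * (EFin \o (fun x => nc (f x))) x)%E).
    exact: integrableZl.
  by apply/funext => x /=; rewrite -EFinM mulrC.
- move=> x t Ix At; rewrite /nc !Normc.normcM normc_cis mulr1.
  by rewrite ler_wpM2l ?normc_ge0// KB.
Qed.

(** Limit of the truncated formula: dominated convergence on the side of [f], and on the side of [F]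
    the L2 convergence of the truncated transforms, paired with the function [K] that is square
    integrable on [A]. *)
Lemma fourier_duality (A : set RR) (B : R) (K f F : R -> R[i]) : measurable A ->
  (leb A < +oo)%E -> Cmeasurable A K -> 0 <= B ->
  (forall t, A t -> nc (K t) <= B) ->
  L2 leb setT (fun x => Cintegral leb A (fun t => K t * cis (- (t * x)))) ->
  is_fourier f F ->
  Cintegral leb setT (fun x => f x * Cintegral leb A (fun t => K t * cis (- (t * x)))) =
  Cintegral leb A (fun t => F t * K t).
Proof.
move=> mA lA mK B0 KB.
set q := fun x => Cintegral _ _ _; move=> qL [fL FL ftF].
pose s N := Cintegral leb A (fun t => fourier_truncated N f t * K t).
have sE N : s N = Cintegral leb `[- N%:R, N%:R] (fun x => f x * q x).
  exact: (fourier_truncated_pairing N mA lA mK KB fL).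
have [i1 i2] := Cintegrable_mul measurableT fL qL.
have KL : L2 leb A K by exact: L2_bounded lA mK KB.
have FA := (L2_sub mA measurableT (@subsetT _ A) FL).1.
have mft N (D : set RR) : Cmeasurable D (fourier_truncated N f).
  have mI : @measurable _ RR `[- N%:R, N%:R]%classic by exact: measurable_itv.
  pose I : set RR := `[- N%:R, N%:R]%classic.
  have lI : (leb I < +oo)%E by exact: lebesgue_itvcc_lty.
  apply: (@fourier_Cmeasurable _ _ D N%:R) => //.
    by move=> t /=; rewrite in_itv /= ler_norml.
  apply: Cintegrable_L2 => //.
  exact: (L2_sub mI measurableT (@subsetT _ _) fL).1.
have conv : nc (s N - Cintegral leb A (fun t => F t * K t)) @[N --> \oo] --> 0.
  apply/cvgrPdist_le => e e0.
  pose e' := e / (2 * (n2 leb A K + 1)).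
  have K0 := n2_ge0 leb A K.
  have e'0 : 0 < e' by rewrite divr_gt0// mulr_gt0// ltr_wpDl.
  have : \forall N \near \oo, (L2norm leb setT (fun xi => fourier_truncated N f xi - F xi)%R
      < e'%:E)%E.
    have nb : nbhs (0%E : \bar R) [set y | (y < e'%:E)%E].
      by apply: open_nbhs_nbhs; split; [exact: open_ereal_lt_ereal|rewrite /= lte_fin].
    exact: ftF _ nb.
  apply: filterS => N hN; rewrite sub0r normrN ger0_norm ?normc_ge0//.
  have dL : L2 leb setT (fun xi => fourier_truncated N f xi - F xi).
    split; first by apply: CmeasurableB; [exact: mft|case: FL].
    exact: lt_trans hN (ltry _).
  have [dA dle] := L2_sub mA measurableT (@subsetT _ A) dL.
  have d1 : n2 leb A (fun xi => fourier_truncated N f xi - F xi) <= e'.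
    by rewrite (le_trans dle)// -lee_fin -(L2norm_fin dL) ltW.
  have ftA : L2 leb A (fourier_truncated N f).
    have [h _] := n2D mA dA FA.
    by move: h; congr (L2 leb A); apply/funext => x; rewrite subrK.
  rewrite /s -(CintegralB mA); [|exact: Cintegrable_mul|exact: Cintegrable_mul].
  rewrite (_ : (fun x => _) = (fun x => (fourier_truncated N f x - F x) * K x)); last first.
    by apply/funext => x; rewrite mulrBl.
  rewrite (le_trans (normc_pairing_le mA dA KL))//.
  apply: (@le_trans _ _ (2 * e' * n2 leb A K)).
    by rewrite ler_wpM2r// ler_wpM2l.
  rewrite /e' (_ : _ * _ = e * (n2 leb A K / (n2 leb A K + 1))); last first.
    by field; rewrite lt0r_neq0// ltr_wpDl.
  by rewrite ler_piMr ?(ltW e0)// ler_pdivrMr ?ltr_wpDl// mul1r lerDl.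
have cRe (g : R[i] -> R) (l : R[i]) : (forall z, `|g z - g l| <= nc (z - l)) ->
    nc (s N - l) @[N --> \oo] --> 0 -> g (s N) @[N --> \oo] --> g l.
  move=> gl sl; apply/cvgrPdist_le => e e0; move/cvgrPdist_le: sl => /(_ e e0).
  apply: filterS => N; rewrite sub0r normrN ger0_norm ?normc_ge0// distrC.
  exact: le_trans.
apply: complex_ext.
- have h1 := Rintegral_sym_itv_cvg i1.
  have h2 := cRe (@complex.Re R) _ _ conv.
  apply: (cvg_unique _ h1) => //; apply: cvg_trans (h2 _).
    by apply: near_eq_cvg; apply: nearW => N; rewrite sE.
  by move=> z; rewrite -cReN -cReD; exact: normc_Re.
- have h1 := Rintegral_sym_itv_cvg i2.
  have h2 := cRe (@complex.Im R) _ _ conv.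
  apply: (cvg_unique _ h1) => //; apply: cvg_trans (h2 _).
    by apply: near_eq_cvg; apply: nearW => N; rewrite sE.
  by move=> z; rewrite -cImN -cImD; exact: normc_Im.
Qed.

End Parseval.

(** * Integration by parts against completely monotone weights *)

Section Oscillation.
Context {R : realType}.
Notation leb := (@lebesgue_measure R).
Notation RR := (measurableTypeR R).

Lemma continuous_itv_integrable (f : R -> R) (a b : R) :
  (forall x, a <= x <= b -> {for x, continuous f}) ->
  leb.-integrable (`[a, b]%classic : set RR) (EFin \o f).
Proof.
move=> cf; apply: continuous_compact_integrable; first exact: segment_compact.
by apply: continuous_in_subspaceT => x; rewrite inE /= in_itv /=; exact: cf.
Qed.

Lemma is_derive1_continuous (f : R -> R) x df : is_derive x (1 : R) f df ->
  {for x, continuous f}.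
Proof. by move=> [h _]; exact/differentiable_continuous/derivable1_diffP. Qed.

Lemma Rintegral_by_parts (f df g dg : R -> R) (a b : R) : a < b ->
  (forall x, a <= x <= b -> is_derive x 1 f (df x)) ->
  (forall x, a <= x <= b -> is_derive x 1 g (dg x)) ->
  (forall x, a <= x <= b -> {for x, continuous df}) ->
  (forall x, a <= x <= b -> {for x, continuous dg}) ->
  Rintegral leb `[a, b]%classic (fun x => f x * dg x) =
  f b * g b - f a * g a - Rintegral leb `[a, b]%classic (fun x => df x * g x).
Proof.
move=> ab df' dg' cdf cdg.
have cf x (h : a <= x <= b) := is_derive1_continuous (df' x h).
have cg x (h : a <= x <= b) := is_derive1_continuous (dg' x h).
have c1 x : a <= x <= b -> {for x, continuous (fun x => f x * dg x)}.
  by move=> h; apply: cvgM; [exact: cf|exact: cdg].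
have c2 x : a <= x <= b -> {for x, continuous (fun x => df x * g x)}.
  by move=> h; apply: cvgM; [exact: cdf|exact: cg].
have dfg x (h : a <= x <= b) : is_derive x 1 (f \* g) (f x * dg x + df x * g x).
  have h1 := df' x h; have h2 := dg' x h.
  by apply: is_derive_eq; rewrite /GRing.scale /= [g x * _]mulrC.
have cfg x (h : a <= x <= b) : {for x, continuous (fun x => f x * dg x + df x * g x)}.
  by apply: cvgD; [exact: c1|exact: c2].
have := Rintegral_FTC ab dfg cfg.
rewrite RintegralD//; [|exact: continuous_itv_integrable|exact: continuous_itv_integrable].
by move=> /= <-; rewrite addrK.
Qed.

(** The profile x^m/m! moved to start at frequency 1, away from the singularity of x^alpha at 0. It
    vanishes at 1 with its derivatives of order less than [m]. *)
Definition shifted_monomial m (x : R) : R := (x - 1) ^+ m / m`!%:R.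

Lemma is_derive_shifted_monomial m (x : R) :
  is_derive x 1 (shifted_monomial m.+1) (shifted_monomial m x).
Proof.
rewrite (_ : shifted_monomial m.+1 = (m.+1`!%:R)^-1 \*: ((id - cst 1) ^+ m.+1)); last first.
  by apply/funext => y; rewrite /shifted_monomial /GRing.scale /= fctE mulrC.
apply: is_derive_eq; rewrite /shifted_monomial /GRing.scale /= subr0 mulr1.
rewrite factS natrM -mulr_natl; field.
by rewrite pnatr_eq0 -lt0n fact_gt0 /= ?pnatr_eq0.
Qed.

Lemma shifted_monomial_continuous m (x : R) : {for x, continuous (shifted_monomial m)}.
Proof.
case: m => [|m]; last exact: is_derive1_continuous (is_derive_shifted_monomial _ _).
rewrite (_ : shifted_monomial 0 = cst 1); first exact: cvg_cst.
by apply/funext => y; rewrite /shifted_monomial expr0 divr1.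
Qed.

Lemma is_derive_sin_phase (y u x : R) : y != 0 ->
  is_derive x 1 (fun x => sin (x * y + u) / y) (cos (x * y + u)).
Proof.
move=> y0.
have h : is_derive x 1 (fun x => x * y + u) y.
  rewrite (_ : (fun x => _) = y \*: id + cst u); last first.
    by apply/funext => z /=; rewrite /GRing.scale /= mulrC.
  by apply: is_derive_eq; rewrite /GRing.scale /= mulr1 addr0.
have h2 : is_derive x 1 (sin \o (fun x => x * y + u)) (cos (x * y + u) * y).
  exact: is_derive1_comp.
rewrite (_ : (fun x => _) = y^-1 \*: (sin \o (fun x => x * y + u))); last first.
  by apply/funext => z /=; rewrite mulrC.
by apply: is_derive_eq; rewrite /GRing.scale /=; field.
Qed.

Lemma continuous_cos_phase (y u x : R) : {for x, continuous (fun x : R => cos (x * y + u))}.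
Proof.
apply: continuous_comp; last exact: continuous_cos.
by apply: cvgD; [apply: cvgM; [exact: cvg_id|exact: cvg_cst]|exact: cvg_cst].
Qed.

Section CM.
Context (L : R) (n : nat) (c : nat -> R -> R).
Hypothesis L1 : 1 < L.
Hypothesis dc : forall j (x : R), (j < n.+2)%N -> 0 < x -> is_derive x 1 (c j) (- c j.+1 x).
Hypothesis c_ge0 : forall j x, (j <= n.+2)%N -> 0 < x <= L -> 0 <= c j x.
Hypothesis cL : forall j, (j <= n.+2)%N -> c j L = 0.

Let I : set RR := `[1, L]%classic.

Let mI : measurable I. Proof. exact: measurable_itv. Qed.

Let I0 x : 1 <= x <= L -> 0 < x.
Proof. by move=> /andP[h _]; exact: lt_le_trans h. Qed.

Let cc j x : (j < n.+2)%N -> 1 <= x <= L -> {for x, continuous (c j)}.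
Proof. by move=> jn h; exact: is_derive1_continuous (dc jn (I0 h)). Qed.

Let ccN j x : (j < n.+2)%N -> 1 <= x <= L -> {for x, continuous (fun x => - c j x)}.
Proof. by move=> jn h; apply: cvgN; exact: cc. Qed.

(** Repeated integration by parts: the monomial of positive degree vanishes at 1 and every [c j] at
    [L], so only the last step leaves a boundary value. It is the continuous counterpart of the
    value of [negbin_sum] at 1. *)
Lemma cm_moment m : (m <= n)%N -> Rintegral leb I (fun x => shifted_monomial m x * c m.+1 x) = c 0 1.
Proof.
elim: m => [|m IH] mn.
  have h := Rintegral_FTC L1 (fun x hx => dc (ltn0Sn _) (I0 hx))
    (fun x hx => ccN (isT : (1 < n.+2)%N) hx).
  transitivity (Rintegral leb I (fun x => (-1) * (- c 1%N x))).
    by apply: eq_Rintegral => x _; rewrite /shifted_monomial expr0 divr1 mul1r mulN1r opprK.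
  rewrite RintegralZl//; last by apply: continuous_itv_integrable => x hx; exact: ccN.
  by rewrite h cL// sub0r mulN1r opprK.
have m2 : (m.+2 < n.+2)%N by rewrite !ltnS.
have m1 : (m.+1 < n.+2)%N by exact: ltnW.
have h := Rintegral_by_parts L1 (fun x _ => is_derive_shifted_monomial m x)
  (fun x hx => dc m1 (I0 hx)) (fun x _ => @shifted_monomial_continuous m x) (fun x hx => ccN m2 hx).
transitivity (Rintegral leb I (fun x => (-1) * (shifted_monomial m.+1 x * - c m.+2 x))).
  by apply: eq_Rintegral => x _; rewrite mulrN mulN1r opprK.
rewrite RintegralZl//; last first.
  by apply: continuous_itv_integrable => x hx; apply: cvgM; [exact: shifted_monomial_continuous|exact: ccN].
rewrite h (cL (ltnW m1)) /shifted_monomial subrr expr0n /= !mulr0 !mul0r subr0 sub0r mulN1r opprK.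
by rewrite -/(shifted_monomial m) IH// ltnW.
Qed.

Let w_ge0 m x : 1 <= x -> 0 <= shifted_monomial m x.
Proof. by move=> x1; rewrite divr_ge0// exprn_ge0// subr_ge0. Qed.

Let cwc m j (y u x : R) : (j < n.+2)%N -> 1 <= x <= L ->
  {for x, continuous (fun x : R => shifted_monomial m x * c j x * cos (x * y + u))}.
Proof.
move=> jn hx; apply: cvgM; last exact: continuous_cos_phase.
by apply: cvgM; [exact: shifted_monomial_continuous|exact: cc].
Qed.

(* One integration by parts gains [`|y|^-1] and leaves two terms of the same kind:
   either the monomial or [c j] is differentiated, and both lower [d] by one. *)
Lemma cm_oscillation (y u : R) d m j : y != 0 -> (m <= n)%N -> (j + d)%N = m.+1 ->
  `|Rintegral leb I (fun x => shifted_monomial m x * c j x * cos (x * y + u))| <=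
  (2 / `|y|) ^+ d * c 0 1.
Proof.
move=> y0 mn; have c01 : 0 <= c 0 1 by apply: c_ge0 => //; rewrite ltr01 ltW.
have posy : 0 < `|y| by rewrite normr_gt0.
elim: d m j u mn => [|d IH] m j u mn jd.
  rewrite expr0 mul1r -(cm_moment mn); move: jd; rewrite addn0 => ->.
  have mn2 : (m.+1 < n.+2)%N by [].
  apply: le_trans (le_normr_Rintegral _ _) _ => //.
    by apply: continuous_itv_integrable => x hx; exact: cwc.
  apply: le_Rintegral => //.
  - have := integrable_abse (continuous_itv_integrable (fun x hx => @cwc m _ y u x mn2 hx)).
    exact.
  - by apply: continuous_itv_integrable => x hx; apply: cvgM; [exact: shifted_monomial_continuous|exact: cc].
  - move=> x; rewrite /I /= in_itv /= => hx.
    have wc : 0 <= shifted_monomial m x * c m.+1 x.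
      rewrite mulr_ge0 ?w_ge0//; first by case/andP: hx.
      by apply: c_ge0; [exact: ltnW|rewrite (I0 hx); case/andP: hx].
    by rewrite normrM (ger0_norm wc) ler_piMr// cos_max.
have jn : (j.+1 < n.+2)%N by lia.
have jn' := ltnW jn.
pose dw (x : R) : R := if m is m'.+1 then shifted_monomial m' x else 0.
have dw' (x : R) : is_derive x 1 (shifted_monomial m) (dw x).
  rewrite /dw; case: (m) => [|m']; last exact: is_derive_shifted_monomial.
  rewrite (_ : shifted_monomial 0 = cst 1); first exact: is_derive_cst.
  by apply/funext => z; rewrite /shifted_monomial expr0 divr1.
have cdw (x : R) : {for x, continuous dw}.
  by rewrite /dw; case: (m) => [|m']; [exact: cvg_cst|exact: shifted_monomial_continuous].
(* A phase shift by [pi / 2] writes the sine as a cosine again, so the induction hypothesis, stated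
   for every phase, applies. *)
pose cs (x : R) : R := cos (x * y + (u + pi / 2)).
have csE x : sin (x * y + u) = - cs x by rewrite /cs addrA cosDpihalf opprK.
have df (x : R) (hx : 1 <= x <= L) :
    is_derive x 1 (shifted_monomial m \* c j) (dw x * c j x - shifted_monomial m x * c j.+1 x).
  have h1 := dw' x; have h2 := dc jn' (I0 hx).
  by apply: is_derive_eq; rewrite /GRing.scale /=; ring.
have cdf (x : R) (hx : 1 <= x <= L) :
    {for x, continuous (fun x => dw x * c j x - shifted_monomial m x * c j.+1 x)}.
  apply: cvgB; apply: cvgM; [exact: cdw|exact: cc|exact: shifted_monomial_continuous|exact: cc].
have c1 (x : R) : 1 <= x <= L -> {for x, continuous (fun x => dw x * c j x * cs x)}.
  by move=> hx; apply: cvgM; [apply: cvgM; [exact: cdw|exact: cc]|exact: continuous_cos_phase].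
have c2 (x : R) : 1 <= x <= L -> {for x, continuous (fun x => shifted_monomial m x * c j.+1 x * cs x)}.
  by move=> hx; exact: cwc.
have i1 := continuous_itv_integrable c1.
have i2 := continuous_itv_integrable c2.
have -> := Rintegral_by_parts L1 df (fun x _ => @is_derive_sin_phase y u x y0) cdf
  (fun x _ => @continuous_cos_phase y u x).
have -> : Rintegral leb `[1, L]%classic
    (fun x => (dw x * c j x - shifted_monomial m x * c j.+1 x) * (sin (x * y + u) / y)) =
    y^-1 * (Rintegral leb I (fun x => shifted_monomial m x * c j.+1 x * cs x) -
      Rintegral leb I (fun x => dw x * c j x * cs x)).
  rewrite -RintegralB// -RintegralZl//; last first.
    by apply: continuous_itv_integrable => x hx; apply: cvgB; [exact: c2|exact: c1].
  by apply: eq_Rintegral => x _; rewrite csE; ring.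
set J2 := Rintegral leb I (fun x => shifted_monomial m x * c j.+1 x * cs x).
set J1 := Rintegral leb I (fun x => dw x * c j x * cs x).
have hJ2 : `|J2| <= (2 / `|y|) ^+ d * c 0 1 by apply: IH; lia.
rewrite /= (cL (ltnW jn')) mulr0 mul0r sub0r.
have key : `|y^-1 * J1 - shifted_monomial m 1 * c j 1 * (sin (1 * y + u) / y)| <=
    `|y|^-1 * ((2 / `|y|) ^+ d * c 0 1).
  (* In degree 0 the monomial has derivative 0 and only the boundary term at 1 is left; in positive
     degree the boundary term vanishes and the integral is left. *)
  rewrite /J1 /dw; case: (m) mn jd => [_ jd|m' mn' jd].
    have j0 : j = 0%N by lia.
    have d0 : d = 0%N by lia.
    have -> : Rintegral leb I (fun x => 0 * c j x * cs x) = 0.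
      transitivity (Rintegral leb I (fun=> 0)).
        by apply: eq_Rintegral => x _; rewrite !mul0r.
      by rewrite Rintegral_cst// mul0r.
    rewrite j0 d0.
    rewrite mulr0 sub0r normrN /shifted_monomial !expr0 divr1 !mul1r.
    rewrite !normrM normfV (ger0_norm c01) [leRHS]mulrC ler_wpM2l ?invr_ge0 ?(ltW posy)//.
    by rewrite ler_piMl ?invr_ge0 ?normr_ge0 ?sin_max.
  rewrite /(shifted_monomial m'.+1 1) subrr expr0n !mul0r subr0 normrM normfV.
  rewrite ler_wpM2l ?invr_ge0 ?(ltW posy)//; apply: IH; lia.
set b := shifted_monomial m 1 * _ * _ in key *.
have -> : - b - y^-1 * (J2 - J1) = (y^-1 * J1 - b) - y^-1 * J2 by ring.
have key2 : `|y^-1 * J2| <= `|y|^-1 * ((2 / `|y|) ^+ d * c 0 1).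
  by rewrite normrM normfV; apply: ler_wpM2l; [rewrite invr_ge0 ltW|exact: hJ2].
rewrite (le_trans (ler_normB _ _))// (le_trans (lerD key key2))//.
by rewrite le_eqVlt; apply/orP; left; apply/eqP; rewrite exprS; ring.
Qed.

End CM.
End Oscillation.

(** * The test functions on the line *)

Section LineTest.
Context {R : realType}.
Notation leb := (@lebesgue_measure R).
Notation RR := (measurableTypeR R).
Let nc := @Normc.normc R.
Context (alpha a L : R) (n : nat).
Hypothesis alpha01 : 0 <= alpha <= 1.
Hypothesis L1 : 1 < L.
Let I : set RR := `[1, L]%classic.

Let mI : measurable I. Proof. exact: measurable_itv. Qed.

Let leb_I : (leb I = (L - 1)%:E)%E.
Proof. by rewrite /I lebesgue_measure_itv /= lte_fin L1. Qed.

Let lI : (leb I < +oo)%E. Proof. exact: lebesgue_itvcc_lty. Qed.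

(* The factor vanishing at [L] to order [n + 3] kills the boundary terms of the
   [n + 1] integrations by parts and keeps the weight completely monotone up to
   order [n + 2]. *)
Definition line_weight (t x : R) : R :=
  shifted_monomial n x * ((1 - x / L) ^+ n.+3 * expR (- t * x `^ alpha)).

Definition line_test (t x : R) : R[i] :=
  Cintegral leb `[1, L] (fun xi => (line_weight t xi)%:C * cis (xi * a) * cis (- (xi * x))).

Let II x : I x -> 1 <= x <= L. Proof. by rewrite /I /= in_itv. Qed.

Lemma line_weight_ge0 t x : 1 <= x <= L -> 0 <= line_weight t x.
Proof.
move=> /andP[x1 xL]; have L0 : 0 < L by rewrite (lt_trans ltr01).
rewrite mulr_ge0//; first by rewrite divr_ge0 ?exprn_ge0 ?subr_ge0.
by rewrite mulr_ge0 ?expR_ge0// exprn_ge0// subr_ge0 ler_pdivrMr// mul1r.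
Qed.

Lemma line_weight_le t x : 0 <= t -> 1 <= x <= L -> line_weight t x <= L ^+ n.
Proof.
move=> t0 /andP[x1 xL]; have L0 : 0 < L by rewrite (lt_trans ltr01).
have x0 : 0 < x by exact: lt_le_trans x1.
rewrite -[leRHS]mulr1 ler_pM//.
- by rewrite divr_ge0 ?exprn_ge0 ?subr_ge0.
- by rewrite mulr_ge0 ?expR_ge0// exprn_ge0// subr_ge0 ler_pdivrMr// mul1r.
- rewrite ler_pdivrMr ?ltr0n ?fact_gt0//.
  apply: (@le_trans _ _ (L ^+ n)).
    by rewrite lerXn2r ?nnegrE ?subr_ge0 ?(ltW L0)//; lra.
  by rewrite ler_peMr ?exprn_ge0 ?(ltW L0)// ler1n fact_gt0.
- rewrite mulr_ile1 ?expR_ge0//.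
  + by rewrite exprn_ge0// subr_ge0 ler_pdivrMr// mul1r.
  + by rewrite exprn_ile1 ?subr_ge0 ?ler_pdivrMr ?mul1r// gerBl divr_ge0// ltW.
  + by rewrite -expR0 ler_expR mulNr oppr_le0 mulr_ge0// powR_ge0.
Qed.

Lemma line_weight_continuous t x : 1 <= x <= L -> {for x, continuous (line_weight t)}.
Proof.
move=> /andP[x1 _]; have x0 : 0 < x by exact: lt_le_trans x1.
apply: cvgM; first exact: shifted_monomial_continuous.
apply: cvgM.
  have h : {for x, continuous (fun x : R => 1 - x / L)}.
    by apply: cvgB; [exact: cvg_cst|apply: cvgM; [exact: cvg_id|exact: cvg_cst]].
  apply: (@continuous_comp _ _ _ (fun x : R => 1 - x / L) (fun y => y ^+ n.+3)) => //.
  exact: exprn_continuous.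
apply: (@continuous_comp _ _ _ (fun x : R => - t * x `^ alpha) expR); last exact: continuous_expR.
apply: cvgM; first exact: cvg_cst.
exact: (is_derive1_continuous (is_derive1_powR alpha x0)).
Qed.

Let weight_integrable t : leb.-integrable I (EFin \o line_weight t).
Proof. by apply: continuous_itv_integrable => x; exact: line_weight_continuous. Qed.

Let weight_measurable t : Cmeasurable I (fun x => (line_weight t x)%:C).
Proof.
split => /=; last exact: measurable_cst.
by apply/measurable_EFinP; exact: measurable_int (weight_integrable t).
Qed.

Lemma line_kernel_measurable t : Cmeasurable I (fun x => (line_weight t x)%:C * cis (x * a)).
Proof. by apply: CmeasurableM; [exact: weight_measurable|exact: Cmeasurable_cisM]. Qed.

Lemma line_kernel_le t x : 0 <= t -> 1 <= x <= L ->
  nc ((line_weight t x)%:C * cis (x * a)) <= L ^+ n.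
Proof.
move=> t0 hx; rewrite /nc Normc.normcM normc_cis mulr1 normc_real ger0_norm ?line_weight_ge0//.
exact: line_weight_le.
Qed.

Let kernel_integrable t : 0 <= t ->
  Cintegrable leb I (fun x => (line_weight t x)%:C * cis (x * a)).
Proof.
move=> t0; apply: Cintegrable_L2 => //; apply: (@L2_bounded _ _ (L ^+ n)) => //.
  exact: line_kernel_measurable.
by move=> x /II; exact: line_kernel_le.
Qed.

Lemma line_test_Cmeasurable (D : set RR) t : 0 <= t -> Cmeasurable D (line_test t).
Proof.
move=> t0; apply: (@fourier_Cmeasurable _ I D L) => //; last exact: kernel_integrable.
by move=> x /II /andP[x1 xL]; rewrite ger0_norm// (le_trans ler01).
Qed.

(** This ignores the oscillation and serves near [a], where the decay estimate degenerates. *)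
Lemma line_test_crude t x : 0 <= t -> nc (line_test t x) <= 2 * (L ^+ n * L).
Proof.
move=> t0.
have ik : Cintegrable leb I (fun xi => (line_weight t xi)%:C * cis (xi * a) * cis (- (xi * x))).
  apply: (Cintegrable_le mI _ (integrable_normc mI (kernel_integrable t0))).
    apply: CmeasurableM; first exact: line_kernel_measurable.
    exact: Cmeasurable_cisNM.
  by move=> y _; rewrite Normc.normcM normc_cis mulr1.
rewrite -lee_fin (le_trans (normc_Cintegral_le mI ik))// EFinM lee_pmul2l//.
apply: (@le_trans _ _ (\int[leb]_(y in I) (L ^+ n)%:E)%E).
  apply: ge0_le_integral => //.
  - by move=> y _; rewrite lee_fin normc_ge0.
  - by apply/measurable_EFinP; apply: measurable_normc; exact: (Cintegrable_measurable ik).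
  - by move=> y Iy; rewrite lee_fin Normc.normcM normc_cis mulr1; apply: line_kernel_le => //; exact: II.
rewrite (integral_cst leb mI) [X in (_ * X)%E](_ : _ = (L - 1)%:E)%E//.
by rewrite -EFinM lee_fin ler_wpM2l ?exprn_ge0 ?(ltW (lt_trans ltr01 L1))// gerBl.
Qed.

(** Cut-off times exponential is completely monotone up to order [n + 2] on (0, L] and vanishes at
    [L], so the oscillatory estimate gains the full power [n + 1]. The factor 2 adds real and
    imaginary parts. *)
Lemma line_test_le t x : 0 <= t -> x != a ->
  nc (line_test t x) <= 2 * (2 / `|x - a|) ^+ n.+1.
Proof.
move=> t0 xa; pose D : set R := [set y | 0 < y <= L].
have L0 : 0 < L by exact: lt_trans ltr01 L1.
have hcm : cm D [set L] n.+2 ((fun x => (1 - x / L) ^+ n.+3) \* (fun x => expR (- t * x `^ alpha))).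
  apply: cmM; first by apply: cm_expr => // y /andP[].
  by apply: cm_expR_powR => // y /andP[].
have [c [c0 dc cz]] := cm_derivatives hcm.
have c01 : c 0 1 <= 1.
  rewrite c0 /= mulr_ile1 ?expR_ge0//.
  - by rewrite exprn_ge0// subr_ge0 ler_pdivrMr// mul1r ltW.
  - by rewrite exprn_ile1 ?subr_ge0 ?ler_pdivrMr ?mul1r ?(ltW L1)// gerBl invr_ge0// ltW.
  - by rewrite -expR0 ler_expR mulNr oppr_le0 mulr_ge0// powR_ge0.
have y0 : a - x != 0 by rewrite subr_eq0 eq_sym.
have key u : `|Rintegral leb I (fun xi => line_weight t xi * cos (xi * (a - x) + u))| <=
    (2 / `|x - a|) ^+ n.+1.
  have := @cm_oscillation _ L n c L1 dc (fun j y jn hy => proj1 (cz j y jn) hy)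
    (fun j jn => proj2 (cz j L jn) erefl) (a - x) u n.+1 n 0 y0 (leqnn n) (add0n _).
  rewrite c0 -/(line_weight t) distrC => h; apply: le_trans h _.
  rewrite -[leRHS]mulr1 ler_wpM2l ?exprn_ge0 ?divr_ge0//.
  by move: c01; rewrite c0.
have -> : line_test t x = Cintegral leb I (fun xi => (line_weight t xi)%:C * cis (xi * (a - x))).
  by apply: eq_Cintegral => xi _; rewrite -mulrA -cisD mulrBr.
apply: (le_trans (normc_le _)); rewrite mulr2n mulrDl mul1r /Cintegral; apply: lerD.
- have := key 0; congr (`|_| <= _); apply: eq_Rintegral => y _.
  by rewrite /= mul0r subr0 addr0.
(* The phase [- (pi / 2)] turns the cosine into the sine of the imaginary part. *)
- have := key (- (pi / 2)); congr (`|_| <= _); apply: eq_Rintegral => y _.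
  by rewrite /= mul0r addr0 cosBpihalf.
Qed.

End LineTest.

(** * Decay in space and duality on the line *)

Section LineDuality.
Context {R : realType}.
Notation leb := (@lebesgue_measure R).
Notation RR := (measurableTypeR R).
Let nc := @Normc.normc R.
Context (alpha a L : R) (n : nat).
Hypothesis alpha01 : 0 <= alpha <= 1.
Hypothesis L1 : 1 < L.
Let I : set RR := `[1, L]%classic.
Let q := line_test alpha a L n.
Let K t xi := (line_weight alpha L n t xi)%:C * cis (xi * a).

Let mI : measurable I. Proof. exact: measurable_itv. Qed.

Let leb_I : (leb I = (L - 1)%:E)%E.
Proof. by rewrite /I lebesgue_measure_itv /= lte_fin L1. Qed.

Let lI : (leb I < +oo)%E. Proof. exact: lebesgue_itvcc_lty. Qed.

Let II x : I x -> 1 <= x <= L. Proof. by rewrite /I /= in_itv. Qed.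

Let L0 : 0 < L. Proof. exact: lt_trans ltr01 L1. Qed.

Lemma oneDsqr_shift (x r : R) : 0 < r -> r <= `|x - a| ->
  (`|x - a| ^+ 2)^-1 <= 2 * (1 + a ^+ 2) * (1 + (r ^+ 2)^-1) * (1 + x ^+ 2)^-1.
Proof.
move=> r0 rx; have y0 : 0 < `|x - a| by exact: lt_le_trans rx.
have yr : r ^+ 2 <= `|x - a| ^+ 2 by rewrite lerXn2r ?nnegrE// ltW.
rewrite ler_pdivlMr; last by rewrite ltr_pwDl// sqr_ge0.
rewrite ler_pdivrMl ?exprn_gt0//.
have h1 : 1 <= `|x - a| ^+ 2 * (r ^+ 2)^-1 by rewrite ler_pdivlMr ?exprn_gt0// mul1r.
have h2 : `|x - a| ^+ 2 = (x - a) ^+ 2 by rewrite -normrX ger0_norm// sqr_ge0.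
have -> : `|x - a| ^+ 2 * (2 * (1 + a ^+ 2) * (1 + (r ^+ 2)^-1)) =
    2 * (1 + a ^+ 2) * (`|x - a| ^+ 2 + `|x - a| ^+ 2 * (r ^+ 2)^-1) by ring.
apply: (@le_trans _ _ (2 * (1 + a ^+ 2) * (`|x - a| ^+ 2 + 1))).
  rewrite h2; have := sqr_ge0 (x - 2 * a); have := sqr_ge0 (a * (x - a)).
  by rewrite !expr2; lra.
by rewrite ler_wpM2l ?mulr_ge0 ?addr_ge0 ?sqr_ge0// lerD2l.
Qed.

(** Of the [n + 1] factors [2 / |x - a|], two are spent on integrability at infinity and [n - 1] are
    kept as smallness. *)
Lemma line_test_far t x r : 0 <= t -> (0 < n)%N -> 0 < r -> r <= `|x - a| ->
  nc (q t x) <= (2 / r) ^+ n.-1 * (16 * (1 + a ^+ 2) * (1 + (r ^+ 2)^-1)) * (1 + x ^+ 2)^-1.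
Proof.
move=> t0 n0 r0 rx; have y0 : 0 < `|x - a| by exact: lt_le_trans rx.
have xa : x != a by rewrite -subr_eq0 -normr_gt0.
apply: (le_trans (line_test_le n alpha01 L1 t0 xa)).
have -> : 2 * (2 / `|x - a|) ^+ n.+1 = (2 / `|x - a|) ^+ n.-1 * (8 * (`|x - a| ^+ 2)^-1).
  rewrite -{1}(prednK n0) !exprS; field; exact: lt0r_neq0.
rewrite -[leRHS]mulrA ler_pM ?exprn_ge0 ?divr_ge0 ?mulr_ge0 ?invr_ge0 ?exprn_ge0//.
  by rewrite lerXn2r ?nnegrE ?divr_ge0 ?(ltW r0)// ler_pM2l// lef_pV2.
by have := oneDsqr_shift r0 rx; lra.
Qed.

(** The far bound with radius 1 and, near [a], the crude bound, where 1 + x^2 <= 4 (1 + a^2). *)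
Lemma line_test_decay : (0 < n)%N -> exists2 C : R, 0 <= C &
  forall t x, 0 <= t -> nc (q t x) <= C * (1 + x ^+ 2)^-1.
Proof.
move=> n0; pose C1 := (2 / 1) ^+ n.-1 * (16 * (1 + a ^+ 2) * (1 + (1 ^+ 2)^-1)) : R.
pose C2 := 2 * (L ^+ n * L) * (4 * (1 + a ^+ 2)).
have a0 := sqr_ge0 a.
have C10 : 0 <= C1 by rewrite mulr_ge0 ?exprn_ge0 ?divr_ge0// expr1n invr1; lra.
have Ln0 : 0 <= 2 * (L ^+ n * L) by rewrite !mulr_ge0 ?exprn_ge0 ?(ltW L0).
have C20 : 0 <= C2 by rewrite mulr_ge0//; lra.
exists (C1 + C2); first exact: addr_ge0.
move=> t x t0; have k0 : 0 < 1 + x ^+ 2 by rewrite ltr_pwDl// sqr_ge0.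
have kV : 0 <= (1 + x ^+ 2)^-1 by rewrite invr_ge0 ltW.
have [h|h] := leP 1 `|x - a|.
  apply: (le_trans (line_test_far t0 n0 ltr01 h)).
  by rewrite -/C1 ler_wpM2r// lerDl.
apply: (le_trans (line_test_crude alpha a n L1 x t0)).
apply: (@le_trans _ _ (C2 * (1 + x ^+ 2)^-1)); last by rewrite ler_wpM2r// lerDr.
rewrite -[leRHS]mulrA ler_peMr//.
rewrite ler_pdivlMr// mul1r.
have : (x - a) ^+ 2 <= 1.
  by rewrite -(ger0_norm (sqr_ge0 (x - a))) normrX exprn_ile1// ltW.
have := sqr_ge0 (x - 2 * a); rewrite !expr2; lra.
Qed.

Lemma line_test_L2 : (0 < n)%N -> exists C : R, forall t, 0 <= t ->
  L2 leb setT (q t) /\ n2 leb setT (q t) <= C.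
Proof.
move=> n0; have [C C0 hC] := line_test_decay n0.
exists (C * Num.sqrt pi) => t t0.
have mq := line_test_Cmeasurable alpha a n L1 setT t0.
have mk2 : measurable_fun setT (fun x : RR => (((1 + x ^+ 2)^-1 : R) ^+ 2)%:E).
  apply/measurable_EFinP; apply: measurable_funX; apply: continuous_measurable_fun => x.
  apply: cvgV; first by rewrite gt_eqF// ltr_pwDl// sqr_ge0.
  by apply: cvgD; [exact: cvg_cst|apply: exprn_continuous].
have sq : (L2sq leb setT (q t) <= ((C * Num.sqrt pi) ^+ 2)%:E)%E.
  apply: (@le_trans _ _ (\int[leb]_x ((C ^+ 2)%:E * (((1 + x ^+ 2)^-1 : R) ^+ 2)%:E))%E).
    apply: ge0_le_integral => //.
    - by move=> x _; rewrite lee_fin sqr_ge0.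
    - by apply/measurable_EFinP; exact: measurable_normc_sqr.
    - by apply: measurable_funeM; exact: mk2.
    - move=> x _; rewrite -EFinM lee_fin -exprMn lerXn2r ?nnegrE ?normc_ge0 ?hC//.
      by rewrite mulr_ge0// invr_ge0 addr_ge0// sqr_ge0.
    rewrite ge0_integralZl_EFin//; last exact: sqr_ge0.
    rewrite exprMn sqr_sqrtr ?pi_ge0// (EFinM (C ^+ 2) pi).
    apply: lee_wpmul2l; first by rewrite lee_fin sqr_ge0.
    exact: integral_oneDsqrV_sq.
  by move=> x _; rewrite lee_fin sqr_ge0.
have qL : L2 leb setT (q t) by apply/L2_sqP; split => //; exact: le_lt_trans sq (ltry _).
by split => //; apply: n2_le => //; rewrite mulr_ge0// sqrtr_ge0.
Qed.

Lemma n2_bounded_le (M : R -> R[i]) b : Cmeasurable I M -> 0 <= b ->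
  (forall x, I x -> nc (M x) <= b) -> L2 leb I M /\ n2 leb I M <= b * L.
Proof.
move=> mM b0 hM; have ML : L2 leb I M by exact: L2_bounded hM.
split => //; apply: n2_le => //; first by rewrite mulr_ge0// ltW.
apply: (@le_trans _ _ (\int[leb]_(x in I) (b ^+ 2)%:E)%E).
  apply: ge0_le_integral => //.
  - by move=> x _; rewrite lee_fin sqr_ge0.
  - by apply/measurable_EFinP; exact: measurable_normc_sqr.
  - by move=> x Ix; rewrite lee_fin lerXn2r ?nnegrE ?normc_ge0 ?hM.
rewrite (integral_cst leb mI) [X in (_ * X)%E](_ : _ = (L - 1)%:E)%E//.
rewrite -EFinM lee_fin exprMn ler_wpM2l ?sqr_ge0// expr2.
have := L1; nra.
Qed.

(** Expansions of [P], whose derivative is [- Q]. The frequencies lie in a bounded band, so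
    multiplication by [la] is bounded and the remainders are uniform in [s]. *)
Lemma n2_decay_pairing (F k0 : R -> R[i]) (la : R -> R) (b s h : R) :
  L2 leb I F -> Cmeasurable I k0 -> measurable_fun I la -> 0 <= b -> 0 <= s -> 0 <= h ->
  (forall x, I x -> nc (k0 x) <= b) -> (forall x, I x -> 0 <= la x <= L) ->
  let P u := Cintegral leb I (fun x => F x * ((expR (- u * la x))%:C * k0 x)) in
  let Q u := Cintegral leb I (fun x => F x * ((la x)%:C * ((expR (- u * la x))%:C * k0 x))) in
  nc (P s - P (s + h) - h%:C * Q (s + h)) <= 2 * n2 leb I F * (L ^+ 2 * b * L) * h ^+ 2 /\
  nc (Q s - Q (s + h)) <= 2 * n2 leb I F * (L ^+ 2 * b * L) * h.
Proof.
move=> FL mk mla b0 s0 h0 kb la_le P Q.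
have sh0 : 0 <= s + h by exact: addr_ge0.
have N0 := n2_ge0 leb I F.
pose w u x : R := expR (- u * la x).
have mr (f : R -> R) : measurable_fun I f -> Cmeasurable I (fun x => (f x)%:C).
  by move=> mf; split => //=; exact: measurable_cst.
have mw u : measurable_fun I (w u).
  apply: (measurableT_comp (continuous_measurable_fun (@continuous_expR R))).
  by apply: measurable_funM => //; exact: measurable_cst.
have w01 u x : 0 <= u -> I x -> 0 <= w u x <= 1.
  move=> u0 Ix; rewrite expR_ge0/= -expR0 ler_expR mulNr oppr_le0 mulr_ge0//.
  by case/andP: (la_le _ Ix).
have wkL u : 0 <= u -> L2 leb I (fun x => (w u x)%:C * k0 x) /\
    L2 leb I (fun x => (la x)%:C * ((w u x)%:C * k0 x)).
  move=> u0.
  have wk x : I x -> nc ((w u x)%:C * k0 x) <= b.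
    move=> Ix; rewrite /nc Normc.normcM normc_real; have /andP[w0 w1] := w01 u x u0 Ix.
    by rewrite ger0_norm// -[leRHS]mul1r ler_pM ?normc_ge0 ?kb.
  have mwk : Cmeasurable I (fun x => (w u x)%:C * k0 x) by apply: CmeasurableM => //; exact: mr.
  split; first exact: (@L2_bounded _ _ b).
  apply: (@L2_bounded _ _ (L * b)) => //; first by apply: CmeasurableM => //; exact: mr.
  move=> x Ix; rewrite /nc Normc.normcM normc_real; have /andP[l0 lL] := la_le x Ix.
  by rewrite ger0_norm// ler_pM ?normc_ge0 ?wk.
have iP u : 0 <= u -> Cintegrable leb I (fun x => F x * ((w u x)%:C * k0 x)).
  by move=> u0; apply: Cintegrable_mul => //; have [] := wkL u u0.
have iQ u : 0 <= u -> Cintegrable leb I (fun x => F x * ((la x)%:C * ((w u x)%:C * k0 x))).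
  by move=> u0; apply: Cintegrable_mul => //; have [] := wkL u u0.
have bound (v : R -> R) c : measurable_fun I v -> 0 <= c -> (forall x, I x -> `|v x| <= c) ->
    nc (Cintegral leb I (fun x => F x * ((v x)%:C * k0 x))) <= 2 * n2 leb I F * (c * b * L).
  move=> mv c0 vc.
  have [ML Mle] : L2 leb I (fun x => (v x)%:C * k0 x) /\
      n2 leb I (fun x => (v x)%:C * k0 x) <= c * b * L.
    apply: n2_bounded_le; [by apply: CmeasurableM => //; exact: mr|exact: mulr_ge0|].
    by move=> x Ix; rewrite /nc Normc.normcM normc_real ler_pM ?normr_ge0 ?normc_ge0 ?kb ?vc.
  by apply: (le_trans (normc_pairing_le mI FL ML)); rewrite ler_wpM2l// mulr_ge0.
split.
  pose v x : R := w s x - w (s + h) x - h * la x * w (s + h) x.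
  have -> : P s - P (s + h) - h%:C * Q (s + h) =
      Cintegral leb I (fun x => F x * ((v x)%:C * k0 x)).
    rewrite /P /Q -(CintegralZ mI); last exact: iQ.
    rewrite -(CintegralB mI); [|exact: iP|exact: iP].
    have i1 : Cintegrable leb I (fun x => F x * ((w s x)%:C * k0 x) -
        F x * ((w (s + h) x)%:C * k0 x)).
      have := CintegrableD mI (iP s s0) (CintegrableZ mI (-1) (iP _ sh0)).
      by congr Cintegrable; apply/funext => x; rewrite mulN1r.
    rewrite -(CintegralB mI); [|exact: i1|by apply: (CintegrableZ mI); exact: iQ].
    by apply: eq_Cintegral => x _; rewrite /v !rmorphB !rmorphM /=; ring.
  apply: (le_trans (bound v (L ^+ 2 * h ^+ 2) _ _ _)).
  - apply: measurable_funB; first exact: measurable_funB.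
    by apply: measurable_funM => //; apply: measurable_funM => //; exact: measurable_cst.
  - by rewrite mulr_ge0 ?sqr_ge0.
  - move=> x Ix; have /andP[l0 lL] := la_le _ Ix.
    apply: (le_trans (expR_decay2 l0 s0 h0)).
    by rewrite ler_wpM2r ?sqr_ge0// lerXn2r ?nnegrE// ltW.
  - by rewrite le_eqVlt; apply/orP; left; apply/eqP; ring.
pose v x : R := la x * (w s x - w (s + h) x).
have -> : Q s - Q (s + h) = Cintegral leb I (fun x => F x * ((v x)%:C * k0 x)).
  rewrite /Q -(CintegralB mI); [|exact: iQ|exact: iQ].
  by apply: eq_Cintegral => x _; rewrite /v rmorphM rmorphB /=; ring.
apply: (le_trans (bound v (L * (h * L)) _ _ _)).
- by apply: measurable_funM => //; exact: measurable_funB.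
- by rewrite !mulr_ge0// ltW.
- move=> x Ix; have /andP[l0 lL] := la_le _ Ix.
  rewrite normrM ger0_norm// ler_pM ?normr_ge0//.
  by apply: (le_trans (expR_decay1 l0 s0 h0)); rewrite ler_wpM2l.
- by rewrite le_eqVlt; apply/orP; left; apply/eqP; ring.
Qed.

Context (S : R -> (R -> R[i]) -> R -> R[i]).
Hypothesis HS : semigroup_generated_by setT (minus_frac_laplacian line alpha) S.

(** By the multiplication formula, pairing with [q s] is an integral over the frequency band
    [[1, L]], where the generator acts as multiplication by minus x^alpha, a bounded function
    there. *)
Lemma line_test_duality t f : 0 <= t -> (0 < n)%N -> L2 leb setT f ->
  Cintegral leb setT (fun x => S t f x * q 0 x) = Cintegral leb setT (fun x => f x * q t x).
Proof.
move=> t0 n0; have [C hC] := line_test_L2 n0.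
have Cint s f' : 0 <= s -> L2 leb setT f' -> Cintegrable leb setT (fun x => f' x * q s x).
  by move=> s0 f'L; apply: (Cintegrable_mul measurableT) => //; have [] := hC s s0.
move: f; apply: (@c0_duality R setT measurableT S (proj1 HS)
  (fun s f => Cintegral leb setT (fun x => f x * q s x)) t (2 * C) t0).
- move=> s f1 f2 /andP[s0 _] h1 h2.
  rewrite -(CintegralB measurableT); [|exact: Cint|exact: Cint].
  by apply: eq_Cintegral => x _; rewrite mulrBl.
- move=> s z f1 /andP[s0 _] h1.
  rewrite -(CintegralZ measurableT); last exact: Cint.
  by apply: eq_Cintegral => x _; rewrite mulrA.
- move=> s f1 /andP[s0 _] h1; have [qL qC] := hC s s0.
  rewrite (le_trans (normc_pairing_le measurableT h1 qL))//.
  by rewrite mulrAC ler_wpM2r ?n2_ge0// ler_wpM2l.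
move=> f g hfg; have [F [G [hF hG FG]]] := (proj2 HS f g).1 hfg.
have K_le s xi : 0 <= s -> I xi -> nc (K s xi) <= L ^+ n.
  by move=> s0 /II; exact: line_kernel_le.
have mK s := line_kernel_measurable alpha a L n s.
have Ln0 : 0 <= L ^+ n by rewrite exprn_ge0// ltW.
pose P s F := Cintegral leb I (fun xi => F xi * K s xi).
have ellE s f' F' : 0 <= s -> is_fourier f' F' ->
    Cintegral leb setT (fun x => f' x * q s x) = P s F'.
  move=> s0 hf'; apply: (@fourier_duality _ I (L ^+ n) (K s)) => //.
  - exact: mK.
  - by move=> xi; exact: K_le.
  - by have [] := hC s s0.
have [fL FL _] := hF; have [gNL GL _] := hG; have [_ gL _] := hfg.
have FI := (L2_sub mI measurableT (@subsetT _ I) FL).1.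
have GI := (L2_sub mI measurableT (@subsetT _ I) GL).1.
(* [G] is the transform of [- g], hence the sign. *)
have ellg s : 0 <= s -> Cintegral leb setT (fun x => g x * q s x) = - P s G.
  move=> s0; rewrite -(ellE _ _ _ s0 hG) -mulN1r -(CintegralZ measurableT); last first.
    exact: Cint.
  by apply: eq_Cintegral => x _; rewrite mulN1r mulNr opprK.
pose la xi : R := xi `^ alpha.
have la_le xi : I xi -> 0 <= la xi <= L.
  move=> /II /andP[x1 xL]; rewrite powR_ge0/=.
  have x0 : 0 <= xi by exact: le_trans x1.
  apply: (@le_trans _ _ (L `^ alpha)).
    by apply: ge0_ler_powR; rewrite ?nnegrE ?(ltW L0)//; case/andP: alpha01.
  by rewrite -[leRHS](powRr1 (ltW L0)) ler_powR ?(ltW L1)//; case/andP: alpha01.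
have mla : measurable_fun I la by apply: measurable_funTS; exact: measurable_powR.
have Kw s xi : K s xi = (expR (- s * la xi))%:C * K 0 xi.
  by rewrite /K /line_weight oppr0 mul0r expR0 mulr1 !rmorphM /=; ring.
have PF s : P s F = Cintegral leb I (fun x => F x * ((expR (- s * la x))%:C * K 0 x)).
  by apply: eq_Cintegral => xi _; rewrite Kw.
have PG s : P s G = Cintegral leb I (fun x => F x * ((la x)%:C * ((expR (- s * la x))%:C * K 0 x))).
  apply: ae_eq_Cintegral => //.
  - by apply: CmeasurableM; [case: GI|exact: mK].
  - apply: CmeasurableM; first by case: FI.
    have -> : (fun x : RR => (la x)%:C * ((expR (- s * la x))%:C * K 0 x)) =
        (fun x => (la x)%:C * K s x) by apply/funext => x; rewrite [in RHS]Kw.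
    apply: CmeasurableM; last exact: mK.
    by split => //=; exact: measurable_cst.
  - apply: filterS FG => x FG Ix; have := II Ix => /andP[x1 _].
    rewrite (FG Logic.I) ger0_norm ?(le_trans ler01)// -/(la x) -Kw.
    by rewrite mulrA [_ * F x]mulrC.
exists (2 * n2 leb I F * (L ^+ 2 * L ^+ n * L)) => s h s0 h0 _.
have sh0 : 0 <= s + h by exact: addr_ge0.
have [] := @n2_decay_pairing F (K 0) la _ _ _ FI (mK 0) mla Ln0 s0 h0 (fun xi => K_le 0 xi (lexx 0)) la_le.
move=> h1 h2; split.
  rewrite (_ : _ - _ + _ = P s F - P (s + h) F + h%:C * - P (s + h) G); last first.
    by congr (_ - _ + _ * _); [exact: ellE|exact: ellE|exact: ellg].
  by rewrite !PF !PG mulrN; exact: h1.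
rewrite (_ : _ - _ = - P s G - - P (s + h) G); last first.
  by congr (_ - _); exact: ellg.
by rewrite opprK addrC /nc -normcN opprB !PG; exact: h2.
Qed.

End LineDuality.

(** * Comparison of growth rates *)

Section Growth.
Context {R : realType}.

(** This is where [alpha < 1] is decisive: the threshold z solves A z^alpha = z. *)
Lemma sublinear_powR (alpha T c : R) : 0 <= alpha < 1 -> 0 <= T -> 0 <= c ->
  exists z : R, forall x, 0 < x -> z <= x -> T * (c * x) `^ alpha <= x.
Proof.
move=> /andP[a0 a1] T0 c0; pose A := T * c `^ alpha.
have A0 : 0 <= A by rewrite mulr_ge0// powR_ge0.
have b0 : 0 < 1 - alpha by rewrite subr_gt0.
exists (A `^ (1 - alpha)^-1) => x x0 Ax.
rewrite powRM ?(ltW x0)// mulrA -/A.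
have e : x = x `^ (1 - alpha) * x `^ alpha.
  rewrite -powRD; last by rewrite (gt_eqF x0) implybT.
  by rewrite subrK powRr1// ltW.
rewrite [leRHS]e ler_wpM2r ?powR_ge0//.
have -> : A = (A `^ (1 - alpha)^-1) `^ (1 - alpha).
  by rewrite -powRrM mulVf ?gt_eqF// powRr1.
by apply: ge0_ler_powR; rewrite ?nnegrE ?powR_ge0// ltW.
Qed.

(** Each of the three factors is at most [expR n%:R]: the first two because [A < n%:R] and n <= e^n,
    the exponential by sublinearity of its exponent. *)
Lemma exp_dominates (alpha T c A : R) n0 : 0 <= alpha < 1 -> 0 <= T -> 0 <= c ->
  exists2 n, (n0 < n)%N & A * n%:R * expR (T * (c * n%:R) `^ alpha) < expR 3 ^+ n.
Proof.
move=> a01 T0 c0; have [z hz] := sublinear_powR a01 T0 c0.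
pose n := (n0 + Num.truncn `|z| + Num.truncn `|A|).+1.
exists n; first by rewrite ltnS -addnA leq_addr.
have n1 : (0 : R) < n%:R by rewrite ltr0n.
have zn : z <= n%:R.
  rewrite (le_trans (ler_norm z))// (le_trans (ltW (truncnS_gt _)))// ler_nat.
  by rewrite ltnS addnAC leq_addl.
have An : A < n%:R.
  rewrite (le_lt_trans (ler_norm A))// (lt_le_trans (truncnS_gt _))// ler_nat.
  by rewrite ltnS leq_addl.
have e0 := expR_gt0 (T * (c * n%:R) `^ alpha).
have ne : n%:R <= expR n%:R :> R.
  by apply: le_trans (expR_ge1Dx _); rewrite lerDr.
have -> : expR 3 ^+ n = expR n%:R * expR n%:R * expR n%:R :> R.
  by rewrite -expRM_natl -!expRD; congr expR; ring.
apply: (@lt_le_trans _ _ (n%:R * n%:R * expR (T * (c * n%:R) `^ alpha))).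
  by rewrite ltr_pM2r// ltr_pM2r.
have h := hz _ n1 zn.
apply: ler_pM; [by rewrite mulr_ge0 ?ltW|exact: ltW| |by rewrite ler_expR].
by apply: ler_pM => //; exact: ltW.
Qed.

Lemma factorial_le_exp n : (n`! <= n ^ n)%N.
Proof.
elim: n => // n IH; rewrite factS expnS leq_mul2l /=.
by apply: (leq_trans IH); case: n {IH} => // n; rewrite leq_exp2r.
Qed.

(** The falling factorial of [m + n] has [n] factors, each at least [m], and n! <= n^n. *)
Lemma bin_ge_expn m n : (m ^ n <= 'C(m + n, n) * n ^ n)%N.
Proof.
apply: (@leq_trans ('C(m + n, n) * n`!)%N); last by rewrite leq_mul2l factorial_le_exp orbT.
rewrite bin_ffact.
elim: n => [|n IH]; first by rewrite expn0 ffactn0.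
by rewrite expnS addnS ffactnS /= leq_mul// -addnS leq_addr.
Qed.

(** Factor by factor: 2 m - k <= 3 (m - k) as soon as 2 k <= m. *)
Lemma bin_double_le m n : (2 * n <= m)%N -> ('C(2 * m, n.+1) <= 3 ^ n.+1 * 'C(m, n.+1))%N.
Proof.
move=> nm; rewrite -(leq_pmul2r (fact_gt0 n.+1)) -mulnA !bin_ffact.
have h k : (2 * k <= m.+2)%N -> ((2 * m) ^_ k <= 3 ^ k * m ^_ k)%N.
  elim: k => [|k IH] km; first by rewrite !ffactn0.
  rewrite !ffactnSr expnSr mulnACA leq_mul//; first by apply: IH; lia.
  lia.
by apply: h; lia.
Qed.

End Growth.

(** * Lower bound for the pairing on the line *)

Section LinePairing.
Context {R : realType}.
Notation leb := (@lebesgue_measure R).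
Notation RR := (measurableTypeR R).
Let nc := @Normc.normc R.

Lemma Cintegral_indic_setT (D : set RR) (a b : R) (g : R -> R[i]) :
  (forall x, a <= x <= b -> D x) ->
  Cintegral leb setT (fun x => (\1_(`[a, b]%classic) x)%:C * g x) =
  Cintegral leb D (fun x => (\1_(`[a, b]%classic) x)%:C * g x).
Proof.
move=> ID; have e x : ~ D x -> (\1_(`[a, b]%classic) x)%:C * g x = 0.
  move=> nDx; rewrite indicE memNset ?rmorph0 ?mul0r//= in_itv/= => h.
  by apply: nDx; exact: ID.
rewrite /Cintegral; congr (_ +i* _); rewrite [RHS]Rintegral_mkcond;
  apply: eq_Rintegral => x _; rewrite patchE; case: ifPn => // /negP xD;
  rewrite e//; apply: contra_not xD; exact: mem_set.
Qed.

Lemma continuous_oneBcos (b x : R) : {for x, continuous (fun x : R => 1 - cos (x * b))}.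
Proof.
apply: cvgB; first exact: cvg_cst.
have := @continuous_cos_phase _ b 0 x.
by rewrite (_ : (fun x : R => cos (x * b + 0)) = (fun x => cos (x * b)))//;
  apply/funext => y; rewrite addr0.
Qed.

(** The window is one period long, so the zeros of the integrand do no harm wherever the window
    starts. *)
Lemma Rintegral_oneBcos (X b : R) : 0 < b ->
  Rintegral leb `[X, X + 2 * pi / b]%classic (fun x => 1 - cos (x * b)) = 2 * pi / b.
Proof.
move=> b0; have b1 : b != 0 by rewrite gt_eqF.
have XX : X < X + 2 * pi / b by rewrite ltrDl divr_gt0// mulr_gt0// pi_gt0.
have dF (x : R) : is_derive x 1 (fun x => x - sin (x * b + 0) / b) (1 - cos (x * b)).
  have h := is_derive_sin_phase 0 x b1; rewrite addr0 in h.
  rewrite (_ : (fun x => _) = id - (fun x => sin (x * b + 0) / b))//.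
  exact: is_deriveB.
rewrite (Rintegral_FTC XX (fun x _ => dF x) (fun x _ => @continuous_oneBcos b x)) !addr0.
have -> : (X + 2 * pi / b) * b = X * b + pi *+ 2 by field.
by rewrite sinD2pi; ring.
Qed.

Lemma fourier_truncated_indic (a b xi : R) N : 0 < b -> 0 < xi ->
  (forall x, a <= x <= a + b -> - N%:R <= x <= N%:R) ->
  complex.Im (fourier_truncated N (fun x => (\1_(`[a, a + b]%classic) x)%:C) xi * cis (xi * a)) =
  - ((1 - cos (xi * b)) / xi).
Proof.
move=> b0 xi0 ID; have mD : @measurable _ RR `[- N%:R, N%:R]%classic by exact: measurable_itv.
pose D : set RR := `[- N%:R, N%:R]%classic.
have lD : (leb D < +oo)%E by exact: lebesgue_itvcc_lty.
rewrite mulrC /fourier_truncated -(CintegralZ mD); last first.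
  apply: (Cintegrable_mul mD); first exact: L2_indic.
  apply: (@L2_bounded _ _ 1) => //; last by move=> t _; rewrite normc_cis.
  exact: Cmeasurable_cisNM.
rewrite -mulNr -(@indic_mode_Im _ D a b xi mD b0 xi0); last first.
  by move=> x /ID; rewrite /D /= in_itv.
congr (complex.Im _); apply: eq_Cintegral => x _.
by rewrite mulrCA -cisD; congr (_ * cis _); ring.
Qed.

Lemma le_Rintegral_subset (A B : set RR) (f : R -> R) : measurable A -> measurable B ->
  A `<=` B -> leb.-integrable B (EFin \o f) -> (forall x, B x -> 0 <= f x) ->
  Rintegral leb A f <= Rintegral leb B f.
Proof.
move=> mA mB AB fB f0; have fA := integrableS mB mA AB fB.
apply: fine_le; [exact: integrable_fin_num|exact: integrable_fin_num|].
by apply: ge0_subset_integral => //; exact: measurable_int fB.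
Qed.

(** On the frequency side the imaginary part is minus the integral of a nonnegative function, which
    is then restricted to one period starting at [X], with 1/x >= 1/L. *)
Lemma line_test_pairing_ge (alpha a b L X k0 t : R) n : 0 <= t -> 0 < b -> 1 <= X ->
  X + 2 * pi / b <= L -> 0 <= k0 ->
  (forall x, X <= x <= X + 2 * pi / b -> k0 <= line_weight alpha L n t x) ->
  k0 / L * (2 * pi / b) <=
  nc (Cintegral leb setT (fun x => (\1_(`[a, a + b]%classic) x)%:C * line_test alpha a L n t x)).
Proof.
move=> t0 b0 X1 XL k00 kw.
have P0 : 0 < 2 * pi / b by rewrite divr_gt0// mulr_gt0// pi_gt0.
have L1 : 1 < L by rewrite (lt_le_trans _ XL)// ltr_pwDr.
have L0 : 0 < L by exact: lt_trans L1.
(* [[-N, N]] contains [[a, a + b]], so truncation leaves the Fourier integral of the indicator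
   unchanged. *)
pose N := (Num.truncn (`|a| + b)).+1.
have hN x : a <= x <= a + b -> - N%:R <= x <= N%:R.
  move=> /andP[ax xb]; have := truncnS_gt (`|a| + b); rewrite -/N => hN.
  have := ler_norm a; have := lerNnormlW (lexx `|a|); lra.
pose I : set RR := `[1, L]%classic.
have mI : measurable I by exact: measurable_itv.
have lI : (leb I < +oo)%E by exact: lebesgue_itvcc_lty.
have II x : I x -> 1 <= x <= L by rewrite /I /= in_itv.
rewrite (@Cintegral_indic_setT `[- N%:R, N%:R]%classic); last first.
  by move=> x /hN; rewrite /= in_itv.
have fL : L2 leb setT (fun x => (\1_(`[a, a + b]%classic) x)%:C : R[i]) by exact: L2_indic.
have mK := line_kernel_measurable alpha a L n t.
have := fourier_truncated_pairing N mI lI mK (fun x Ix => line_kernel_le alpha a n L1 t0 (II x Ix)) fL.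
rewrite -/(line_test alpha a L n t) => <-.
apply: le_trans (normc_Im _); rewrite /Cintegral.
pose g x := line_weight alpha L n t x * ((1 - cos (x * b)) / x).
have cg x : 1 <= x <= L -> {for x, continuous g}.
  move=> hx; have x0 : 0 < x by case/andP: hx => h _; exact: lt_le_trans h.
  apply: cvgM; first exact: line_weight_continuous.
  apply: cvgM; last by apply: cvgV; [rewrite gt_eqF|exact: cvg_id].
  exact: continuous_oneBcos.
have ig : leb.-integrable I (EFin \o g) := continuous_itv_integrable cg.
have g0 x : I x -> 0 <= g x.
  move=> Ix; rewrite mulr_ge0 ?(line_weight_ge0 _ _ L1 _ (II x Ix))//.
  have /andP[x1 _] := II x Ix.
  by rewrite divr_ge0 ?subr_ge0 ?cos_le1// (le_trans ler01).
rewrite (_ : complex.Im _ = - Rintegral leb I g); last first.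
  transitivity (Rintegral leb I (fun x => (-1) * g x)); last by rewrite RintegralZl// mulN1r.
  apply: eq_Rintegral => x; rewrite inE => /II hx.
  have x0 : 0 < x by case/andP: hx => h _; exact: lt_le_trans h.
  rewrite mulrCA cImM (fourier_truncated_indic b0 x0 hN) /= mul0r addr0 /g mulN1r mulrN.
  by [].
rewrite normrN ger0_norm; last by rewrite Rintegral_ge0.
pose J : set RR := `[X, X + 2 * pi / b]%classic.
have mJ : measurable J by exact: measurable_itv.
have JI : J `<=` I.
  move=> x; rewrite /J /I /= !in_itv /= => /andP[h1 h2].
  by rewrite (le_trans X1)// (le_trans h2).
apply: le_trans (le_Rintegral_subset mJ mI JI ig g0).
rewrite -(Rintegral_oneBcos X b0) -RintegralZl//; last first.
  by apply: continuous_itv_integrable => x _; exact: continuous_oneBcos.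
apply: le_Rintegral => //.
- by apply: continuous_itv_integrable => x _; apply: cvgM; [exact: cvg_cst|exact: continuous_oneBcos].
- exact: integrableS ig.
move=> x Jx; have /II hx := JI x Jx.
have /andP[x1 xL] := hx; have x0 : 0 < x by exact: lt_le_trans x1.
rewrite /g -mulrA ler_pM ?mulr_ge0 ?invr_ge0 ?(ltW L0) ?subr_ge0 ?cos_le1//.
  by apply: kw; move: Jx; rewrite /J /= in_itv.
by rewrite mulrC ler_wpM2l ?subr_ge0 ?cos_le1// lef_pV2.
Qed.

End LinePairing.

(** * Conclusion on the line *)

Section LineFinal.
Context {R : realType}.
Notation leb := (@lebesgue_measure R).
Notation RR := (measurableTypeR R).
Let nc := @Normc.normc R.

(** The monomial is at least (K - 1)^n because x - 1 >= (K - 1) n and n! <= n^n; the cut-off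
    frequency 4 K n is at least twice [x], so each factor of the cut-off is at least 1/2. *)
Lemma line_weight_ge (alpha T K x : R) n : 0 <= alpha -> 0 <= T -> 1 < K -> (0 < n)%N ->
  K * n%:R <= x <= 2 * (K * n%:R) ->
  (K - 1) ^+ n * (2^-1) ^+ n.+3 * expR (- (T * (2 * K * n%:R) `^ alpha)) <=
  line_weight alpha (4 * (K * n%:R)) n T x.
Proof.
move=> a0 T0 K1 n0 /andP[Kx xK].
have n1 : (1 : R) <= n%:R by rewrite ler1n.
have X1 : 1 < K * n%:R by nra.
have K0 : 0 <= K - 1 by lra.
have h20 : 0 <= 2^-1 :> R by rewrite invr_ge0.
rewrite /line_weight [leRHS]mulrA; apply: ler_pM; last 2 first.
- apply: ler_pM; [exact: exprn_ge0|exact: exprn_ge0| |].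
  + rewrite /shifted_monomial ler_pdivlMr ?ltr0n ?fact_gt0//.
    apply: (@le_trans _ _ ((K - 1) ^+ n * (n%:R ^+ n))).
      by rewrite ler_wpM2l ?exprn_ge0// -natrX ler_nat factorial_le_exp.
    by rewrite -exprMn lerXn2r ?nnegrE ?mulr_ge0//; lra.
  + rewrite lerXn2r ?nnegrE ?invr_ge0//.
      by rewrite subr_ge0 ler_pdivrMr; lra.
    rewrite lerBrDl -lerBrDr ler_pdivrMr; lra.
- rewrite ler_expR mulNr lerN2 ler_wpM2l// ge0_ler_powR ?nnegrE//; nra.
- by rewrite mulr_ge0 ?exprn_ge0.
- exact: expR_ge0.
Qed.

Lemma line_not_null_controllable (alpha T : R) (omega : set R)
    (S : R -> (R -> R[i]) -> R -> R[i]) : 0 <= alpha < 1 ->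
  interior (~` omega) !=set0 -> measurable (omega : set RR) ->
  semigroup_generated_by setT (minus_frac_laplacian line alpha) S -> 0 < T ->
  ~ null_controllable setT S omega T.
Proof.
move=> a01 [a inta] momega HS T0 nullc.
have a01' : 0 <= alpha <= 1 by case/andP: a01 => -> /ltW.
have [r r0 hr] : exists2 r : R, 0 < r & forall x, omega x -> r <= `|x - a|.
  move: inta => /nbhs_ballP[r /= r0 hr]; exists r => // x ox; rewrite leNgt; apply/negP => xr.
  by apply: (hr x) => //; rewrite /ball /= distrC.
pose kappa (x : R) := (1 + x ^+ 2)^-1.
have mk : measurable_fun (setT : set RR) kappa.
  apply: continuous_measurable_fun => x.
  apply: cvgV; first by rewrite gt_eqF// ltr_pwDl// sqr_ge0.
  by apply: cvgD; [exact: cvg_cst|apply: exprn_continuous].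
have fL : L2 leb setT (fun x => (\1_(`[a, a + 1]%classic) x)%:C : R[i]) by exact: L2_indic.
have [C hC] := control_bound measurableT (proj1 HS) momega (ltW T0) fL (pi_ge0 R) mk
  integral_oneDsqrV_sq (nullc _ fL).
pose C1 := 16 * (1 + a ^+ 2) * (1 + (r ^+ 2)^-1).
(* With this choice ((K - 1) / 2)^n equals (2 / r)^n e^(3n): the lower bound has the exponential
   rate of the upper one and e^(3n) to spare. *)
pose K := 1 + 4 * expR 3 / r.
have K1 : 1 < K by rewrite ltrDl divr_gt0// mulr_gt0// expR_gt0.
have K0 : 0 < K by lra.
have K20 : 0 <= 2 * K by lra.
(* The first argument is the constant left when both bounds are compared. [n > 8] makes the window
   of length 2 pi that starts at K n fit into [K n, 2 K n]. *)
have [n n8 hn] := exp_dominates (`|C| * C1 * (r / 2) * (32 * K) / (2 * pi)) 8 a01 (ltW T0) K20.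
have n0 : (0 < n)%N by exact: leq_trans n8.
have n8' : (8 : R) <= n%:R by rewrite ler_nat ltnW.
pose X := K * n%:R; have X8 : 8 <= X by rewrite /X; nra.
pose L := 4 * X; have L1 : 1 < L by rewrite /L; lra.
have pi4 : pi <= 4 :> R by have := (pihalf_02_cos_pihalf R).1; lra.
have C10 : 0 <= C1.
  by rewrite /C1 !mulr_ge0 ?addr_ge0 ?invr_ge0 ?sqr_ge0.
pose B := (2 / r) ^+ n.-1 * C1.
have B0 : 0 <= B by rewrite mulr_ge0// exprn_ge0// divr_ge0// ltW.
have h1 := hC (line_test alpha a L n) B B0.
have [Cq hq] := line_test_L2 a a01' L1 n0.
have {h1} h1 : nc (Cintegral leb setT (fun x => (\1_(`[a, a + 1]%classic) x)%:C * line_test alpha a L n T x))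
    <= C * B.
  apply: h1.
  - by move=> t /andP[t0 _]; have [] := hq t t0.
  - by move=> t f /andP[t0 _] hf; exact: line_test_duality.
  - move=> t x /andP[t0 _] _ ox; apply: (line_test_far a01' L1 t0 n0 r0); exact: hr.
pose k0 := (K - 1) ^+ n * (2^-1) ^+ n.+3 * expR (- (T * (2 * K * n%:R) `^ alpha)).
have k00 : 0 <= k0.
  rewrite mulr_ge0 ?expR_ge0// mulr_ge0 ?exprn_ge0 ?invr_ge0//; lra.
have h2 : k0 / L * (2 * pi / 1) <= C * B.
  apply: le_trans h1; apply: (@line_test_pairing_ge _ _ _ _ _ X) => //; [exact: ltW|lra| |].
    by rewrite /L; lra.
  move=> x /andP[x1 x2]; apply: line_weight_ge => //; first by case/andP: a01.
    exact: ltW.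
  by rewrite x1/= -/X; lra.
suff : expR 3 ^+ n <= `|C| * C1 * (r / 2) * (32 * K) / (2 * pi) * n%:R *
    expR (T * (2 * K * n%:R) `^ alpha) by rewrite leNgt hn.
pose E := expR (T * (2 * K * n%:R) `^ alpha).
have E0 : 0 < E by exact: expR_gt0.
pose Z := (2 / r) ^+ n.-1; have Z0 : 0 < Z by rewrite exprn_gt0// divr_gt0.
have kE : k0 = 2 / r * Z * expR 3 ^+ n / 8 / E.
  rewrite /k0 expRN -/E /Z -exprS (prednK n0); congr (_ / E).
  have -> : (2^-1 : R) ^+ n.+3 = (2^-1) ^+ n / 8 by rewrite !exprSr; field.
  rewrite mulrA -!exprMn; congr (_ ^+ n / 8).
  by rewrite /K; field; exact: lt0r_neq0.
have pi0 : 0 < pi :> R := pi_gt0 R.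
have nR0 : 0 < n%:R :> R by lra.
(* The inverse of everything in the lower bound except [expR 3 ^+ n]. *)
pose F := r / 2 / Z * (32 * K) * n%:R * E / (2 * pi).
have F0 : 0 <= F.
  rewrite /F; apply: ltW; do ![apply: mulr_gt0 | apply: divr_gt0 | rewrite invr_gt0] => //.
have neq : [/\ r != 0, Z != 0, K != 0, E != 0 & pi != 0 :> R].
  by rewrite !lt0r_neq0.
have [rn Zn Kn En pn] := neq.
have -> : expR 3 ^+ n = k0 / L * (2 * pi / 1) * F.
  rewrite kE /L /X /F; move: (@pi R) pn => p pn.
  by field; rewrite pn Zn (lt0r_neq0 nR0) Kn En rn.
have h3 : k0 / L * (2 * pi / 1) <= `|C| * B.
  by apply: (le_trans h2); rewrite ler_wpM2r// ler_norm.
apply: (le_trans (ler_wpM2r F0 h3)).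
rewrite le_eqVlt; apply/orP; left; apply/eqP; rewrite /B /F -/Z -/E.
move: (@pi R) pn => p pn; by field; rewrite pn Zn.
Qed.

End LineFinal.

(** * Conclusion on the torus *)

Lemma odd_multiple_bounds N K n m : (0 < N)%N -> (0 < K)%N -> (0 < n)%N ->
  m.+1 = (N * (2 * K * n).+1)%N ->
  [/\ (2 * K * n <= m)%N, (m.+1 <= 3 * N * K * n)%N, (2 * n <= m)%N, (n < m)%N & (0 < m)%N].
Proof.
move=> N0 K0 n0 mS; have Kn0 : (0 < K * n)%N by rewrite muln_gt0 K0.
have h1 : (2 * K * n <= m)%N by rewrite -ltnS mS leq_pmull.
have h2 : (n <= K * n)%N by rewrite leq_pmull.
split=> //; [|lia|lia|lia].
rewrite mS [(3 * N)%N]mulnC -!mulnA leq_mul2l; apply/orP; right; lia.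
Qed.

Section TorusFinal.
Context {R : realType}.
Notation leb := (@lebesgue_measure R).
Notation RR := (measurableTypeR R).
Let nc := @Normc.normc R.

Lemma cos_odd_pi k : cos (k.*2.+1%:R * pi : R) = -1.
Proof.
elim: k => [|k IH]; first by rewrite mul1r cospi.
by rewrite doubleS -[k.*2.+3]addn2 natrD mulrDl [2 * pi]mulr_natl cosD2pi.
Qed.

Lemma periodic_shift (omega : set R) (k : int) x :
  (forall x, omega (x + 2 * pi) <-> omega x) -> omega (x + k%:~R * (2 * pi)) <-> omega x.
Proof.
move=> per; have pos (j : nat) y : omega (y + j%:R * (2 * pi)) <-> omega y.
  elim: j y => [|j IH] y; first by rewrite mul0r addr0.
  by rewrite -natr1 mulrDl mul1r addrA per.
case: k => j; first exact: pos.
rewrite NegzE mulrNz mulNr -(pos j.+1 (x - _)).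
by rewrite subrK.
Qed.

(** The squared modulus is 2 - 2 cos y, and on [r, 2 pi - r] the cosine is largest at the end
    points. *)
Lemma normc_1Bcis_ge (r y : R) : 0 < r -> r <= 1 -> r <= y -> y <= 2 * pi - r ->
  Num.sqrt (2 - 2 * cos r) <= nc (1 - cis (- y)).
Proof.
move=> r0 r1 ry yr.
have pi2 := pi_ge2 R.
have le_cos z : r <= z -> z <= pi -> cos z <= cos r.
  move=> rz zp; move: rz; rewrite le_eqVlt => /predU1P[<-//|rz].
  by rewrite ltW// ltr_cos ?in_itv/=; lra.
have cy : cos y <= cos r.
  have [h|h] := leP y pi; first exact: le_cos.
  have -> : cos y = cos (2 * pi - y).
    have -> : 2 * pi - y = - y + pi *+ 2 by rewrite mulr_natl addrC.
    by rewrite cosD2pi cosN.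
  by apply: le_cos; lra.
have sq : nc (1 - cis (- y)) ^+ 2 = 2 - 2 * cos y.
  rewrite /nc normc_sqr cReD cImD cReN cImN /= cosN sinN.
  have := cos2Dsin2 y; rewrite !expr2; lra.
rewrite -[leRHS](@ger0_norm) ?normc_ge0// -sqrtr_sqr sq.
by apply: ler_wsqrtr; lra.
Qed.

Lemma torus_not_null_controllable (alpha T : R) (omega : set R)
    (S : R -> (R -> R[i]) -> R -> R[i]) : 0 <= alpha < 1 ->
  interior (~` omega) !=set0 -> measurable (omega : set RR) ->
  (forall x, omega (x + 2 * pi) <-> omega x) ->
  semigroup_generated_by `[0, 2 * pi[ (minus_frac_laplacian torus alpha) S -> 0 < T ->
  ~ null_controllable `[0, 2 * pi[ S omega T.
Proof.
move=> a01 [x0 intx] momega per HS T0 nullc.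
have a01' : 0 <= alpha <= 1 by case/andP: a01 => -> /ltW.
have pi0 : 0 < pi :> R := pi_gt0 R.
have tp0 : 0 < 2 * pi :> R by rewrite mulr_gt0.
(* The interior point is translated into the fundamental domain. *)
pose k := Num.floor (x0 / (2 * pi)); pose a := x0 + (- k)%:~R * (2 * pi).
have [a0 a2] : 0 <= a /\ a < 2 * pi.
  have := floor_le (x0 / (2 * pi)); have := lt_succ_floor (x0 / (2 * pi)).
  rewrite -/k ler_pdivlMr// ltr_pdivrMr// intrD mulrDl mul1r /a intrN mulNr.
  lra.
(* All translates of [x] are taken into account, since points near 0 and near 2 pi are close on the
   circle. *)
have [r [r0 r1 hr]] : exists r : R, [/\ 0 < r, r <= 1 &
    forall x (j : int), omega x -> r <= `|x + j%:~R * (2 * pi) - a|].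
  move: intx => /nbhs_ballP[r /= r0 hr]; exists (Num.min r 1); split.
  - by rewrite lt_min r0 ltr01.
  - by rewrite ge_min lexx orbT.
  move=> x j ox; rewrite leNgt; apply/negP; rewrite lt_min => /andP[xr _].
  apply: (hr (x + (j + k)%:~R * (2 * pi))); last by rewrite /= periodic_shift.
  rewrite /ball /= distrC; move: xr; congr (`|_| < _).
  by rewrite /a intrD intrN; ring.
pose D : set RR := `[0, 2 * pi[%classic.
have mD : measurable D by exact: measurable_itv.
pose rho := Num.sqrt (2 - 2 * cos r).
have rho0 : 0 < rho.
  rewrite sqrtr_gt0; have pi2 := pi_ge2 R.
  have : cos r < cos 0 by rewrite ltr_cos ?in_itv/=; lra.
  by rewrite cos0; lra.
have far x : D x -> omega x -> rho <= nc (1 - cis (- (x - a))).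
  move=> Dx ox; have /andP[x0' x2] : 0 <= x < 2 * pi by move: Dx; rewrite /D /= in_itv.
  (* Both points lie in the fundamental domain, so the translates by 0 and by one period in either
     direction suffice. *)
  have := hr x 0 ox; have := hr x 1 ox; have := hr x (-1) ox.
  rewrite mul0r addr0 mul1r mulrN1z mulN1r.
  have [ya|ya] := leP a x.
    rewrite [X in _ -> _ -> r <= X -> _]ger0_norm ?subr_ge0//.
    rewrite [X in r <= X -> _]ler0_norm; last lra.
    by move=> h1 _ h2; apply: normc_1Bcis_ge => //; lra.
  rewrite [X in _ -> _ -> r <= X -> _]ltr0_norm ?subr_lt0//.
  rewrite [X in _ -> r <= X -> _]ger0_norm; last lra.
  move=> _ h1 h2.
  have e : cis (- (x + 2 * pi - a)) = cis (- (x - a)).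
    have -> : - (x - a) = - (x + 2 * pi - a) + pi *+ 2 by rewrite -[pi *+ 2]mulr_natl; ring.
    by rewrite /cis cosD2pi sinD2pi.
  by rewrite -[cis _]e; apply: normc_1Bcis_ge => //; lra.
(* [N] is so large that the interval of length [pi / N] starting at [a] stays in the fundamental
   domain. *)
have [N Nn Na] : exists2 N, (0 < N)%N & pi / (2 * pi - a) < N%:R.
  by exists (Num.truncn (pi / (2 * pi - a))).+1 => //; exact: truncnS_gt.
have N0 : 0 < N%:R :> R by rewrite ltr0n.
pose b : R := pi / N%:R.
have b0 : 0 < b by rewrite divr_gt0.
have ab : a + b < 2 * pi.
  move: Na; rewrite ltr_pdivrMr ?subr_gt0// => h.
  by rewrite -ltrBrDl /b ltr_pdivrMr// mulrC.
have fL : L2 leb D (fun x => (\1_(`[a, a + b]%classic) x)%:C : R[i]) by exact: L2_indic.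
have [C hC] : exists C : R, forall (q : R -> R -> R[i]) (B : R), 0 <= B ->
    (forall t, 0 <= t <= T -> L2 leb D (q t)) ->
    (forall t f, 0 <= t <= T -> L2 leb D f ->
       Cintegral leb D (fun x => S t f x * q 0 x) = Cintegral leb D (fun x => f x * q t x)) ->
    (forall t x, 0 <= t <= T -> D x -> omega x -> nc (q t x) <= B) ->
    nc (Cintegral leb D (fun x => (\1_(`[a, a + b]%classic) x)%:C * q T x)) <= C * B.
  (* The domain has finite measure, so the constant weight 1 is square integrable. *)
  have k1 : (\int[leb]_(x in D) ((cst 1 x : R) ^+ 2)%:E <= (2 * pi)%:E)%E.
    under eq_integral do rewrite expr1n.
    rewrite (integral_cst leb mD) mul1e [X in (X <= _)%E](_ : _ = (2 * pi)%:E)%E//.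
    by rewrite /= /D lebesgue_measure_itv/= lte_fin tp0 sube0.
  have [C hC] := control_bound mD (proj1 HS) momega (ltW T0) fL (ltW tp0)
    (measurable_cst (1 : R)) k1 (nullc _ fL).
  exists C => q B B0 qL dual qB; apply: (hC q B B0 qL dual) => t x ht Dx ox.
  by rewrite mulr1 qB.
(* [G] is [2 / rho] from the decay times 3 from doubling the upper index of a binomial coefficient.
   [K] is then such that 'C(m + n, n), at least (2 K)^n, exceeds G^n by e^(3n). *)
pose G : R := 6 / rho; have G0 : 0 < G by rewrite divr_gt0.
have [K K0 KG] : exists2 K, (0 < K)%N & G * expR 3 <= (2 * K)%:R.
  exists (Num.truncn (G * expR 3)).+1 => //.
  apply: (@le_trans _ _ (Num.truncn (G * expR 3)).+1%:R); first exact: ltW (truncnS_gt _).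
  by rewrite ler_nat leq_pmull.
have c0 : 0 <= (3 * N * K)%:R :> R by [].
have [n n1 hn] := exp_dominates (`|C| * G / 2 * (3 * N * K)%:R) 0 a01 (ltW T0) c0.
(* The frequency [m.+1] is an odd multiple of [N], so [m.+1%:R * b] is an odd multiple of [pi] and
   one minus its cosine takes the maximal value 2. *)
have [m mS] : exists m, m.+1 = (N * (2 * K * n).+1)%N.
  by exists (N * (2 * K * n).+1).-1; rewrite prednK// muln_gt0 Nn.
have [m_ge m_le nm nm1 m0] := odd_multiple_bounds Nn K0 n1 mS.
have cosm : cos (m.+1%:R * b) = -1.
  rewrite -(cos_odd_pi (K * n)) mS /b natrM; congr cos.
  rewrite (_ : (2 * K * n).+1 = (K * n).*2.+1)%N; last by rewrite -mul2n mulnA.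
  by field; exact: lt0r_neq0.
(* With the cut-off at [2 * m], its value 'C(m, n+1) at index [m] is at least 3^(-n-1) times its
   value 'C(2 m, n+1) at index 0. *)
pose B : R := (2 / rho) ^+ n.+1 * 'C(2 * m, n.+1)%:R.
have B0 : 0 <= B by rewrite mulr_ge0 ?exprn_ge0 ?divr_ge0// ltW.
have mM : (m < 2 * m)%N by rewrite mul2n -addnn -[ltnLHS]addn0 ltn_add2l.
have h1 := hC (torus_test alpha a n (2 * m)) B B0.
have {h1} h1 : nc (Cintegral leb D (fun x => (\1_(`[a, a + b]%classic) x)%:C *
    torus_test alpha a n (2 * m) T x)) <= C * B.
  apply: h1.
  - by move=> t _; exact: torus_test_L2.
  - by move=> t f /andP[t0 _] hf; exact: torus_test_duality.
  - move=> t x /andP[t0 _] Dx ox; apply: torus_test_le => //; [exact: ltn_trans m0 mM|exact: far].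
have h2 := le_trans (torus_test_pairing_ge alpha n T mM a0 b0 ab) h1.
suff : expR 3 ^+ n <= `|C| * G / 2 * (3 * N * K)%:R * n%:R *
    expR (T * ((3 * N * K)%:R * n%:R) `^ alpha) by rewrite leNgt hn.
pose E := expR (T * m.+1%:R `^ alpha).
have E0 : 0 < E by exact: expR_gt0.
have E_le : E <= expR (T * ((3 * N * K)%:R * n%:R) `^ alpha).
  rewrite ler_expR ler_wpM2l ?(ltW T0)//; apply: ge0_ler_powR; rewrite ?nnegrE//.
    by case/andP: a01.
  by rewrite -natrM ler_nat.
have cm0 : 0 < 'C(m, n.+1)%:R :> R by rewrite ltr0n bin_gt0.
have c2 : 'C(2 * m, n.+1)%:R <= 3 ^+ n.+1 * 'C(m, n.+1)%:R :> R.
  by rewrite -natrX -natrM ler_nat bin_double_le.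
have bn : (G * expR 3) ^+ n <= 'C(m + n, n)%:R :> R.
  apply: (@le_trans _ _ ((2 * K) ^ n)%:R).
    by rewrite natrX lerXn2r ?nnegrE// mulr_ge0 ?expR_ge0 ?(ltW G0).
  rewrite ler_nat -(leq_pmul2r (_ : 0 < n ^ n)%N) ?expn_gt0 ?n1//.
  by rewrite -expnMn (leq_trans _ (bin_ge_expn m n))// leq_exp2r.
have m1 : 0 < m.+1%:R :> R by rewrite ltr0n.
have h3 : (G * expR 3) ^+ n * ('C(m, n.+1)%:R / E) * (2 / m.+1%:R) <=
    `|C| * ((2 / rho) ^+ n.+1 * (3 ^+ n.+1 * 'C(m, n.+1)%:R)).
  have h4 : C * B <= `|C| * ((2 / rho) ^+ n.+1 * (3 ^+ n.+1 * 'C(m, n.+1)%:R)).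
    rewrite (le_trans (ler_wpM2r B0 (ler_norm C)))// ler_wpM2l// /B ler_wpM2l//.
    by rewrite exprn_ge0// divr_ge0// ltW.
  apply: le_trans h4; apply: le_trans h2.
  have mmm : (2 * m - m)%N = m by rewrite mul2n -addnn addnK.
  rewrite cosm /torus_coef mmm mulNr expRN -/E opprK; apply: ler_wpM2r.
    by rewrite divr_ge0.
  apply: ler_wpM2r; last exact: bn.
  by rewrite divr_ge0 ?(ltW cm0) ?(ltW E0).
pose Z := G ^+ n; have Z0 : 0 < Z by exact: exprn_gt0.
pose F := E * m.+1%:R / (2 * Z * 'C(m, n.+1)%:R).
have F0 : 0 <= F.
  by rewrite divr_ge0 ?mulr_ge0 ?(ltW E0) ?(ltW Z0).
have -> : expR 3 ^+ n = (G * expR 3) ^+ n * ('C(m, n.+1)%:R / E) * (2 / m.+1%:R) * F.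
  rewrite exprMn -/Z /F; move: ('C(m, n.+1)%:R : R) cm0 (m.+1%:R : R) m1 => c c0' y y0.
  by field; rewrite !lt0r_neq0.
apply: (le_trans (ler_wpM2r F0 h3)).
have -> : `|C| * ((2 / rho) ^+ n.+1 * (3 ^+ n.+1 * 'C(m, n.+1)%:R)) * F =
    `|C| * G / 2 * (m.+1%:R * E).
  have -> : (2 / rho) ^+ n.+1 * (3 ^+ n.+1 * 'C(m, n.+1)%:R) = G * Z * 'C(m, n.+1)%:R.
    rewrite mulrA -exprMn /Z -exprS; congr (_ ^+ _ * _).
    by rewrite /G; field; exact: lt0r_neq0.
  rewrite /F; move: ('C(m, n.+1)%:R : R) cm0 (m.+1%:R : R) m1 => c c0' y y0.
  by field; rewrite !lt0r_neq0.
have CG : 0 <= `|C| * G / 2 by rewrite divr_ge0// mulr_ge0// ltW.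
rewrite -[leRHS]mulrA -[leRHS]mulrA ler_wpM2l//.
rewrite mulrA; apply: ler_pM; [exact: ler0n|exact: ltW| |exact: E_le].
by rewrite -natrM ler_nat.
Qed.

End TorusFinal.

Unset Implicit Arguments.

Theorem theorem1p3 (R : realType) (alpha : R) (halpha : 0 <= alpha < 1)
    (Omega : ambient) (omega : set R)
    (omega_sub : subset_of_ambient Omega omega)
    (omega_open : open omega)
    (omega_compl : interior (~` omega) !=set0)
    (S : R -> (R -> R[i]) -> R -> R[i])
    (S_gen : semigroup_generated_by (ambient_domain Omega)
               (minus_frac_laplacian Omega alpha) S)
    (T : R) (T_gt0 : 0 < T) :
  ~ null_controllable (ambient_domain Omega) S omega T.
Proof.
have momega : @measurable _ (measurableTypeR R) omega by exact: open_measurable.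
case: Omega omega_sub S_gen => /= omega_sub S_gen.
- exact: (line_not_null_controllable halpha omega_compl momega S_gen T_gt0).
- exact: (torus_not_null_controllable halpha omega_compl momega omega_sub S_gen T_gt0).
Qed.
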